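(* Let $m\ge2$. The canonical solution operator $S_m:A^2(\mathbb C,e^{-|z|^m})\to L^2(\mathbb C,e^{-|z|^m})$ to $\overline\partial$ is compact if and only if $$\lim_{k\to\infty}\left(\frac{c_{k+1}^2}{c_k^2}-\frac{c_k^2}{c_{k-1}^2}\right)=0,$$ where $c_k^2=\int_{\mathbb C}|z|^{2k}e^{-|z|^m}\,d\lambda(z)$.
   Context: For $m>0$, $L^2(\mathbb C,e^{-|z|^m})$ is the space of measurable $u$ with $\int_{\mathbb C}|u|^2e^{-|z|^m}d\lambda<\infty$ ($d\lambda$ Lebesgue measure), and $A^2(\mathbb C,e^{-|z|^m})$ its closed subspace of entire functions. The canonical solution operator $S_m$ assigns to $f\in A^2(\mathbb C,e^{-|z|^m})$ the unique $u\in L^2(\mathbb C,e^{-|z|^m})$ with $\overline\partial u=f$ and $u\perp A^2(\mathbb C,e^{-|z|^m})$ (for $m\ge2$ this is a bounded operator). *)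

(* Defs.v *)
(* The complex plane is modelled as R * R (with the
   product of two copies of Lebesgue measure on R); complex values live in
   R[i] (mathcomp-real-closed). *)
From mathcomp Require Import all_boot all_algebra.
From mathcomp Require Import all_classical all_reals all_analysis.
From mathcomp Require Import complex.
Import GRing.Theory Num.Theory numFieldNormedType.Exports.

Set Implicit Arguments.
Unset Strict Implicit.
Unset Printing Implicit Defensive.

Local Open Scope classical_set_scope.
Local Open Scope ring_scope.
Local Open Scope complex_scope.

Section Weighted.
Variable R : realType.

Definition lam2 := ((@lebesgue_measure R) \x (@lebesgue_measure R))%E.

Definition toC (p : R * R) : R[i] := p.1 +i* p.2.

Definition sqmod (a : R[i]) : R := (complex.Re a) ^+ 2 + (complex.Im a) ^+ 2.
Definition cmod (a : R[i]) : R := Num.sqrt (sqmod a).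

Definition absz (p : R * R) : R := cmod (toC p).

Definition weight (m : R) (p : R * R) : R := expR (- (absz p `^ m)).

Definition cmeasurable (u : R * R -> R[i]) : Prop :=
  measurable_fun setT (fun p => complex.Re (u p)) /\
  measurable_fun setT (fun p => complex.Im (u p)).

Definition cint (g : R * R -> R[i]) : R[i] :=
  (Rintegral lam2 setT (fun p => complex.Re (g p))) +i*
  (Rintegral lam2 setT (fun p => complex.Im (g p))).

Definition L2w (m : R) (u : R * R -> R[i]) : Prop :=
  cmeasurable u /\
  (\int[lam2]_p ((sqmod (u p) * weight m p)%:E) < +oo)%E.

Definition L2norm2 (m : R) (u : R * R -> R[i]) : R :=
  Rintegral lam2 setT (fun p => sqmod (u p) * weight m p).

Definition inner (m : R) (u v : R * R -> R[i]) : R[i] :=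
  cint (fun p => u p * (v p)^* * (weight m p)%:C).

Definition entire (h : R * R -> R[i]) : Prop :=
  forall p : R * R, exists l : R[i], forall e : R, 0 < e ->
    exists2 d : R, 0 < d & forall q : R * R, q != p ->
      cmod (toC q - toC p) < d ->
      cmod ((h q - h p) / (toC q - toC p) - l) < e.

Definition A2w (m : R) (h : R * R -> R[i]) : Prop := entire h /\ L2w m h.

Definition ex : R * R := (1, 0).
Definition ey : R * R := (0, 1).

Fixpoint iter_partial (ds : seq bool) (f : R * R -> R) : R * R -> R :=
  match ds with
  | [::] => f
  | b :: ds' => fun x => 'D_(if b then ex else ey) (iter_partial ds' f) x
  end.

Definition smooth (f : R * R -> R) : Prop :=
  (forall ds : seq bool, continuous (iter_partial ds f)) /\
  (forall (ds : seq bool) (x : R * R),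
      derivable (iter_partial ds f) x ex /\ derivable (iter_partial ds f) x ey).

Definition test_fun (phi : R * R -> R) : Prop :=
  smooth phi /\ exists r : R, forall p, r < absz p -> phi p = 0.

Definition dbar (phi : R * R -> R) (p : R * R) : R[i] :=
  ('D_ex phi p / 2) +i* ('D_ey phi p / 2).

Definition weak_dbar (u f : R * R -> R[i]) : Prop :=
  forall phi, test_fun phi ->
    cint (fun p => u p * dbar phi p) = - cint (fun p => f p * (phi p)%:C).

(* u = S_m f : the canonical (L^2-minimal) solution of dbar u = f *)
Definition canonical_solution (m : R) (f u : R * R -> R[i]) : Prop :=
  L2w m u /\ weak_dbar u f /\ (forall h, A2w m h -> inner m u h = 0).

Definition Sm_compact (m : R) : Prop :=
  forall (f u : nat -> R * R -> R[i]),
    (forall n, A2w m (f n)) ->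
    (exists M : R, forall n, L2norm2 m (f n) <= M) ->
    (forall n, canonical_solution m (f n) (u n)) ->
    exists (s : nat -> nat) (v : R * R -> R[i]),
      (forall n, (s n < s n.+1)%N) /\ L2w m v /\
      (fun n => L2norm2 m (fun p => u (s n) p - v p)) @ \oo --> (0 : R).

Definition ck2 (m : R) (k : nat) : R :=
  Rintegral lam2 setT (fun p => absz p ^+ (2 * k) * weight m p).

End Weighted.

(* Main.v *)
(* The monomials z^k are orthogonal with |z^k|^2 = c_k^2, and the canonical
   solution of dbar u = z^k is s_k = z^k zbar - (c_k^2 / c_{k-1}^2) z^{k-1}.
   The s_k are pairwise orthogonal and
   |s_k|^2 / c_k^2 = c_{k+1}^2 / c_k^2 - c_k^2 / c_{k-1}^2, so S_m is diagonal
   with these squared singular values, and it is compact if and only if they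
   tend to 0.

   The analytic point is that f = sum a_k z^k entails S_m f = sum a_k s_k in L^2.
   Both f minus its orthogonal expansion and u minus sum a_k s_k are weakly
   dbar-closed and orthogonal to all z^j, so it suffices that such a w is null.
   Testing dbar w = 0 against z^n K(|z|^2) and zbar^n N(|z|^2) shows that all
   integrals of w z^a zbar^b H(|z|^2) vanish for H smooth with compact support in
   ]0, +oo[; the polynomials (1 - s^N)^(N 2^N) tend boundedly to the indicator
   of s < 1/2, hence w H(|z|^2) has integral zero over every quadrant.  No power
   series, polar coordinates or Weyl lemma are needed.  The weak equations for
   entire functions come from Goursat's bisection, which yields the divergence
   theorem for fields that are merely differentiable. *)
Require Import Defs.
From HB Require Import structures.
From mathcomp Require Import all_boot all_order all_algebra.
From mathcomp Require Import all_classical all_reals all_analysis.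
From mathcomp Require Import measurable_realfun complex ring lra.
Import Order.TTheory GRing.Theory Num.Theory numFieldNormedType.Exports.
Set Implicit Arguments.
Unset Strict Implicit.
Unset Printing Implicit Defensive.
Local Open Scope classical_set_scope.
Local Open Scope ring_scope.

(** Three obstacles shape the argument. [entire] is bare pointwise complex differentiability, so the
    partial derivatives of h cannot be taken to be continuous; the divergence theorem still applies
    because dbar (h phi) = h dbar phi is continuous. Weak equations are integrals against test
    functions, while series converge in weighted L^2; rewriting the integral against G as the inner
    product with conj(G) / W lets the equations pass to the limit. Finally the weight exp(-t^(m/2)),
    t = |z|^2, is in general not smooth at t = 0, so it cannot enter a test function there: radial
    profiles are supported away from 0, and a cutoff is removed afterwards by dominated convergence.
    Heuristically a weakly closed w is a sum of a_n z^n, and pairing it with zbar^j H(|z|^2) gives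
    a_j times the integral of |z|^(2j) H. This proportionality is obtained by comparing w with the
    constant function 1, and orthogonality to z^j then reads a_j = 0. For compactness, small tails
    of the singular values give uniform approximation by finite sums; conversely, large singular
    values give normalised monomials whose images are orthogonal and bounded away from 0. *)

HB.instance Definition _ (R : realType) := Measure.on (@lam2 R).

(** * Continuous functions on the plane and integrals over boxes *)

Section PlaneMeasure.
Variable R : realType.
Implicit Types (f g : R * R -> R) (p q : R * R).

Lemma cont2P f p : {for p, continuous f} <->
  forall e : R, 0 < e -> exists2 d : R, 0 < d &
    forall q, `|q.1 - p.1| < d -> `|q.2 - p.2| < d -> `|f q - f p| < e.
Proof.
split=> [cf e e0|cf].
  have /cvgrPdist_lt/(_ e e0) := cf.
  rewrite -nbhs_ballE => -[d /= d0 dP]; exists d => // q q1 q2.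
  rewrite distrC; apply: dP; split => /=; by rewrite /ball /= distrC.
apply/cvgrPdist_lt => e e0; have [d d0 dP] := cf e e0.
exists (ball p.1 d, ball p.2 d); first by split; exact: nbhsx_ballx.
move=> q [/= q1 q2]; rewrite /ball/= in q1 q2.
by rewrite distrC; apply: dP; rewrite distrC.
Qed.

(** The sigma-algebra on the plane is the product one, so an open set is exhibited as a countable
    union of squares with rational centre and radius. *)
Lemma open2_measurable (A : set (R * R)) : open A -> measurable A.
Proof.
move=> oA.
pose box (t : rat * rat * rat) : set (R * R) :=
  `](ratr t.1.1 - ratr t.2), (ratr t.1.1 + ratr t.2)[ `*`
  `](ratr t.1.2 - ratr t.2), (ratr t.1.2 + ratr t.2)[.
have -> : A = \bigcup_a \bigcup_b \bigcup_c
    (if `[< box (a, b, c) `<=` A >] then box (a, b, c) else set0).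
  apply/seteqP; split => p.
    move=> Ap.
    have : nbhs p A by apply: open_nbhs_nbhs.
    rewrite -nbhs_ballE => -[e /= e0 eA].
    have [c] := @rat_in_itvoo R 0 (e / 2) ltac:(by rewrite divr_gt0).
    rewrite in_itv/= => /andP[c0 ce].
    have [a] := @rat_in_itvoo R (p.1 - ratr c) p.1 ltac:(by rewrite ltrBlDr ltrDl).
    rewrite in_itv/= => /andP[a1 a2].
    have [b] := @rat_in_itvoo R (p.2 - ratr c) p.2 ltac:(by rewrite ltrBlDr ltrDl).
    rewrite in_itv/= => /andP[b1 b2].
    exists a => //; exists b => //; exists c => //.
    case: asboolP => [_|]; last first.
      case => q [] /=; rewrite !in_itv/= => /andP[q1 q2] /andP[q3 q4].
      by apply: eA; split => /=; rewrite /ball/= ltr_norml; lra.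
    by split => /=; rewrite in_itv/=; lra.
  move=> [a _] [b _] [c _]; case: asboolP => // + ?; exact.
apply: bigcupT_measurable_rat => a; apply: bigcupT_measurable_rat => b.
apply: bigcupT_measurable_rat => c; case: ifP => // _.
by apply: measurableX; exact: measurable_itv.
Qed.

Lemma cont2_measurable f : continuous f -> measurable_fun setT f.
Proof.
move=> /continuousP cf; apply: (measurability _ (measurable_realfun.RGenOInfty.measurableE R)).
move=> _ [_ [a ->] <-]; rewrite setTI; apply: open2_measurable.
by apply: cf; exact: interval_open.
Qed.

(** Boxes are half-open so that the quarters of a square partition it exactly. *)
Lemma lam2_box (a b c d : R) (h1 : a <= b) (h2 : c <= d) :
  lam2 (`]a, b] `*` `]c, d]) = ((b - a) * (d - c))%:E.
Proof.
rewrite /lam2 product_measure1E; last 2 first;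
  [exact: measurable_itv|exact: measurable_itv|].
have L (x y : R) : x <= y -> lebesgue_measure (`]x, y] : set R) = (y - x)%:E.
  move=> xy; rewrite lebesgue_measure_itv/= lte_fin.
  by case: ltgtP xy => // -> _; rewrite subrr.
by rewrite /= L// L.
Qed.

Lemma Rintegral_close d (T : measurableType d) (mu : {measure set T -> \bar R})
    (A : set T) (F : T -> R) (l e v : R) : measurable A -> mu A = v%:E ->
  mu.-integrable A (EFin \o F) -> (forall x, A x -> `|F x - l| <= e) ->
  `|(\int[mu]_(x in A) F x) - l * v| <= e * v.
Proof.
move=> mA Av iF Fl.
have Cv c : \int[mu]_(x in A) c = c * v by rewrite Rintegral_cst// Av.
have iC c : mu.-integrable A (EFin \o fun _ : T => c).
  apply: measurable_bounded_integrable => //; first by rewrite Av ltry.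
  by exists `|c|; split; [exact: num_real|move=> M cM x _ /=; exact: ltW].
have -> : (\int[mu]_(x in A) F x) - l * v = \int[mu]_(x in A) (F x - l).
  by rewrite -(Cv l) -RintegralB.
have iFl : mu.-integrable A (EFin \o (fun x => F x - l)).
  by have := integrableB mA iF (iC l); apply: eq_integrable => // x _ /=; rewrite EFinB.
apply: le_trans (le_normr_Rintegral mA iFl) _.
rewrite -Cv; apply: le_Rintegral => //.
by have := integrable_norm iFl; apply: eq_integrable.
Qed.

Lemma cont2_box_integrable f a b c d : continuous f ->
  (@lam2 R).-integrable (`]a, b] `*` `]c, d]) (EFin \o f).
Proof.
move=> cf.
have [ab|ba] := leP a b; last first.
  have -> : `]a, b] `*` `]c, d] = set0 :> set (R * R).
    by apply/seteqP; split => // -[x y] [/=]; rewrite in_itv/=; lra.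
  exact: integrable_set0.
have [cd|dc] := leP c d; last first.
  have -> : `]a, b] `*` `]c, d] = set0 :> set (R * R).
    by apply/seteqP; split => // -[x y] [/= _]; rewrite in_itv/=; lra.
  exact: integrable_set0.
apply: measurable_bounded_integrable.
- by apply: measurableX; exact: measurable_itv.
- by rewrite [X in (X < _)%E](lam2_box ab cd) ltry.
- by apply: measurable_funTS; exact: cont2_measurable.
have K : compact (`[a, b] `*` `[c, d] : set (R * R)).
  by apply: compact_setX; exact: segment_compact.
have := compact_bounded (continuous_compact (continuous_subspaceT cf) K).
move=> [M [Mr MP]]; exists M; split => // N MN p [/= p1 p2].
apply: MP => //; exists p => //; split => /=;
  [move: p1|move: p2]; by rewrite !in_itv/= => /andP[/ltW -> ->].
Qed.

Lemma cont1_itv_integrable (f : R -> R) (a b : R) : continuous f ->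
  (@lebesgue_measure R).-integrable (`]a, b] : set R) (EFin \o f).
Proof.
move=> cf; have icc : (@lebesgue_measure R).-integrable `[a, b] (EFin \o f).
  apply: continuous_compact_integrable; first exact: segment_compact.
  exact: continuous_subspaceT.
by apply: integrableS icc => //; apply: subset_itvr; rewrite bnd_simp.
Qed.

End PlaneMeasure.

(** * The divergence theorem for differentiable fields *)

Section PlaneCalculus.
Variable R : realType.
Implicit Types (f g P Q : R * R -> R) (p q : R * R).

(* Carathéodory's form of differentiability: a and b are the partial derivatives. *)
Definition rdiff f p (a b : R) : Prop := exists A B : R * R -> R,
  [/\ {for p, continuous A}, {for p, continuous B}, A p = a, B p = b &
      forall q, f q = f p + A q * (q.1 - p.1) + B q * (q.2 - p.2)].

Lemma cont_fst p : {for p, continuous (fun q : R * R => q.1)}.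
Proof. by apply/cont2P => e e0; exists e. Qed.

Lemma cont_snd p : {for p, continuous (fun q : R * R => q.2)}.
Proof. by apply/cont2P => e e0; exists e. Qed.

Lemma contD2 f g p : {for p, continuous f} -> {for p, continuous g} ->
  {for p, continuous (fun q => f q + g q)}.
Proof. by move=> cf cg; apply: cvgD. Qed.

Lemma contN2 f p : {for p, continuous f} -> {for p, continuous (fun q => - f q)}.
Proof. by move=> cf; apply: cvgN. Qed.

Lemma contM2 f g p : {for p, continuous f} -> {for p, continuous g} ->
  {for p, continuous (fun q => f q * g q)}.
Proof. by move=> cf cg; apply: cvgM. Qed.

Lemma contC2 (c : R) p : {for p, continuous (fun _ : R * R => c)}.
Proof. exact: cvg_cst. Qed.

Lemma rdiff_cont f p a b : rdiff f p a b -> {for p, continuous f}.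
Proof.
move=> [A [B [cA cB _ _ fE]]].
rewrite (_ : f = fun q => f p + A q * (q.1 - p.1) + B q * (q.2 - p.2)); last first.
  exact/funext.
have cx : {for p, continuous (fun q : R * R => q.1 - p.1)}.
  by apply: (@contD2 fst (fun=> - p.1)); [exact: cont_fst|exact: contC2].
have cy : {for p, continuous (fun q : R * R => q.2 - p.2)}.
  by apply: (@contD2 snd (fun=> - p.2)); [exact: cont_snd|exact: contC2].
have cAx := contM2 cA cx; have cBy := contM2 cB cy.
apply: (@contD2 (fun q => f p + A q * (q.1 - p.1)) (fun q => B q * (q.2 - p.2))) => //.
by apply: (@contD2 (fun=> f p)); [exact: contC2|].
Qed.

Lemma rdiffD f g p a b c d : rdiff f p a b -> rdiff g p c d ->
  rdiff (fun q => f q + g q) p (a + c) (b + d).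
Proof.
move=> [A [B [cA cB <- <- fE]]] [C [D [cC cD <- <- gE]]].
exists (fun q => A q + C q), (fun q => B q + D q); split => //; [exact: contD2 cA cC|exact: contD2 cB cD|].
by move=> q; rewrite fE gE; ring.
Qed.

Lemma rdiffM f g p a b c d : rdiff f p a b -> rdiff g p c d ->
  rdiff (fun q => f q * g q) p (a * g p + f p * c) (b * g p + f p * d).
Proof.
move=> fd; have cf := rdiff_cont fd.
move: fd => [A [B [cA cB <- <- fE]]] [C [D [cC cD <- <- gE]]].
(* f q g q - f p g p = (f q - f p) g p + f q (g q - g p): freezing [g] at [p] leaves only the
   continuity of [f] to be used. *)
exists (fun q => A q * g p + f q * C q), (fun q => B q * g p + f q * D q).
have cg := @contC2 (g p) p.
split => //.
- exact: contD2 (contM2 cA cg) (contM2 cf cC).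
- exact: contD2 (contM2 cB cg) (contM2 cf cD).
move=> q; rewrite [g q]gE mulrDr mulrDr.
by rewrite {1}fE; ring.
Qed.

Lemma rdiff_cst (c : R) p : rdiff (fun=> c) p 0 0.
Proof.
by exists (fun=> 0), (fun=> 0); split; try exact: contC2; move=> // q; ring.
Qed.

Lemma rdiff_fst p : rdiff fst p 1 0.
Proof.
by exists (fun=> 1), (fun=> 0); split; try exact: contC2; move=> // q; ring.
Qed.

Lemma rdiff_snd p : rdiff snd p 0 1.
Proof.
by exists (fun=> 0), (fun=> 1); split; try exact: contC2; move=> // q; ring.
Qed.

Lemma rdiffN f p a b : rdiff f p a b -> rdiff (fun q => - f q) p (- a) (- b).
Proof.
move=> [A [B [cA cB <- <- fE]]].
exists (fun q => - A q), (fun q => - B q); split => //; [exact: contN2 cA|exact: contN2 cB|].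
by move=> q; rewrite fE; ring.
Qed.

Lemma is_derive_quot f p (v : R * R) (A : R * R -> R) : {for p, continuous A} ->
  (forall h : R, f (h *: v + p) = f p + A (h *: v + p) * h) -> is_derive p v f (A p).
Proof.
move=> cA fE.
have L : (fun h : R => h^-1 *: ((f \o shift p) (h *: v) - f p)) @ 0^' --> A p.
  have cA' : (fun h : R => A (h *: v + p)) @ 0^' --> A p.
    have C : {for 0, continuous (fun h : R => A (h *: v + p))}.
      apply: continuous_comp; last by rewrite scale0r add0r.
      by apply: cvgD; [apply: cvgZr_tmp; exact: cvg_id|exact: cvg_cst].
    by apply: cvg_trans (cvg_within_filter _ C) _; rewrite scale0r add0r.
  apply: cvg_trans cA'; apply: near_eq_cvg; near=> h.
  rewrite /= fE addrAC subrr add0r /GRing.scale/= mulrCA mulVf ?mulr1//.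
  by near: h; exact: nbhs_dnbhs_neq.
by apply: DeriveDef; [exact: cvgP L|exact: (cvg_lim _ L)].
Unshelve. all: by end_near. Qed.

Lemma rdiff_derive_x f p a b : rdiff f p a b -> is_derive p (ex R) f a.
Proof.
move=> [A [B [cA cB <- _ fE]]]; apply: is_derive_quot => // h.
by rewrite fE /ex /= /GRing.scale/=; ring.
Qed.

Lemma rdiff_derive_y f p a b : rdiff f p a b -> is_derive p (ey R) f b.
Proof.
move=> [A [B [cA cB _ <- fE]]]; apply: is_derive_quot => // h.
by rewrite fE /ey /= /GRing.scale/=; ring.
Qed.

Lemma cont_slice_x f (y : R) : continuous f -> continuous (fun x => f (x, y)).
Proof.
move=> cf x; apply/cvgrPdist_lt => e e0.
have /cont2P/(_ e e0)[d d0 dP] := cf (x, y).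
exists d => //= t; rewrite /= distrC => td; rewrite distrC; apply: dP => //=.
by rewrite subrr normr0.
Qed.

Lemma cont_slice_y f (x : R) : continuous f -> continuous (fun y => f (x, y)).
Proof.
move=> cf y; apply/cvgrPdist_lt => e e0.
have /cont2P/(_ e e0)[d d0 dP] := cf (x, y).
exists d => //= t; rewrite /= distrC => td; rewrite distrC; apply: dP => //=.
by rewrite subrr normr0.
Qed.

End PlaneCalculus.

Section DivergenceTheorem.
Variable R : realType.

Let sum4_lt (e h x y z t : R) : `|x| < e * h ^+ 2 -> `|y| < e * h ^+ 2 ->
  `|z| < e * h ^+ 2 -> `|t| < e * h ^+ 2 -> `|x + y + z + t| < e * (h + h) ^+ 2.
Proof.
move=> hx hy hz ht; have -> : e * (h + h) ^+ 2 =
  e * h ^+ 2 + e * h ^+ 2 + e * h ^+ 2 + e * h ^+ 2 by ring.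
apply: le_lt_trans (ler_normD _ _) _; apply: ler_ltD ht => //.
apply: ltW; apply: le_lt_trans (ler_normD _ _) _; apply: ltrD hz.
by apply: le_lt_trans (ler_normD _ _) _; exact: ltrD.
Qed.

Let within_side (a s x y d : R) : a <= x <= a + s -> a <= y <= a + s -> s < d ->
  `|x - y| < d.
Proof. by move=> /andP[? ?] /andP[? ?] ?; rewrite ltr_norml; apply/andP; split; lra. Qed.

Let norm_le_corners (e s X Y Z W u v w : R) : `|X| <= e -> `|Y| <= e -> `|Z| <= e ->
  `|W| <= e -> `|u| <= s -> `|v| <= s -> `|w| <= s ->
  `|X * u - Y * v + (Z - W) * w| <= 4 * e * s.
Proof.
move=> hX hY hZ hW hu hv hw.
apply: (@le_trans _ _ (e * s + e * s + (e + e) * s)); last by rewrite le_eqVlt; apply/orP; left; apply/eqP; ring.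
apply: le_trans (ler_normD _ _) _; apply: lerD; last first.
  by rewrite normrM ler_pM//; apply: le_trans (ler_normB _ _) _; exact: lerD.
by apply: le_trans (ler_normB _ _) _; rewrite !normrM; apply: lerD; exact: ler_pM.
Qed.

Variables P Q g : R * R -> R.
Hypothesis div : forall p, exists a b c d,
  [/\ rdiff P p a b, rdiff Q p c d & g p = a + d].
Hypothesis gc : continuous g.

Let cP : continuous P.
Proof. by move=> p; have [a [b [c [d [/rdiff_cont]]]]] := div p. Qed.
Let cQ : continuous Q.
Proof. by move=> p; have [a [b [c [d [_ /rdiff_cont]]]]] := div p. Qed.

(* D is the flux of (P, Q) through the boundary of a square minus the integral
   of its divergence; it is additive under bisection. *)
Let V (x c h : R) := \int[@lebesgue_measure R]_(y in `]c, c + h]) P (x, y).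
Let H (y a h : R) := \int[@lebesgue_measure R]_(x in `]a, a + h]) Q (x, y).
Let I (a c h k : R) := \int[@lam2 R]_(p in `]a, a + h] `*` `]c, c + k]) g p.
Let D (a c s : R) := (V (a + s) c s - V a c s) + (H (c + s) a s - H c a s) - I a c s s.

Let ocU (c h : R) : 0 < h ->
  `]c, c + (h + h)]%classic = `]c, c + h] `|` `]c + h, c + h + h] :> set R.
Proof.
move=> h0; apply/seteqP; split => x; rewrite /= !in_itv/=.
  by move=> /andP[x1 x2]; have [xh|xh] := leP x (c + h); [left|right]; apply/andP; split => //; lra.
by move=> []/andP[x1 x2]; apply/andP; split; lra.
Qed.

Let ocD (c h : R) : [disjoint `]c, c + h]%classic & `]c + h, c + h + h]%classic : set R].
Proof.
by apply/disj_setPLR => x /=; rewrite !in_itv/= => /andP[x1 x2]; apply/negP; lra.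
Qed.

Let Rint1_split (f : R -> R) (c h : R) : continuous f -> 0 < h ->
  \int[@lebesgue_measure R]_(y in `]c, c + (h + h)]) f y =
  \int[@lebesgue_measure R]_(y in `]c, c + h]) f y +
  \int[@lebesgue_measure R]_(y in `]c + h, c + h + h]) f y.
Proof.
move=> cf h0; rewrite ocU// Rintegral_setU//.
by rewrite -ocU//; exact: cont1_itv_integrable.
Qed.

Let V_split x c h : 0 < h -> V x c (h + h) = V x c h + V x (c + h) h.
Proof. by move=> h0; rewrite /V Rint1_split//; exact: cont_slice_y. Qed.

Let H_split y a h : 0 < h -> H y a (h + h) = H y a h + H y (a + h) h.
Proof. by move=> h0; rewrite /H Rint1_split//; apply: cont_slice_x. Qed.

Let I_split a c h : 0 < h ->
  I a c (h + h) (h + h) = I a c h h + I (a + h) c h h + I a (c + h) h h + I (a + h) (c + h) h h.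
Proof.
move=> h0; have mX (x y z t : R) : measurable (`]x, y] `*` `]z, t] : set (R * R)).
  by apply: measurableX; exact: measurable_itv.
have setXUl (A B C : set R) : (A `|` B) `*` C = (A `*` C) `|` (B `*` C) :> set (R * R).
  by apply/seteqP; split => [[x y] [/= [Ax|Bx] Cy]|[x y] [[/= Ax Cy]|[/= Bx Cy]]];
    do ?[by left|by right|split => //].
have setXUr (A B C : set R) : C `*` (A `|` B) = (C `*` A) `|` (C `*` B) :> set (R * R).
  by apply/seteqP; split => [[x y] [/= Cy [Ax|Bx]]|[x y] [[/= Cy Ax]|[/= Cy Bx]]];
    do ?[by left|by right|split => //].
have E k : I a c (h + h) k = I a c h k + I (a + h) c h k.
  rewrite /I ocU// setXUl Rintegral_setU//; try exact: mX.
    by have := @cont2_box_integrable R g a (a + (h + h)) c (c + k) gc; rewrite ocU// setXUl.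
  apply/disj_setPLR => -[x y] [/= x1 y1] [/= x2 _].
  by have /disj_setPLR/(_ _ x1) := ocD a h.
have F b : I b c h (h + h) = I b c h h + I b (c + h) h h.
  rewrite /I ocU// setXUr Rintegral_setU//; try exact: mX.
    by have := @cont2_box_integrable R g b (b + h) c (c + (h + h)) gc; rewrite ocU// setXUr.
  apply/disj_setPLR => -[x y] [/= y1 x1] [/= _ x2].
  by have /disj_setPLR/(_ _ x1) := ocD c h.
by rewrite E !F; ring.
Qed.

Let D_split a c h : 0 < h ->
  D a c (h + h) = D a c h + D (a + h) c h + D a (c + h) h + D (a + h) (c + h) h.
Proof.
by move=> h0; rewrite /D I_split// !V_split// !H_split// !addrA; clear; ring.
Qed.

(** If every quarter had defect below e h^2, [sum4_lt] would put the whole below e (2h)^2. *)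
Let D_bisect a c h e : 0 < h -> e * (h + h) ^+ 2 <= `|D a c (h + h)| ->
  exists q : R * R, [/\ a <= q.1 <= a + h, c <= q.2 <= c + h &
    e * h ^+ 2 <= `|D q.1 q.2 h|].
Proof.
move=> h0; rewrite D_split// => B.
have l0 (x : R) : x <= x <= x + h by rewrite lexx lerDl ltW.
have l1 (x : R) : x <= x + h <= x + h by rewrite lexx lerDl ltW.
have [h1|h1] := leP (e * h ^+ 2) `|D a c h|.
  by exists (a, c); split; [exact: l0|exact: l0|].
have [h2|h2] := leP (e * h ^+ 2) `|D (a + h) c h|.
  by exists (a + h, c); split; [exact: l1|exact: l0|].
have [h3|h3] := leP (e * h ^+ 2) `|D a (c + h) h|.
  by exists (a, c + h); split; [exact: l0|exact: l1|].
have [h4|h4] := leP (e * h ^+ 2) `|D (a + h) (c + h) h|.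
  by exists (a + h, c + h); split; [exact: l1|exact: l1|].
by move: B; rewrite leNgt sum4_lt.
Qed.

Let D_local p e : 0 < e -> exists2 d : R, 0 < d &
  forall a c s, 0 < s -> s < d -> a <= p.1 <= a + s -> c <= p.2 <= c + s ->
    `|D a c s| < e * s ^+ 2.
Proof.
(* Each of the two flux differences will cost 4 e' s^2 and the area integral e' s^2, in total 9 e'
   s^2; a tenth keeps the final inequality strict. *)
move=> e0; pose e' := e / 10; have e'0 : 0 < e' by rewrite divr_gt0.
have [a0 [b0 [c0 [d0 [[A [B [cA cB Aa Bb PE]]] [A' [B' [cA' cB' Aa' Bb' QE]]] gE]]]]] := div p.
have near (F : R * R -> R) : {for p, continuous F} -> exists2 d : R, 0 < d &
    forall q, `|q.1 - p.1| < d -> `|q.2 - p.2| < d -> `|F q - F p| <= e'.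
  by move=> /cont2P/(_ e' e'0)[d d0' dP]; exists d => // q q1 q2; exact/ltW/dP.
have [d1 d1p HA] := near _ cA; have [d2 d2p HB] := near _ cB.
have [d3 d3p HA'] := near _ cA'; have [d4 d4p HB'] := near _ cB'.
have [d5 d5p Hg] := near _ (@gc p).
exists (Num.min d1 (Num.min d2 (Num.min d3 (Num.min d4 d5)))); first by rewrite !lt_min; lra.
move=> a c s s0; rewrite !lt_min => /and5P[s1 s2 s3 s4 s5] /andP[ap pa] /andP[cp pc].
have l0 (x : R) : x <= x <= x + s by rewrite lexx lerDl ltW.
have l1 (x : R) : x <= x + s <= x + s by rewrite lexx lerDl ltW.
have ca : a <= p.1 <= a + s by rewrite ap.
have cc : c <= p.2 <= c + s by rewrite cp.
have cl (x y d : R) : a <= x <= a + s -> c <= y <= c + s -> s < d ->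
    `|x - p.1| < d /\ `|y - p.2| < d.
  by move=> hx hy sd; split; [exact: within_side hx ca sd|exact: within_side hy cc sd].
have cs (b x y : R) : b <= x <= b + s -> b <= y <= b + s -> `|x - y| <= s.
  by move=> hx hy; rewrite leNgt; apply/negP => h; have := within_side hx hy h; rewrite ltxx.
have muI (x : R) : (@lebesgue_measure R) `]x, x + s]%classic = s%:E.
  by rewrite lebesgue_measure_itv/= lte_fin ltrDl s0 -EFinD addrAC subrr add0r.
have VE : `|(V (a + s) c s - V a c s) - a0 * s * s| <= 4 * e' * s * s.
  rewrite /V -RintegralB//; try (apply: cont1_itv_integrable; exact: cont_slice_y).
  apply: (@Rintegral_close R _ _ _ _ _ _ _ s) => //; first exact: muI.
    by apply: cont1_itv_integrable => y; apply: cvgB; exact: cont_slice_y.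
  move=> y; rewrite /= in_itv/= => /andP[/ltW y1 y2].
  rewrite (PE (a + s, y)) (PE (a, y)) /=.
  (* The two points have the same height, so [B p] cancels and the slopes enter only through their
     deviation from their values at [p]. *)
  rewrite (_ : _ - _ = (A (a + s, y) - A p) * (a + s - p.1) - (A (a, y) - A p) * (a - p.1)
    + ((B (a + s, y) - B p) - (B (a, y) - B p)) * (y - p.2)); last by rewrite Aa; ring.
  have yc : c <= y <= c + s by rewrite y1.
  have [u1 u2] := cl _ _ _ (l1 a) yc s1; have [u3 u4] := cl _ _ _ (l0 a) yc s1.
  have [u5 u6] := cl _ _ _ (l1 a) yc s2; have [u7 u8] := cl _ _ _ (l0 a) yc s2.
  apply: norm_le_corners; [exact: HA|exact: HA|exact: HB|exact: HB|exact: cs (l1 a) ca|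
    exact: cs (l0 a) ca|exact: cs yc cc].
have HE : `|(H (c + s) a s - H c a s) - d0 * s * s| <= 4 * e' * s * s.
  rewrite /H -RintegralB//; try (apply: cont1_itv_integrable; exact: cont_slice_x).
  apply: (@Rintegral_close R _ _ _ _ _ _ _ s) => //; first exact: muI.
    by apply: cont1_itv_integrable => y; apply: cvgB; exact: cont_slice_x.
  move=> x; rewrite /= in_itv/= => /andP[/ltW x1 x2].
  rewrite (QE (x, c + s)) (QE (x, c)) /=.
  rewrite (_ : _ - _ = (B' (x, c + s) - B' p) * (c + s - p.2) - (B' (x, c) - B' p) * (c - p.2)
    + ((A' (x, c + s) - A' p) - (A' (x, c) - A' p)) * (x - p.1)); last by rewrite Bb'; ring.
  have xc : a <= x <= a + s by rewrite x1.
  have [u1 u2] := cl _ _ _ xc (l1 c) s3; have [u3 u4] := cl _ _ _ xc (l0 c) s3.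
  have [u5 u6] := cl _ _ _ xc (l1 c) s4; have [u7 u8] := cl _ _ _ xc (l0 c) s4.
  apply: norm_le_corners; [exact: HB'|exact: HB'|exact: HA'|exact: HA'|exact: cs (l1 c) cc|
    exact: cs (l0 c) cc|exact: cs xc ca].
have IE : `|I a c s s - g p * (s * s)| <= e' * (s * s).
  apply: Rintegral_close.
  - by apply: measurableX; exact: measurable_itv.
  - by rewrite [LHS]lam2_box ?lerDl ?ltW// !(addrAC _ s) !subrr !add0r.
  - exact: cont2_box_integrable.
  - move=> [x y] [/=]; rewrite !in_itv/= => /andP[/ltW x1 x2] /andP[/ltW y1 y2].
    have xc : a <= x <= a + s by rewrite x1.
    have yc : c <= y <= c + s by rewrite y1.
    by have [z1 z2] := cl _ _ _ xc yc s5; exact: Hg.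
rewrite (_ : D a c s = ((V (a + s) c s - V a c s) - a0 * s * s)
  + ((H (c + s) a s - H c a s) - d0 * s * s) - (I a c s s - g p * (s * s))); last first.
  by rewrite /D gE; ring.
apply: le_lt_trans (ler_normB _ _) _.
apply: le_lt_trans (lerD (ler_normD _ _) (lexx _)) _.
apply: le_lt_trans (lerD (lerD VE HE) IE) _.
have -> : e * s ^+ 2 = 4 * e' * s * s + 4 * e' * s * s + e' * (s * s) + e' * s ^+ 2.
  by rewrite /e'; field.
by rewrite ltrDl mulr_gt0// exprn_gt0.
Qed.

(** Bisection yields nested squares whose defect per unit area never drops below that of the first
    one, which [D_local] forbids at their common point. *)
Let D_eq0 a c s : 0 < s -> D a c s = 0.
Proof.
move=> s0; apply/eqP/negPn/negP => Dneq0.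
pose sz n : R := s / 2 ^+ n.
have sz0 n : 0 < sz n by rewrite divr_gt0// exprn_gt0.
have szS n : sz n = sz n.+1 + sz n.+1.
  by rewrite /sz exprS; field; rewrite expf_neq0.
pose e := `|D a c s| / s ^+ 2.
have e0 : 0 < e by rewrite divr_gt0 ?normr_gt0// exprn_gt0.
pose bad n (q : R * R) := e * sz n ^+ 2 <= `|D q.1 q.2 (sz n)|.
have [|next nextP] := @choice (nat * (R * R))%type (R * R)%type (fun nq q' => bad nq.1 nq.2 ->
    [/\ nq.2.1 <= q'.1 <= nq.2.1 + sz nq.1.+1,
        nq.2.2 <= q'.2 <= nq.2.2 + sz nq.1.+1 & bad nq.1.+1 q']).
  move=> [n q] /=.
  have [bq|nbq] := pselect (bad n q); last by exists q => /nbq.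
  have [|q' q'P] := @D_bisect q.1 q.2 (sz n.+1) e (sz0 _); last by exists q'.
  by rewrite -szS.
pose fix x (n : nat) : R * R := if n is n'.+1 then next (n', x n') else (a, c).
have xbad n : bad n (x n).
  elim: n => [|n IH]; last by have [] := nextP (n, x n) IH.
  by rewrite /bad /= /sz expr0 divr1 /e mulfVK// expf_neq0// gt_eqF.
have x1 n : (x n).1 <= (x n.+1).1 <= (x n).1 + sz n.+1 by have [] := nextP (n, x n) (xbad n).
have x2 n : (x n).2 <= (x n.+1).2 <= (x n).2 + sz n.+1 by have [] := nextP (n, x n) (xbad n).
have nested (y : nat -> R) : (forall n, y n <= y n.+1 <= y n + sz n.+1) ->
    exists l, forall n, y n <= l <= y n + sz n.
  move=> yP.
  have up n k : y n <= y (n + k)%N /\ y (n + k)%N + sz (n + k)%N <= y n + sz n.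
    elim: k => [|k [IH1 IH2]]; first by rewrite addn0.
    rewrite addnS; have := szS (n + k)%N; have /andP[] := yP (n + k)%N; lra.
  have ub n k : y k <= y n + sz n.
    have [nk|/ltnW kn] := leqP n k.
      by have [] := up n (k - n)%N; rewrite subnKC// => _; have := sz0 k; lra.
    by have [] := up k (n - k)%N; rewrite subnKC// => ?; have := sz0 n; lra.
  exists (sup (range y)) => n; apply/andP; split.
    apply: ub_le_sup; last by exists n.
    by exists (y 0%N + sz 0%N) => _ [k _ <-].
  by apply: ge_sup; [exists (y 0%N); exists 0%N|move=> _ [k _ <-]].
have [l1 l1P] := nested _ x1; have [l2 l2P] := nested _ x2.
have [d d0 dP] := D_local (l1, l2) e0.
have [n nd] : exists n, sz n < d.
  have h2 : `|2^-1 : R| < 1 by rewrite ger0_norm ?invr_ge0// invf_lt1// ltr1n.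
  have /cvgrPdist_lt/(_ (d / s)) := @cvg_expr R (2^-1) h2.
  move=> /(_ ltac:(by rewrite divr_gt0)) [n _ /(_ n (leqnn _))] /=.
  rewrite sub0r normrN exprVn ger0_norm ?invr_ge0 ?exprn_ge0// ltr_pdivlMr// => h.
  by exists n; rewrite /sz mulrC.
have := dP _ _ _ (sz0 n) nd (l1P n) (l2P n).
by rewrite ltNge; move/negP; apply; exact: xbad.
Qed.

Theorem compact_divergence (r : R) :
  (forall p, (r < `|p.1|) || (r < `|p.2|) -> [/\ P p = 0, Q p = 0 & g p = 0]) ->
  \int[@lam2 R]_p g p = 0.
Proof.
(* With [+ 1] the boundary of the square lies strictly outside the support, so only the area term of
   [D] survives. *)
move=> supp; pose t := Num.max r 0 + 1.
have rt : r < t by rewrite /t ltr_pwDr// le_max lexx.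
have t0 : 0 < t by rewrite /t ltr_pwDr// le_max lexx orbT.
have := @D_eq0 (- t) (- t) (t + t) ltac:(by rewrite addr_gt0).
rewrite /D /V /H /I addKr.
have I0 (F : R -> R) A : (forall x, F x = 0) -> \int[@lebesgue_measure R]_(x in A) F x = 0.
  by move=> F0; under eq_Rintegral do rewrite F0; rewrite /Rintegral integral0.
have nt : r < `|t| by rewrite ger0_norm// ltW.
have PQ0 x : [/\ P (t, x) = 0, P (- t, x) = 0, Q (x, t) = 0 & Q (x, - t) = 0].
  split; [have [] := supp (t, x)|have [] := supp (- t, x)|
          have [] := supp (x, t)|have [] := supp (x, -t)] => //=;
  by rewrite ?normrN nt ?orbT.
rewrite !I0; try by move=> x; have [] := PQ0 x.
rewrite subrr addr0 sub0r => /eqP; rewrite oppr_eq0 => /eqP <-.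
rewrite [RHS]Rintegral_mkcond; apply: eq_Rintegral => -[x y] _.
rewrite patchE; case: ifPn => //; rewrite notin_setE => xy.
have [] := supp (x, y) _ => //=.
have [|xr] := ltP r `|x| => //=; have [|yr] := ltP r `|y| => //=.
exfalso; apply: xy; split => /=; rewrite in_itv/=; move: xr yr; rewrite !ler_norml; lra.
Qed.

End DivergenceTheorem.

(** * Smooth cutoff functions *)

Section Smooth1.
Variable R : realType.
Implicit Types (f g k : R -> R) (O : set R) (n : nat).

(** Differentiability classes are relative to a set so that inverses and real powers, smooth on ]0,
    +oo[ only, are covered; [smooth1_glue] extends across 0 afterwards. *)
Fixpoint Cn O n k : Prop :=
  if n is n'.+1 then (forall t, O t -> derivable k t 1) /\ Cn O n' (derive1 k)
  else forall t, O t -> {for t, continuous k}.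

Lemma open_near O (t : R) : open O -> O t -> \near t, O t.
Proof. by move=> oO Ot; apply: open_nbhs_nbhs. Qed.

Lemma eq_Cn O n f g : open O -> (forall t, O t -> f t = g t) -> Cn O n f -> Cn O n g.
Proof.
move=> oO; elim: n f g => [|n IH] f g fg /=.
  move=> cf t Ot; have := cf t Ot; rewrite /prop_for /continuous_at -fg//.
  apply: cvg_trans; apply: near_eq_cvg; near=> s.
  by rewrite fg//; near: s; exact: open_near.
have E t : O t -> \near t, f t = g t.
  by move=> Ot; near=> s; apply: fg; near: s; exact: open_near.
move=> [df Cf]; split=> [t Ot|].
  by apply: near_eq_derivable (df t Ot); exact: E.
by apply: IH Cf => t Ot; rewrite !derive1E; apply: near_eq_derive; exact: E.
Unshelve. all: by end_near. Qed.

Lemma Cn_intro O n f g : open O -> (forall t, O t -> is_derive t 1 f (g t)) ->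
  Cn O n g -> Cn O n.+1 f.
Proof.
move=> oO fg Cg; split=> [t Ot|]; first by have [] := fg t Ot.
by apply: eq_Cn Cg => // t Ot; rewrite derive1E; have [_ ->] := fg t Ot.
Qed.

Lemma derive_Cn O n f t : Cn O n.+1 f -> O t -> is_derive t 1 f (derive1 f t).
Proof. by move=> [df _] Ot; rewrite derive1E; exact/derivableP/df. Qed.

Lemma CnS O n f : Cn O n.+1 f -> Cn O n f.
Proof.
elim: n f => [|n IH] f [df Cf]; last by split => //; exact: IH.
by move=> t Ot; apply: differentiable_continuous; apply/derivable1_diffP; exact: df.
Qed.

Lemma Cn_cst O n (c : R) : open O -> Cn O n (fun=> c).
Proof.
move=> oO; elim: n c => [|n IH] c; first by move=> t _; exact: cvg_cst.
by apply: (@Cn_intro _ _ _ (fun=> 0)) => // t _; exact: is_derive_cst.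
Qed.

Lemma Cn_id O n : open O -> Cn O n id.
Proof.
move=> oO; case: n => [|n]; first by move=> t _; exact: cvg_id.
by apply: (@Cn_intro _ _ _ (fun=> 1)) => //; exact: Cn_cst.
Qed.

Lemma CnD O n f g : open O -> Cn O n f -> Cn O n g -> Cn O n (fun t => f t + g t).
Proof.
move=> oO; elim: n f g => [|n IH] f g Cf Cg.
  by move=> t Ot; apply: cvgD; [exact: Cf|exact: Cg].
apply: (@Cn_intro _ _ _ (fun t => derive1 f t + derive1 g t) oO).
  by move=> t Ot; have df := derive_Cn Cf Ot; have dg := derive_Cn Cg Ot; exact: is_deriveD.
by apply: IH; [exact: Cf.2|exact: Cg.2].
Qed.

Lemma CnM O n f g : open O -> Cn O n f -> Cn O n g -> Cn O n (fun t => f t * g t).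
Proof.
move=> oO; elim: n f g => [|n IH] f g Cf Cg.
  by move=> t Ot; apply: cvgM; [exact: Cf|exact: Cg].
apply: (@Cn_intro _ _ _ (fun t => f t * derive1 g t + g t * derive1 f t) oO).
  by move=> t Ot; have df := derive_Cn Cf Ot; have dg := derive_Cn Cg Ot; exact: is_deriveM.
by apply: CnD => //; apply: IH; do ?[exact: CnS|exact: Cf.2|exact: Cg.2].
Qed.

Lemma Cn_comp O O' n f g : open O -> open O' -> (forall t, O t -> O' (g t)) ->
  Cn O' n f -> Cn O n g -> Cn O n (fun t => f (g t)).
Proof.
move=> oO oO' gO; elim: n f => [|n IH] f Cf Cg.
  by move=> t Ot; apply: continuous_comp; [exact: Cg|apply: Cf; exact: gO].
apply: (@Cn_intro _ _ _ (fun t => derive1 f (g t) * derive1 g t) oO).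
  move=> t Ot; have df := derive_Cn Cf (gO _ Ot); have dg := derive_Cn Cg Ot.
  exact: is_derive1_comp.
by apply: CnM => //; [apply: IH; [exact: Cf.2|exact: CnS]|exact: Cg.2].
Qed.

Lemma Cn_expR O n : open O -> Cn O n expR.
Proof.
move=> oO; elim: n => [|n IH]; first by move=> t _; exact: continuous_expR.
by apply: Cn_intro IH => // t _; exact: is_derive_expR.
Qed.

Definition pos : set R := `]0, +oo[.

Lemma posE (t : R) : pos t = (0 < t) :> Prop.
Proof. by rewrite /pos /= in_itv/= andbT. Qed.

Lemma open_pos : open pos. Proof. exact: interval_open. Qed.

Lemma is_derive1_inv (t : R) : 0 < t -> is_derive t 1 (fun t => t^-1) (- (t^-1 * t^-1)).
Proof.
move=> t0; have t0' : t != 0 by rewrite gt_eqF.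
apply: (is_derive_eq (@is_deriveV R id t 1 1 t0' (is_derive_id t 1))).
by rewrite /GRing.scale/= mulr1 expr2 invfM.
Qed.

Lemma Cn_inv n : Cn pos n (fun t => t^-1).
Proof.
have D := is_derive1_inv.
elim: n => [|n IH].
  move=> t; rewrite posE => /D[+ _] => d.
  by apply: differentiable_continuous; apply/derivable1_diffP.
apply: (@Cn_intro _ _ _ (fun t => (- 1) * (t^-1 * t^-1))).
- exact: open_pos.
- by move=> t; rewrite posE mulN1r; exact: D.
- have op := open_pos; apply: CnM => //; last exact: CnM.
  exact: Cn_cst.
Qed.

Lemma Cn_powR n (a : R) : Cn pos n (fun t => t `^ a).
Proof.
have L : Cn pos n (@ln R).
  case: n => [|n].
    move=> t; rewrite posE => /is_derive1_ln[+ _] => d.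
    by apply: differentiable_continuous; apply/derivable1_diffP.
  apply: Cn_intro (Cn_inv n); first exact: open_pos.
  by move=> t; rewrite posE; exact: is_derive1_ln.
apply: (@eq_Cn _ _ (fun t => expR (a * ln t))); first exact: open_pos.
  by move=> t; rewrite posE => t0; rewrite /powR gt_eqF.
have op := open_pos; apply: (@Cn_comp _ setT) => //; first exact: openT.
- by apply: Cn_expR; exact: openT.
- by apply: CnM => //; exact: Cn_cst.
Qed.

Lemma CnU O O' n f : Cn O n f -> Cn O' n f -> Cn (O `|` O') n f.
Proof.
elim: n f => [|n IH] f; first by move=> C C' t [/C|/C'].
by move=> [d C] [d' C']; split; [move=> t [/d|/d']|exact: IH].
Qed.

Lemma Cn_sub O O' n f : O `<=` O' -> Cn O' n f -> Cn O n f.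
Proof.
move=> OO'; elim: n f => [|n IH] f; first by move=> C t /OO'/C.
by move=> [d C]; split; [move=> t /OO'/d|exact: IH].
Qed.

Definition smooth1 f : Prop := forall n, Cn setT n f.

(** Since 0 < a, the open half-lines ]0, +oo[ and ]-oo, a[ cover the line, and [f] is smooth on the
    first and zero on the second. *)
Lemma smooth1_glue (a : R) f : 0 < a -> (forall t, t <= a -> f t = 0) ->
  (forall n, Cn pos n f) -> smooth1 f.
Proof.
move=> a0 f0 Cf n; apply: (@Cn_sub _ (pos `|` `]-oo, a[)).
  move=> t _; have [t0|t0] := ltP 0 t; [by left; rewrite posE|right].
  by rewrite /= in_itv/=; exact: le_lt_trans a0.
apply: CnU => //; have oa : open (`]-oo, a[%classic : set R) by exact: interval_open.
apply: (@eq_Cn _ _ (fun=> 0)) => //; last exact: Cn_cst.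
by move=> t; rewrite /= in_itv/= => /ltW/f0.
Qed.

Lemma smooth1D f g : smooth1 f -> smooth1 g -> smooth1 (fun t => f t + g t).
Proof. by move=> Cf Cg n; apply: CnD => //; exact: openT. Qed.

Lemma smooth1M f g : smooth1 f -> smooth1 g -> smooth1 (fun t => f t * g t).
Proof. by move=> Cf Cg n; apply: CnM => //; exact: openT. Qed.

Lemma smooth1_cst (c : R) : smooth1 (fun=> c).
Proof. by move=> n; apply: Cn_cst; exact: openT. Qed.

Lemma smooth1_id : smooth1 id.
Proof. by move=> n; apply: Cn_id; exact: openT. Qed.

Lemma smooth1_comp f g : smooth1 f -> smooth1 g -> smooth1 (fun t => f (g t)).
Proof. by move=> Cf Cg n; apply: (@Cn_comp _ setT) => //; exact: openT. Qed.

Lemma smooth1_derive f : smooth1 f -> smooth1 (derive1 f).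
Proof. by move=> Cf n; have [] := Cf n.+1. Qed.

Lemma smooth1_is_derive f (t : R) : smooth1 f -> is_derive t 1 f (derive1 f t).
Proof. by move=> Cf; apply: (@derive_Cn setT 0). Qed.

Lemma smooth1_cont f : smooth1 f -> continuous f.
Proof. by move=> /(_ 0%N) C t; exact: C. Qed.

(* The family t^-j exp(-1/t), t > 0, is stable under differentiation up to
   linear combinations; j = 0 is the standard flat function. *)
Definition flat (j : nat) (t : R) : R := if 0 < t then t^-1 ^+ j * expR (- t^-1) else 0.

(** A single term of the exponential series suffices: exp(1/t) >= t^-(j+1) / (j+1)!. *)
Lemma flat_le j t : 0 < t -> 0 <= flat j t <= (j.+1)`!%:R * t.
Proof.
move=> t0; rewrite /flat t0; apply/andP; split.
  by rewrite mulr_ge0 ?exprn_ge0 ?invr_ge0 ?expR_ge0// ltW.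
have f0 : 0 < (j.+1)`!%:R :> R by rewrite ltr0n fact_gt0.
have := @expR_ge1Dxn R t^-1 j ltac:(by rewrite invr_ge0 ltW).
move=> h; rewrite expRN ler_pdivrMr ?expR_gt0//.
apply: (@le_trans _ _ ((j.+1)`!%:R * t * (t^-1 ^+ j.+1 / (j.+1)`!%:R))); last first.
  rewrite ler_pM2l ?mulr_gt0//; apply: le_trans h; by rewrite lerDr.
rewrite exprS; set X := t^-1 ^+ j.
rewrite le_eqVlt; apply/orP; left; apply/eqP; field.
by rewrite !gt_eqF.
Qed.

Lemma flat_cvg0 j : flat j t @[t --> (0 : R)] --> (0 : R).
Proof.
apply/cvgrPdist_lt => e e0; pose F : R := (j.+1)`!%:R.
have F0 : 0 < F by rewrite ltr0n fact_gt0.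
exists (e / F) => /=; first by rewrite divr_gt0.
move=> t /=; rewrite !sub0r !normrN => te.
have [t0|t0] := ltP 0 t; last by rewrite /flat (le_gtF t0) normr0.
have /andP[h1 h2] := flat_le j t0; rewrite ger0_norm//.
by apply: le_lt_trans h2 _; move: te; rewrite gtr0_norm// ltr_pdivlMr// mulrC.
Qed.

Lemma is_derive_flat j (t : R) : is_derive t 1 (flat j) (flat j.+2 t - j%:R * flat j.+1 t).
Proof.
have [t0|t0|t0] := ltgtP 0 t.
- have E : \near t, t^-1 ^+ j * expR (- t^-1) = flat j t.
    near=> s; rewrite /flat ifT//; near: s.
    have := open_near open_pos (t := t); rewrite posE => /(_ t0).
    by apply: filterS => s; rewrite posE.
  apply: (near_eq_is_derive E).
  have t0' : t != 0 by rewrite gt_eqF.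
  have dV := is_derive1_inv t0.
  have dX : is_derive t 1 (fun t : R => t^-1 ^+ j) (- (j%:R * t^-1 ^+ j.+1)).
    elim: (j) => [|i IH].
      rewrite mul0r oppr0 (_ : (fun _ => _) = fun=> 1); first exact: is_derive_cst.
      by apply/funext => s; rewrite expr0.
    rewrite (_ : (fun _ => _) = fun s : R => s^-1 * s^-1 ^+ i); last first.
      by apply/funext => s; rewrite exprS.
    apply: (is_derive_eq (is_deriveM dV IH)).
    by rewrite /GRing.scale/= -natr1 !exprS; ring.
  have dE : is_derive t 1 (fun t : R => expR (- t^-1)) (expR (- t^-1) * (t^-1 * t^-1)).
    apply: (@is_derive1_comp _ expR (fun t => - t^-1)).
    by apply: (is_derive_eq (is_deriveN dV)); rewrite opprK.
  apply: (is_derive_eq (is_deriveM dX dE)).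
  by rewrite /flat t0 /GRing.scale/= !exprS; ring.
- have E : \near t, 0 = flat j t.
    have o : open (`]-oo, 0[%classic : set R) by exact: interval_open.
    have := open_near o (t := t); rewrite /= in_itv/= => /(_ t0).
    by apply: filterS => s s0; rewrite /flat lt_gtF.
  apply: (near_eq_is_derive E).
  by rewrite /flat !(lt_gtF t0) mulr0 subr0; exact: is_derive_cst.
rewrite -{t}t0 {2 3}/flat ltxx mulr0 subr0.
(* At 0 the difference quotient of [flat j] is [flat j.+1], which tends to 0. *)
have L : (fun h : R => h^-1 *: ((flat j \o shift 0) (h *: 1) - flat j 0)) @ 0^' --> (0 : R).
  have F0 : flat j.+1 t @[t --> 0^'] --> (0 : R) by exact: (@cvg_within_filter _ _ _ (nbhs 0) _ _ _ (@flat_cvg0 j.+1)).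
  apply: cvg_trans F0; apply: near_eq_cvg; near=> h.
  have h0 : h != 0 by near: h; exact: nbhs_dnbhs_neq.
  rewrite /= addr0 /flat ltxx subr0 /GRing.scale/= mulr1.
  by case: ifP => // _; rewrite ?mulr0// exprS mulrA.
by apply: DeriveDef; [exact: cvgP L|exact: (cvg_lim _ L)].
Unshelve. all: by end_near. Qed.

Lemma smooth1_flat j : smooth1 (flat j).
Proof.
move=> n; elim: n j => [|n IH] j.
  move=> t _; have [d _] := is_derive_flat j t.
  by apply: differentiable_continuous; apply/derivable1_diffP.
apply: (@Cn_intro _ _ _ (fun t => flat j.+2 t + (- j%:R) * flat j.+1 t)).
- exact: openT.
- by move=> t _; rewrite mulNr; exact: is_derive_flat.
- by apply: CnD => //; [exact: openT|apply: CnM => //; [exact: openT|apply: Cn_cst; exact: openT]].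
Qed.

Lemma flat0_ge0 t : 0 <= flat 0 t.
Proof. by rewrite /flat; case: ifP => // _; rewrite expr0 mul1r expR_ge0. Qed.

Lemma flat0_gt0 t : 0 < t -> 0 < flat 0 t.
Proof. by rewrite /flat => ->; rewrite expr0 mul1r expR_gt0. Qed.

Lemma flat0_le1 t : flat 0 t <= 1.
Proof.
rewrite /flat; case: ifP => // t0; rewrite expr0 mul1r -expR0 ler_expR.
by rewrite oppr_le0 invr_ge0 ltW.
Qed.

Definition bump (a b t : R) : R := flat 0 (t - a) * flat 0 (b - t).

Lemma smooth1_bump a b : smooth1 (bump a b).
Proof.
have id1 := smooth1_id; have c1 := smooth1_cst.
apply: smooth1M; apply: (@smooth1_comp (flat 0)) => //; try exact: smooth1_flat.
  exact: smooth1D.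
apply: smooth1D => //.
rewrite (_ : -%R = fun t => (-1) * t); first exact: smooth1M.
by apply/funext => t; rewrite mulN1r.
Qed.

Lemma bump_ge0 a b t : 0 <= bump a b t.
Proof. by rewrite mulr_ge0// flat0_ge0. Qed.

Lemma bump_le1 a b t : bump a b t <= 1.
Proof. by rewrite -[leRHS]mulr1 ler_pM ?flat0_ge0 ?flat0_le1. Qed.

Lemma bump_gt0 a b t : a < t < b -> 0 < bump a b t.
Proof. by move=> /andP[? ?]; rewrite mulr_gt0// flat0_gt0// subr_gt0. Qed.

Lemma bump_eq0 a b t : (t <= a) || (b <= t) -> bump a b t = 0.
Proof.
rewrite /bump /flat !subr_gt0 => /orP[h|h]; first by rewrite (le_gtF h) mul0r.
by rewrite (le_gtF h) mulr0.
Qed.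

(** Profiles in t = |z|^2 supported away from 0. They may be multiplied by any function smooth on
    ]0, +oo[, notably by t^-j and by the weight. *)
Definition annular f : Prop := smooth1 f /\
  exists a b, [/\ 0 < a, a < b & forall t, (t <= a) || (b <= t) -> f t = 0].

Lemma annular_bump a b : 0 < a -> a < b -> annular (bump a b).
Proof. by move=> a0 ab; split; [exact: smooth1_bump|exists a, b; split => // t /bump_eq0]. Qed.

Lemma annularMl f g : annular f -> (forall n, Cn pos n g) -> annular (fun t => f t * g t).
Proof.
move=> [sf [a [b [a0 ab fab]]]] sg; split; last first.
  by exists a, b; split => // t /fab ->; rewrite mul0r.
apply: (smooth1_glue a0) => [t ta|n]; first by rewrite fab ?ta// mul0r.
by apply: CnM => //; apply: Cn_sub (sf n).
Qed.

Lemma annularD f g : annular f -> annular g -> annular (fun t => f t + g t).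
Proof.
move=> [sf [a [b [a0 ab fab]]]] [sg [c [d [c0 cd gcd]]]]; split; first exact: smooth1D.
exists (Num.min a c), (Num.max b d); split.
- by rewrite lt_min a0.
- by rewrite gt_min !lt_max ab.
move=> t; rewrite le_min ge_max => /orP[] /andP[h1 h2];
  by rewrite fab ?gcd ?addr0 ?h1 ?h2 ?orbT.
Qed.

Lemma annularZ (c : R) f : annular f -> annular (fun t => f t * c).
Proof. by move=> af; apply: annularMl => // n; apply: Cn_cst; exact: open_pos. Qed.

(** The value [c] at the far right is the total mass of [f]; it is what can prevent the primitive
    from being annular again. *)
Lemma annular_primitive f : annular f -> exists (F : R -> R) (a b c : R),
  [/\ 0 < a, forall t : R, is_derive t 1 F (f t), smooth1 F,
      forall t, t <= a -> F t = 0 & forall t, b <= t -> F t = c].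
Proof.
move=> [sf [a [b [a0 ab fab]]]].
pose F x := \int[@lebesgue_measure R]_(t in `]-oo, x]) f t.
have fi : (@lebesgue_measure R).-integrable setT (EFin \o f).
  have fE : f = f \_ `[a, b].
    apply/funext => x; rewrite patchE; case: ifPn => //; rewrite notin_setE /= in_itv/= => h.
    apply: fab; move/negP: h; rewrite negb_and -!ltNge.
    by move=> /orP[]/ltW ->; rewrite ?orbT.
  have icc : (@lebesgue_measure R).-integrable `[a, b] (EFin \o f).
    apply: continuous_compact_integrable; first exact: segment_compact.
    by apply: continuous_subspaceT; exact: smooth1_cont.
  by have := (@integrable_mkcond _ _ R (@lebesgue_measure R) _ (EFin \o f) (measurable_itv `[a, b])).1 icc; rewrite restrict_EFin -fE.
have FD (t : R) : is_derive t 1 F (f t).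
  have [|||d1 d2] := @continuous_FTC1 R f -oo%O t (t + 1) _ _ _ (@smooth1_cont f sf t).
  - by rewrite ltrDl.
  - by apply: integrableS fi.
  - by exact: ltNyr.
  by have d3 := d2; rewrite derive1E in d3; exact: DeriveDef d1 d3.
exists F, a, b, (\int[@lebesgue_measure R]_t f t); split => //.
- move=> [|n]; last by apply: Cn_intro (sf n) => //; exact: openT.
  move=> t _; have [d _] := FD t.
  by apply: differentiable_continuous; apply/derivable1_diffP.
- move=> t ta; rewrite /F; under eq_Rintegral => s.
    rewrite inE/= in_itv/= => st; rewrite fab ?(le_trans st ta)//; over.
  by rewrite Rintegral_mkcond; under eq_Rintegral do [rewrite patchE if_same];
    rewrite Rintegral_cst ?mul0r.
- move=> t bt; rewrite /F Rintegral_mkcond; apply: eq_Rintegral => s _.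
  rewrite patchE; case: ifPn => //; rewrite notin_setE/= in_itv/= => /negP.
  by rewrite -ltNge => ts; rewrite fab// (ltW (le_lt_trans bt ts)) orbT.
Qed.

(** A reference profile of nonzero mass, against which other profiles are normalised. The mass is
    positive because F 1 < F 2 by the mean value theorem and F is monotone. *)
Lemma bump_primitive_gt0 : exists F : R -> R, exists a b c : R,
  [/\ [/\ 0 < a, 0 < c & smooth1 F], forall t : R, is_derive t 1 F (bump 1 2 t),
      forall t, t <= a -> F t = 0 & forall t, b <= t -> F t = c].
Proof.
have B : annular (bump 1 2) by apply: annular_bump => //; rewrite ltr1n.
have [F [a [b [c [a0 FD sF F0 Fc]]]]] := annular_primitive B.
exists F, a, b, c; split => //; split => //.
pose a' := Num.min a 1; pose b' := Num.max b 2.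
have cF x y : {within `[x, y], continuous F} by apply: continuous_subspaceT; exact: smooth1_cont.
have mono x y : x < y -> F x <= F y.
  move=> xy; have [z _ h] := @MVT R F (bump 1 2) x y xy (fun t _ => FD t) (cF _ _).
  by rewrite -subr_ge0 h mulr_ge0 ?bump_ge0// subr_ge0 ltW.
have h12 : F 1 < F 2.
  have l12 : 1 < 2 :> R by rewrite ltr1n.
  have [z zI h] := @MVT R F (bump 1 2) 1 2 l12 (fun t _ => FD t) (cF _ _).
  rewrite in_itv/= in zI.
  by rewrite -subr_gt0 h mulr_gt0 ?bump_gt0// subr_gt0.
have bb : b <= b' + 1 by rewrite (@le_trans _ _ b') ?lerDl// le_max lexx.
have aa : a' - 1 <= a by rewrite (@le_trans _ _ a') ?gerBl// ge_min lexx.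
rewrite -(Fc _ bb) -(F0 _ aa).
apply: (@le_lt_trans _ _ (F 1)).
  by apply: mono; rewrite ltrBlDr ltr_pwDr// ge_min lexx orbT.
apply: (lt_le_trans h12); apply: mono.
by rewrite ltr_pwDr// le_max lexx orbT.
Qed.

End Smooth1.

Local Open Scope complex_scope.
Local Open Scope ring_scope.

(** * The weighted space *)

Section ComplexIntegral.
Variable R : realType.
Implicit Types (f g : R * R -> R) (u v w : R * R -> R[i]).

Local Notation Re := complex.Re.
Local Notation Im := complex.Im.

Lemma complex_ext (a b : R[i]) : Re a = Re b -> Im a = Im b -> a = b.
Proof. by case: a => a1 a2; case: b => b1 b2 /= -> ->. Qed.

Lemma ReM (a b : R[i]) : Re (a * b) = Re a * Re b - Im a * Im b.
Proof. by case: a => a1 a2; case: b => b1 b2. Qed.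
Lemma ImM (a b : R[i]) : Im (a * b) = Re a * Im b + Im a * Re b.
Proof. by case: a => a1 a2; case: b => b1 b2. Qed.
Lemma ReD (a b : R[i]) : Re (a + b) = Re a + Re b.
Proof. by case: a => a1 a2; case: b => b1 b2. Qed.
Lemma ImD (a b : R[i]) : Im (a + b) = Im a + Im b.
Proof. by case: a => a1 a2; case: b => b1 b2. Qed.
Lemma ReN (a : R[i]) : Re (- a) = - Re a. Proof. by case: a. Qed.
Lemma ImN (a : R[i]) : Im (- a) = - Im a. Proof. by case: a. Qed.
Lemma ReJ (a : R[i]) : Re a^* = Re a. Proof. by case: a. Qed.
Lemma ImJ (a : R[i]) : Im a^* = - Im a. Proof. by case: a. Qed.
Lemma ReC (x : R) : Re x%:C = x. Proof. by []. Qed.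
Lemma ImC (x : R) : Im x%:C = 0. Proof. by []. Qed.
Lemma Re0 : Re (0 : R[i]) = 0. Proof. by []. Qed.
Lemma Im0 : Im (0 : R[i]) = 0. Proof. by []. Qed.
Lemma Re1 : Re (1 : R[i]) = 1. Proof. by []. Qed.
Lemma Im1 : Im (1 : R[i]) = 0. Proof. by []. Qed.
Lemma RePair (x y : R) : Re (x +i* y)%C = x. Proof. by []. Qed.
Lemma ImPair (x y : R) : Im (x +i* y)%C = y. Proof. by []. Qed.
Definition ReImE := (RePair, ImPair, ReD, ImD, ReN, ImN, ReM, ImM, ReJ, ImJ, ReC, ImC, Re0, Im0, Re1, Im1).

Lemma conjD (a b : R[i]) : (a + b)^* = a^* + b^*.
Proof. by apply: complex_ext; rewrite !ReImE ?opprD. Qed.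
Lemma conjN (a : R[i]) : (- a)^* = - a^*.
Proof. by apply: complex_ext; rewrite !ReImE. Qed.
Lemma conjM (a b : R[i]) : (a * b)^* = a^* * b^*.
Proof. by apply: complex_ext; rewrite !ReImE; ring. Qed.
Lemma conjK (a : R[i]) : (a^*)^* = a.
Proof. by apply: complex_ext; rewrite !ReImE ?opprK. Qed.
Lemma conjX (a : R[i]) n : (a ^+ n)^* = a^* ^+ n.
Proof.
elim: n => [|n IH]; first by rewrite !expr0; apply: complex_ext; rewrite !ReImE ?oppr0.
by rewrite !exprS conjM IH.
Qed.
Lemma conjC (x : R) : (x%:C)^* = x%:C.
Proof. by apply: complex_ext; rewrite !ReImE ?oppr0. Qed.

Lemma sqmodE (a : R[i]) : a * a^* = (sqmod a)%:C.
Proof. by rewrite /sqmod; apply: complex_ext; rewrite !ReImE; ring. Qed.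
Lemma sqmodM (a b : R[i]) : sqmod (a * b) = sqmod a * sqmod b.
Proof. by rewrite /sqmod !ReImE; ring. Qed.
Lemma sqmod_ge0 (a : R[i]) : 0 <= sqmod a.
Proof. by rewrite addr_ge0 ?sqr_ge0. Qed.
Lemma sqmodD_le (a b : R[i]) : sqmod (a + b) <= 2 * sqmod a + 2 * sqmod b.
Proof.
rewrite /sqmod !ReImE -subr_ge0.
rewrite (_ : _ - _ = (Re a - Re b) ^+ 2 + (Im a - Im b) ^+ 2); last by ring.
by rewrite addr_ge0 ?sqr_ge0.
Qed.
Lemma sqmodN (a : R[i]) : sqmod (- a) = sqmod a.
Proof. by rewrite /sqmod !ReImE; ring. Qed.
Lemma sqmodJ (a : R[i]) : sqmod a^* = sqmod a.
Proof. by rewrite /sqmod !ReImE; ring. Qed.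
Lemma sqmodC (x : R) : sqmod x%:C = x ^+ 2.
Proof. by rewrite /sqmod !ReImE; ring. Qed.
Lemma sqmod_eq0 (a : R[i]) : sqmod a = 0 -> a = 0.
Proof.
move/eqP; rewrite paddr_eq0 ?sqr_ge0// !sqrf_eq0 => /andP[/eqP h1 /eqP h2].
exact: complex_ext.
Qed.

Definition rint f : Prop := (@lam2 R).-integrable setT (EFin \o f).

Lemma rintD f g : rint f -> rint g -> rint (fun p => f p + g p).
Proof. by move=> rf rg; have := integrableD measurableT rf rg; apply: eq_integrable. Qed.

Lemma rintZ (c : R) f : rint f -> rint (fun p => c * f p).
Proof. by move=> rf; have := integrableZl measurableT c rf; apply: eq_integrable. Qed.

Lemma rint0 : rint (fun=> 0).
Proof. exact: integrable0. Qed.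

Lemma rint_dom f g : measurable_fun setT f -> (forall p, `|f p| <= g p) -> rint g -> rint f.
Proof.
move=> mf fg; apply: le_integrable => //; first exact/measurable_EFinP.
by move=> p _; rewrite /= lee_fin (le_trans (fg p))// ler_norm.
Qed.

Lemma rint_measurable f : rint f -> measurable_fun setT f.
Proof. by move=> /integrableP[/measurable_EFinP]. Qed.

Lemma cmeasurableD u v : cmeasurable u -> cmeasurable v -> cmeasurable (fun p => u p + v p).
Proof.
move=> [u1 u2] [v1 v2]; split; under eq_fun do rewrite !ReImE; exact: measurable_funD.
Qed.

Lemma cmeasurableM u v : cmeasurable u -> cmeasurable v -> cmeasurable (fun p => u p * v p).
Proof.
move=> [u1 u2] [v1 v2]; split; under eq_fun do rewrite !ReImE.
  by apply: measurable_funB; exact: measurable_funM.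
by apply: measurable_funD; exact: measurable_funM.
Qed.

Lemma cmeasurableJ u : cmeasurable u -> cmeasurable (fun p => (u p)^*).
Proof.
move=> [u1 u2]; split; under eq_fun do rewrite !ReImE; first by [].
exact: measurableT_comp.
Qed.

Lemma cmeasurable_cst (c : R[i]) : cmeasurable (fun=> c).
Proof. by split; exact: measurable_cst. Qed.

Lemma cmeasurableC f : measurable_fun setT f -> cmeasurable (fun p => (f p)%:C).
Proof. by move=> mf; split => //; exact: measurable_cst. Qed.

Lemma sqmod_measurable u : cmeasurable u -> measurable_fun setT (fun p => sqmod (u p)).
Proof.
by move=> [u1 u2]; apply: measurable_funD; exact: measurable_funX.
Qed.

Definition cintegrable u : Prop := rint (fun p => Re (u p)) /\ rint (fun p => Im (u p)).

Lemma cintegrable_dom u g : cmeasurable u -> (forall p, sqmod (u p) <= g p ^+ 2) ->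
  (forall p, 0 <= g p) -> rint g -> cintegrable u.
Proof.
move=> [u1 u2] ug g0 rg; have h (x y z : R) : 0 <= z -> x ^+ 2 + y ^+ 2 <= z ^+ 2 -> `|x| <= z.
  move=> z0 h; rewrite -ler_sqr ?nnegrE// real_normK ?num_real//.
  by apply: le_trans h; rewrite lerDl sqr_ge0.
split; apply: rint_dom rg => // p; apply: h => //; first exact: ug.
by rewrite addrC; exact: ug.
Qed.

Lemma cintegrableD u v : cintegrable u -> cintegrable v -> cintegrable (fun p => u p + v p).
Proof.
move=> [u1 u2] [v1 v2]; split; [move: (rintD u1 v1)|move: (rintD u2 v2)];
  by apply: eq_integrable => // p _ /=; rewrite !ReImE.
Qed.

Lemma cintegrableZ (c : R[i]) u : cintegrable u -> cintegrable (fun p => c * u p).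
Proof.
move=> [u1 u2]; split; [move: (rintD (rintZ (Re c) u1) (rintZ (- Im c) u2))|
  move: (rintD (rintZ (Re c) u2) (rintZ (Im c) u1))];
  by apply: eq_integrable => // p _ /=; rewrite !ReImE ?mulNr.
Qed.

Lemma RintD f g : rint f -> rint g ->
  \int[@lam2 R]_p (f p + g p) = \int[@lam2 R]_p f p + \int[@lam2 R]_p g p.
Proof. by move=> rf rg; exact: RintegralD. Qed.

Lemma RintZ (c : R) f : rint f -> \int[@lam2 R]_p (c * f p) = c * \int[@lam2 R]_p f p.
Proof. by move=> rf; exact: RintegralZl. Qed.

Lemma eq_cint u v : (forall p, u p = v p) -> cint u = cint v.
Proof. by move=> uv; congr cint; exact/funext. Qed.

Lemma cintD u v : cintegrable u -> cintegrable v ->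
  cint (fun p => u p + v p) = cint u + cint v.
Proof.
move=> [u1 u2] [v1 v2]; rewrite /cint; apply: complex_ext; rewrite !ReImE /= -RintD//;
  by apply: eq_Rintegral => p _; rewrite !ReImE.
Qed.

Lemma cintZ (c : R[i]) u : cintegrable u -> cint (fun p => c * u p) = c * cint u.
Proof.
move=> [u1 u2]; rewrite /cint; apply: complex_ext; rewrite !ReImE /=.
  rewrite -mulNr -(RintZ _ u1) -(RintZ _ u2) -RintD; [|exact: rintZ|exact: rintZ].
  by apply: eq_Rintegral => p _; rewrite !ReImE mulNr.
rewrite -(RintZ _ u1) -(RintZ _ u2) -RintD; [|exact: rintZ|exact: rintZ].
by apply: eq_Rintegral => p _; rewrite !ReImE.
Qed.

Lemma cint0 : cint (fun _ : R * R => 0 : R[i]) = 0.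
Proof. by rewrite /cint /= !Rintegral_cst// !mul0r. Qed.

Lemma cintJ u : cintegrable u -> cint (fun p => (u p)^*) = (cint u)^*.
Proof.
move=> [u1 u2]; rewrite /cint; apply: complex_ext; rewrite !ReImE /=.
  by apply: eq_Rintegral => p _; rewrite !ReImE.
rewrite -mulN1r -RintZ//; apply: eq_Rintegral => p _; by rewrite !ReImE mulN1r.
Qed.

Lemma cintC f : cint (fun p => (f p)%:C) = (\int[@lam2 R]_p f p)%:C.
Proof. by rewrite /cint /=; apply: complex_ext => //=; rewrite Rintegral_cst// mul0r. Qed.

End ComplexIntegral.

(** * Inner product and squared norm *)

Section WeightedL2.
Variables (R : realType) (m : R).
Implicit Types (f g : R * R -> R) (u v w : R * R -> R[i]).

Local Notation Re := complex.Re.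
Local Notation Im := complex.Im.
Local Notation W := (weight m).
Local Notation nrm := (L2norm2 m).
Local Notation ip := (inner m).

Lemma weight_gt0 p : 0 < W p. Proof. exact: expR_gt0. Qed.

Lemma absz_measurable : measurable_fun setT (@Defs.absz R).
Proof.
rewrite /Defs.absz /cmod; apply: (measurableT_comp (f := @Num.sqrt R)).
  by apply: continuous_measurable_fun => x; exact: sqrt_continuous.
rewrite /sqmod /toC /=; apply: measurable_funD; apply: measurable_funX;
  [exact: measurable_fst|exact: measurable_snd].
Qed.

Lemma weight_measurable : measurable_fun setT W.
Proof.
apply: measurableT_comp => //; apply: measurableT_comp => //.
by apply: (measurableT_comp (f := fun x : R => x `^ m)); [exact: measurable_powR|exact: absz_measurable].
Qed.

Lemma L2wP u : L2w m u <-> cmeasurable u /\ rint (fun p => sqmod (u p) * W p).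
Proof.
split=> -[mu h]; split => //.
  apply/integrableP; split.
    apply/measurable_EFinP; apply: measurable_funM; last exact: weight_measurable.
    exact: sqmod_measurable.
  under eq_integral => p _ do
    rewrite /= ger0_norm ?mulr_ge0 ?sqmod_ge0 ?(ltW (weight_gt0 _))//.
  exact: h.
exact: (integrable_lty measurableT h).
Qed.

Lemma L2w_dom u v (c : R) : cmeasurable u -> (forall p, sqmod (u p) <= c * sqmod (v p)) ->
  L2w m v -> L2w m u.
Proof.
move=> mu uv /L2wP[mv iv]; apply/L2wP; split => //.
apply: rint_dom (rintZ c iv).
  by apply: measurable_funM; [exact: sqmod_measurable|exact: weight_measurable].
move=> p; rewrite ger0_norm ?mulr_ge0 ?sqmod_ge0 ?(ltW (weight_gt0 _))//.
by rewrite mulrA ler_pM2r ?weight_gt0.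
Qed.

Lemma L2wD u v : L2w m u -> L2w m v -> L2w m (fun p => u p + v p).
Proof.
move=> /L2wP[mu iu] /L2wP[mv iv]; apply/L2wP; split; first exact: cmeasurableD.
apply: rint_dom (rintD (rintZ 2 iu) (rintZ 2 iv)).
  apply: measurable_funM; last exact: weight_measurable.
  by apply: sqmod_measurable; exact: cmeasurableD.
move=> p; rewrite ger0_norm ?mulr_ge0 ?sqmod_ge0 ?(ltW (weight_gt0 _))//.
by rewrite !mulrA -mulrDl ler_pM2r ?weight_gt0// sqmodD_le.
Qed.

Lemma L2wZ (c : R[i]) u : L2w m u -> L2w m (fun p => c * u p).
Proof.
move=> Lu; apply: (L2w_dom (c := sqmod c) (v := u)) => //.
  by apply: cmeasurableM; [exact: cmeasurable_cst|case: Lu].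
by move=> p; rewrite sqmodM.
Qed.

Lemma L2wN u : L2w m u -> L2w m (fun p => - u p).
Proof. by move=> /(L2wZ (- 1)); under eq_fun do rewrite mulN1r. Qed.

Lemma L2wB u v : L2w m u -> L2w m v -> L2w m (fun p => u p - v p).
Proof. by move=> Lu /L2wN; exact: L2wD. Qed.

Lemma L2w0 : L2w m (fun=> 0).
Proof.
apply/L2wP; split; first exact: cmeasurable_cst.
by have := rint0 R; apply: eq_integrable => // p _ /=; rewrite /sqmod/= expr0n/= addr0 mul0r.
Qed.

Lemma L2w_sum (I : Type) (s : seq I) (u : I -> R * R -> R[i]) :
  (forall i, L2w m (u i)) -> L2w m (fun p => \sum_(i <- s) u i p).
Proof.
move=> Lu; elim: s => [|i s IH].
  by under eq_fun do rewrite big_nil; exact: L2w0.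
by under eq_fun do rewrite big_cons; exact: L2wD.
Qed.

Lemma ip_cintegrable u v : L2w m u -> L2w m v ->
  cintegrable (fun p => u p * (v p)^* * (W p)%:C).
Proof.
move=> /L2wP[mu iu] /L2wP[mv iv].
apply: (cintegrable_dom (g := fun p => sqmod (u p) * W p + sqmod (v p) * W p)).
- apply: cmeasurableM; last by apply: cmeasurableC; exact: weight_measurable.
  by apply: cmeasurableM => //; exact: cmeasurableJ.
- move=> p; rewrite !sqmodM sqmodJ sqmodC -mulrDl exprMn.
  rewrite ler_pM2r ?exprn_gt0 ?weight_gt0//.
  have := sqmod_ge0 (u p); have := sqmod_ge0 (v p); nra.
- by move=> p; rewrite addr_ge0// mulr_ge0 ?sqmod_ge0 ?(ltW (weight_gt0 _)).
- exact: rintD.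
Qed.

Lemma ipDl u v w : L2w m u -> L2w m v -> L2w m w ->
  ip (fun p => u p + v p) w = ip u w + ip v w.
Proof.
move=> Lu Lv Lw; rewrite /inner -cintD; [|exact: ip_cintegrable|exact: ip_cintegrable].
by apply: eq_cint => p; rewrite !mulrDl.
Qed.

Lemma ipZl (c : R[i]) u v : L2w m u -> L2w m v -> ip (fun p => c * u p) v = c * ip u v.
Proof.
move=> Lu Lv; rewrite /inner -cintZ; last exact: ip_cintegrable.
by apply: eq_cint => p; rewrite !mulrA.
Qed.

Lemma ipJ u v : L2w m u -> L2w m v -> ip v u = (ip u v)^*.
Proof.
move=> Lu Lv; rewrite /inner -cintJ; last exact: ip_cintegrable.
by apply: eq_cint => p; rewrite !conjM conjK conjC; ring.
Qed.

Lemma ipNl u v : L2w m u -> L2w m v -> ip (fun p => - u p) v = - ip u v.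
Proof.
move=> Lu Lv; rewrite (_ : (fun p => - u p) = fun p => -1 * u p).
  by rewrite ipZl// mulN1r.
by apply/funext => p; rewrite mulN1r.
Qed.

Lemma ipBl u v w : L2w m u -> L2w m v -> L2w m w ->
  ip (fun p => u p - v p) w = ip u w - ip v w.
Proof. by move=> Lu Lv Lw; rewrite ipDl ?ipNl//; exact: L2wN. Qed.

Lemma ipDr u v w : L2w m u -> L2w m v -> L2w m w ->
  ip w (fun p => u p + v p) = ip w u + ip w v.
Proof.
by move=> Lu Lv Lw; rewrite [LHS]ipJ ?ipDl ?conjD -?ipJ//; exact: L2wD.
Qed.

Lemma ipZr (c : R[i]) u v : L2w m u -> L2w m v -> ip v (fun p => c * u p) = c^* * ip v u.
Proof.
by move=> Lu Lv; rewrite [LHS]ipJ ?ipZl ?conjM -?ipJ//; exact: L2wZ.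
Qed.

Lemma ipNr u v : L2w m u -> L2w m v -> ip v (fun p => - u p) = - ip v u.
Proof.
by move=> Lu Lv; rewrite [LHS]ipJ ?ipNl ?conjN -?ipJ//; exact: L2wN.
Qed.

Lemma ipBr u v w : L2w m u -> L2w m v -> L2w m w ->
  ip w (fun p => u p - v p) = ip w u - ip w v.
Proof. by move=> Lu Lv Lw; rewrite ipDr ?ipNr//; exact: L2wN. Qed.

Lemma ip0l v : ip (fun=> 0) v = 0.
Proof. by rewrite /inner; under eq_fun do rewrite !mul0r; exact: cint0. Qed.

Lemma ip_suml (I : Type) (s : seq I) (u : I -> R * R -> R[i]) v : (forall i, L2w m (u i)) ->
  L2w m v -> ip (fun p => \sum_(i <- s) u i p) v = \sum_(i <- s) ip (u i) v.
Proof.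
move=> Lu Lv; elim: s => [|i s IH].
  by under eq_fun do rewrite big_nil; rewrite big_nil ip0l.
under eq_fun do rewrite big_cons; rewrite big_cons ipDl ?IH//; exact: L2w_sum.
Qed.

Lemma ip_nrm u : ip u u = (nrm u)%:C.
Proof.
rewrite /inner /L2norm2 -cintC; apply: eq_cint => p.
by rewrite sqmodE; apply: complex_ext; rewrite !ReImE; ring.
Qed.

Lemma nrm_ge0 u : 0 <= nrm u.
Proof. by apply: Rintegral_ge0 => p _; rewrite mulr_ge0 ?sqmod_ge0 ?(ltW (weight_gt0 _)). Qed.

Lemma nrmD u v : L2w m u -> L2w m v ->
  nrm (fun p => u p + v p) = nrm u + 2 * Re (ip u v) + nrm v.
Proof.
move=> Lu Lv; have := ip_nrm (fun p => u p + v p).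
rewrite ipDl ?ipDr//; try exact: L2wD.
rewrite (ipJ Lu Lv) !ip_nrm => /(congr1 (@complex.Re R)); rewrite !ReImE => <-; ring.
Qed.

Lemma nrmZ (c : R[i]) u : L2w m u -> nrm (fun p => c * u p) = sqmod c * nrm u.
Proof.
move=> Lu; have := ip_nrm (fun p => c * u p).
rewrite ipZl ?ipZr//; last exact: L2wZ.
by rewrite mulrA sqmodE ip_nrm => /(congr1 (@complex.Re R)); rewrite !ReImE => <-; ring.
Qed.

Lemma nrmN u : nrm (fun p => - u p) = nrm u.
Proof. by apply: eq_Rintegral => p _; rewrite sqmodN. Qed.

Lemma nrmB u v : L2w m u -> L2w m v ->
  nrm (fun p => u p - v p) = nrm u - 2 * Re (ip u v) + nrm v.
Proof.
by move=> Lu Lv; rewrite nrmD ?ipNr ?nrmN ?ReN//; [ring|exact: L2wN].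
Qed.

(** [L2norm2] is the squared norm: the triangle inequality is replaced throughout by the
    parallelogram law with one square dropped. *)
Lemma nrmD_le u v : L2w m u -> L2w m v ->
  nrm (fun p => u p + v p) <= 2 * nrm u + 2 * nrm v.
Proof.
by move=> Lu Lv; have := nrm_ge0 (fun p => u p - v p); rewrite nrmB// nrmD//; lra.
Qed.

Lemma nrmB_le u v : L2w m u -> L2w m v ->
  nrm (fun p => u p - v p) <= 2 * nrm u + 2 * nrm v.
Proof.
by move=> Lu Lv; have := nrm_ge0 (fun p => u p + v p); rewrite nrmB// nrmD//; lra.
Qed.

(** Expand |u - s I v|^2 >= 0 for real [s]. The choice s = 1 / [nrm v] gives the bound; if [nrm v]
    is 0, a large [s] rules out S > 0. *)
Lemma cauchy_schwarz u v : L2w m u -> L2w m v -> sqmod (ip u v) <= nrm u * nrm v.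
Proof.
move=> Lu Lv; set I := ip u v; set S := sqmod I.
have S0 : 0 <= S by exact: sqmod_ge0.
have h (s : R) : 0 <= nrm u - 2 * s * S + s ^+ 2 * S * nrm v.
  have Lc : L2w m (fun p => (s%:C * I) * v p) by exact: L2wZ.
  have := nrm_ge0 (fun p => u p - (s%:C * I) * v p).
  rewrite nrmB// nrmZ// ipZr// sqmodM sqmodC -/S -/I.
  rewrite (_ : Re _ = s * S); first by rewrite !mulrA.
  by rewrite /S /sqmod !ReImE; ring.
have u0 := nrm_ge0 u; have v0 := nrm_ge0 v.
have [v00|v00] := eqVneq (nrm v) 0.
  rewrite v00 mulr0; rewrite leNgt; apply/negP => Spos.
  have := h ((nrm u + 1) / S); rewrite v00 mulr0 addr0.
  rewrite (_ : 2 * _ * S = 2 * (nrm u + 1)); last by field; rewrite gt_eqF.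
  lra.
have vpos : 0 < nrm v by rewrite lt_neqAle eq_sym v00.
have := h (nrm v)^-1.
rewrite (_ : _ + _ = nrm u - S / nrm v); last by field.
by rewrite subr_ge0 ler_pdivrMr.
Qed.

End WeightedL2.

(** * The dbar calculus *)

Section PlaneSmooth.
Variable R : realType.
Implicit Types (f g : R * R -> R) (p q : R * R).

Local Notation Re := complex.Re.
Local Notation Im := complex.Im.

Lemma derive_slice f (F : R -> R) p v (x : R) d : (forall h : R, F (h + x) = f (h *: v + p)) ->
  is_derive p v f d -> is_derive x 1 F d.
Proof.
move=> Ff [df Df].
have E : (fun h : R => h^-1 *: ((F \o shift x) (h *: 1) - F x)) =
         (fun h : R => h^-1 *: ((f \o shift p) (h *: v) - f p)).
  apply/funext => h; congr (_ *: (_ - _)); first by rewrite /= /GRing.scale/= mulr1 Ff.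
  by have := Ff 0; rewrite add0r scale0r add0r.
by apply: DeriveDef; [rewrite /derivable E|rewrite /derive E].
Qed.

(** The path from p to q goes through (p.1, q.2): A is the slope of its horizontal leg, B that of
    its vertical leg, and the mean value theorem makes both continuous at p. On a degenerate leg the
    slope is set to the partial derivative at p. *)
Lemma C1_rdiff f fx fy : continuous fx -> continuous fy ->
  (forall q, is_derive q (ex R) f (fx q)) -> (forall q, is_derive q (ey R) f (fy q)) ->
  forall p, rdiff f p (fx p) (fy p).
Proof.
move=> cx cy dx dy p.
have sx (x y : R) : is_derive x 1 (fun x => f (x, y)) (fx (x, y)).
  apply: derive_slice (dx (x, y)) => h.
  by rewrite /ex; congr (f (_, _)); rewrite /= /GRing.scale/=; ring.
have sy (x y : R) : is_derive y 1 (fun y => f (x, y)) (fy (x, y)).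
  apply: derive_slice (dy (x, y)) => h.
  by rewrite /ey; congr (f (_, _)); rewrite /= /GRing.scale/=; ring.
have mvt (F dF : R -> R) (a b : R) : (forall x : R, is_derive x 1 F (dF x)) ->
    exists2 c, `|c - a| <= `|b - a| & F b - F a = dF c * (b - a).
  move=> FD; have cF x y : {within `[x, y], continuous F}.
    apply: continuous_subspaceT => t; have [d _] := FD t.
    by apply: differentiable_continuous; apply/derivable1_diffP.
  have [ab|ba] := leP a b.
    have [c] := @MVT_segment R F dF a b ab (fun t _ => FD t) (cF _ _).
    rewrite in_itv/= => /andP[ac cb] h; exists c => //.
    by rewrite !ger0_norm; lra.
  have [c] := @MVT_segment R F dF b a (ltW ba) (fun t _ => FD t) (cF _ _).
  rewrite in_itv/= => /andP[bc ca] h; exists c.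
    by rewrite !ler0_norm; lra.
  by rewrite -opprB h; ring.
pose A q := if q.1 == p.1 then fx p else (f q - f (p.1, q.2)) / (q.1 - p.1).
pose B q := if q.2 == p.2 then fy p else (f (p.1, q.2) - f p) / (q.2 - p.2).
exists A, B; split.
- apply/cont2P => e e0; have /cont2P/(_ e e0)[d d0 dP] := cx p.
  exists d => // q q1 q2; rewrite {2}/A eqxx /A; case: eqVneq => [_|neq].
    by rewrite subrr normr0.
  have [c c1] := mvt _ _ p.1 q.1 (fun x => sx x q.2).
  rewrite -surjective_pairing => ->; rewrite mulfK ?subr_eq0//.
  by apply: dP => //=; exact: (le_lt_trans c1).
- apply/cont2P => e e0; have /cont2P/(_ e e0)[d d0 dP] := cy p.
  exists d => // q q1 q2; rewrite {2}/B eqxx /B; case: eqVneq => [_|neq].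
    by rewrite subrr normr0.
  have [c c1] := mvt _ _ p.2 q.2 (fun y => sy p.1 y).
  rewrite -surjective_pairing => ->; rewrite mulfK ?subr_eq0//.
  by apply: dP => //=; rewrite ?subrr ?normr0//; exact: (le_lt_trans c1).
- by rewrite /A eqxx.
- by rewrite /B eqxx.
move=> q; rewrite /A /B; case: eqVneq => [E1|n1].
  rewrite E1 subrr mulr0 addr0; case: eqVneq => [E2|n2].
    by rewrite E2 subrr mulr0 addr0; congr f; rewrite [q]surjective_pairing E1 E2 -surjective_pairing.
  rewrite mulfVK ?subr_eq0// -E1 -surjective_pairing; ring.
rewrite mulfVK ?subr_eq0//; case: eqVneq => [E2|n2].
  by rewrite E2 -surjective_pairing; ring.
by rewrite mulfVK ?subr_eq0//; ring.
Qed.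

Lemma smooth_rdiff f p : smooth f -> rdiff f p ('D_(ex R) f p) ('D_(ey R) f p).
Proof.
move=> [sc sd]; apply: (@C1_rdiff f (fun p => 'D_(ex R) f p) (fun p => 'D_(ey R) f p)).
- exact: (sc [:: true]).
- exact: (sc [:: false]).
- by move=> q; exact: DeriveDef (sd [::] q).1 erefl.
- by move=> q; exact: DeriveDef (sd [::] q).2 erefl.
Qed.

(** A companion of [smooth] for which sums, products and compositions are easy; [Ck_smooth] converts
    it into iterated directional derivatives. *)
Fixpoint Ck n f : Prop := if n is n'.+1 then
  exists fx fy, [/\ forall p, rdiff f p (fx p) (fy p), Ck n' fx & Ck n' fy]
  else continuous f.

Lemma CkS n f : Ck n.+1 f -> Ck n f.
Proof.
elim: n f => [|n IH] f [fx [fy [fd Cx Cy]]]; first by move=> p; exact: rdiff_cont (fd p).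
by exists fx, fy; split => //; exact: IH.
Qed.

Lemma Ck_cst n (c : R) : Ck n (fun=> c).
Proof.
elim: n c => [|n IH] c; first by move=> p; exact: contC2.
by exists (fun=> 0), (fun=> 0); split => // p; exact: rdiff_cst.
Qed.

Lemma Ck_fst n : Ck n fst.
Proof.
case: n => [|n]; first by move=> p; exact: cont_fst.
by exists (fun=> 1), (fun=> 0); split => [p||]; [exact: rdiff_fst|exact: Ck_cst|exact: Ck_cst].
Qed.

Lemma Ck_snd n : Ck n snd.
Proof.
case: n => [|n]; first by move=> p; exact: cont_snd.
by exists (fun=> 0), (fun=> 1); split => [p||]; [exact: rdiff_snd|exact: Ck_cst|exact: Ck_cst].
Qed.

Lemma CkD n f g : Ck n f -> Ck n g -> Ck n (fun p => f p + g p).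
Proof.
elim: n f g => [|n IH] f g; first by move=> cf cg p; apply: contD2; [exact: cf|exact: cg].
move=> [fx [fy [fd Fx Fy]]] [gx [gy [gd Gx Gy]]].
exists (fun p => fx p + gx p), (fun p => fy p + gy p); split; try exact: IH.
by move=> p; exact: rdiffD.
Qed.

Lemma CkM n f g : Ck n f -> Ck n g -> Ck n (fun p => f p * g p).
Proof.
elim: n f g => [|n IH] f g; first by move=> cf cg p; apply: contM2; [exact: cf|exact: cg].
move=> Cf Cg; have [Cf' Cg'] := (CkS Cf, CkS Cg).
move: Cf Cg => [fx [fy [fd Fx Fy]]] [gx [gy [gd Gx Gy]]].
exists (fun p => fx p * g p + f p * gx p), (fun p => fy p * g p + f p * gy p); split.
- by move=> p; exact: rdiffM.
- by apply: CkD; exact: IH.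
- by apply: CkD; exact: IH.
Qed.

Lemma rdiff_comp (k : R -> R) f p a b c : rdiff f p a b -> is_derive (f p) 1 k c ->
  rdiff (fun q => k (f q)) p (c * a) (c * b).
Proof.
move=> fd kd; have cf := rdiff_cont fd.
move: fd => [A [B [cA cB <- <- fE]]].
pose K s := if s == f p then c else (k s - k (f p)) / (s - f p).
have cK : {for f p, continuous K}.
  move: kd => [d D]; rewrite /prop_for /continuous_at {2}/K eqxx.
  apply/cvgrPdist_lt => e e0.
  have L : (fun h : R => h^-1 *: ((k \o shift (f p)) (h *: 1) - k (f p))) @ 0^' --> c.
    by rewrite -D; exact: d.
  have /cvgrPdist_lt/(_ e e0)[r /= r0 rP] := L.
  exists r => //= s sr; rewrite /K; case: eqVneq => [_|neq]; first by rewrite subrr normr0.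
  have := rP (s - f p); rewrite /= sub0r normrN distrC subr_eq0 neq => /(_ sr isT).
  by rewrite /GRing.scale/= mulr1 subrK mulrC.
have kE s : k s = k (f p) + K s * (s - f p).
  rewrite /K; case: eqVneq => [->|neq]; first by rewrite subrr mulr0 addr0.
  by rewrite mulfVK ?subr_eq0//; ring.
have cKf : {for p, continuous (fun q => K (f q))} by exact: continuous_comp.
exists (fun q => K (f q) * A q), (fun q => K (f q) * B q); split.
- exact: contM2.
- exact: contM2.
- by rewrite /K eqxx.
- by rewrite /K eqxx.
by move=> q; rewrite kE [X in _ * (X - _)]fE; ring.
Qed.

Lemma Ck_comp n (k : R -> R) f : smooth1 k -> Ck n f -> Ck n (fun p => k (f p)).
Proof.
elim: n k f => [|n IH] k f sk Cf.
  by move=> p; apply: continuous_comp; [exact: Cf|exact: smooth1_cont].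
have Cf' := CkS Cf; move: Cf => [fx [fy [fd Fx Fy]]].
have C := IH _ _ (smooth1_derive sk) Cf'.
exists (fun p => derive1 k (f p) * fx p), (fun p => derive1 k (f p) * fy p); split.
- by move=> p; apply: rdiff_comp (fd p) _; exact: smooth1_is_derive.
- exact: CkM.
- exact: CkM.
Qed.

Lemma Ck_smooth f : (forall n, Ck n f) -> smooth f.
Proof.
move=> Cf; have CI ds : forall n, Ck n (iter_partial ds f).
  elim: ds => [//|b ds IH] n /=.
  have [fx [fy [fd Fx Fy]]] := IH n.+1.
  case: b.
    rewrite (_ : (fun _ => _) = fx)//; apply/funext => p.
    by have [_ ->] := rdiff_derive_x (fd p).
  rewrite (_ : (fun _ => _) = fy)//; apply/funext => p.
  by have [_ ->] := rdiff_derive_y (fd p).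
split=> [ds|ds p]; first exact: (CI ds 0%N).
have [fx [fy [fd _ _]]] := CI ds 1%N.
by have [dx _] := rdiff_derive_x (fd p); have [dy _] := rdiff_derive_y (fd p).
Qed.

End PlaneSmooth.

(** * Classical and weak dbar equations *)

Section DbarCalculus.
Variable R : realType.
Implicit Types (f g phi : R * R -> R) (p q : R * R) (F G u v w : R * R -> R[i]).

Local Notation Re := complex.Re.
Local Notation Im := complex.Im.

Definition sqz p : R := sqmod (toC p).

Lemma sqzE p : sqz p = p.1 ^+ 2 + p.2 ^+ 2. Proof. by []. Qed.

Lemma sqz_ge0 p : 0 <= sqz p. Proof. exact: sqmod_ge0. Qed.

Lemma cont_sqz : continuous sqz.
Proof.
move=> p; rewrite (_ : sqz = fun q => q.1 * q.1 + q.2 * q.2); last first.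
  by apply/funext => q; rewrite sqzE !expr2.
by apply: contD2; apply: contM2; do ?[exact: cont_fst|exact: cont_snd].
Qed.

Definition ccont F : Prop := continuous (fun p => Re (F p)) /\ continuous (fun p => Im (F p)).

Lemma ccont_measurable F : ccont F -> cmeasurable F.
Proof. by move=> [c1 c2]; split; exact: cont2_measurable. Qed.

Lemma ccontD F G : ccont F -> ccont G -> ccont (fun p => F p + G p).
Proof.
by move=> [F1 F2] [G1 G2]; split => p; under eq_fun do rewrite !ReImE;
  apply: contD2; do ?[exact: F1|exact: F2|exact: G1|exact: G2].
Qed.

Lemma ccontM F G : ccont F -> ccont G -> ccont (fun p => F p * G p).
Proof.
move=> [F1 F2] [G1 G2]; split => p; under eq_fun do rewrite !ReImE.
  apply: contD2; last apply: contN2;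
  by apply: contM2; do ?[exact: F1|exact: F2|exact: G1|exact: G2].
by apply: contD2; apply: contM2; do ?[exact: F1|exact: F2|exact: G1|exact: G2].
Qed.

Lemma ccontC f : continuous f -> ccont (fun p => (f p)%:C).
Proof. by move=> cf; split => //= p; exact: contC2. Qed.

Lemma ccont_cst (c : R[i]) : ccont (fun=> c).
Proof. by split => p; exact: contC2. Qed.

Lemma ccontJ F : ccont F -> ccont (fun p => (F p)^*).
Proof.
by move=> [F1 F2]; split => p; under eq_fun do rewrite !ReImE; [exact: F1|apply: contN2; exact: F2].
Qed.

Lemma ccont_toC : ccont (@toC R).
Proof. by split => p; [exact: cont_fst|exact: cont_snd]. Qed.

Lemma ccontX F n : ccont F -> ccont (fun p => F p ^+ n).
Proof.
move=> cF; elim: n => [|n IH]; first by under eq_fun do rewrite expr0; exact: ccont_cst.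
by under eq_fun do rewrite exprS; exact: ccontM.
Qed.

Definition cdiff F p (a b : R[i]) : Prop :=
  rdiff (fun q => Re (F q)) p (Re a) (Re b) /\ rdiff (fun q => Im (F q)) p (Im a) (Im b).

Definition has_dbar F p (d : R[i]) : Prop :=
  exists a b, cdiff F p a b /\ d = (((Re a - Im b) / 2) +i* ((Im a + Re b) / 2))%C.

Lemma eq_rdiff f g p a b a' b' : (forall q, f q = g q) -> a = a' -> b = b' ->
  rdiff f p a b -> rdiff g p a' b'.
Proof. by move=> /funext -> -> ->. Qed.

Lemma has_dbar_ccont F d : (forall p, has_dbar F p (d p)) -> ccont F.
Proof.
by move=> Fd; split => p; have [a [b [[/rdiff_cont c1 /rdiff_cont c2] _]]] := Fd p.
Qed.

Lemma has_dbarD F G p d e : has_dbar F p d -> has_dbar G p e ->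
  has_dbar (fun q => F q + G q) p (d + e).
Proof.
move=> [a [b [[F1 F2] ->]]] [a' [b' [[G1 G2] ->]]]; exists (a + a'), (b + b'); split; last first.
  by apply: complex_ext; rewrite !ReImE; field.
by split; [apply: eq_rdiff (rdiffD F1 G1)|apply: eq_rdiff (rdiffD F2 G2)] => *; rewrite ReImE.
Qed.

Lemma has_dbarM F G p d e : has_dbar F p d -> has_dbar G p e ->
  has_dbar (fun q => F q * G q) p (d * G p + F p * e).
Proof.
move=> [a [b [[F1 F2] ->]]] [a' [b' [[G1 G2] ->]]].
exists (a * G p + F p * a'), (b * G p + F p * b'); split; last first.
  by apply: complex_ext; rewrite !ReImE; field.
split.
- apply: eq_rdiff (rdiffD (rdiffM F1 G1) (rdiffN (rdiffM F2 G2))) => *; rewrite !ReImE //; ring.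
- apply: eq_rdiff (rdiffD (rdiffM F1 G2) (rdiffM F2 G1)) => *; rewrite !ReImE //; ring.
Qed.

Lemma has_dbarC f p a b : rdiff f p a b ->
  has_dbar (fun q => (f q)%:C) p ((a / 2) +i* (b / 2))%C.
Proof.
move=> fd; exists a%:C, b%:C; split; last by apply: complex_ext; rewrite !ReImE; ring.
by split; [exact: fd|exact: rdiff_cst].
Qed.

Lemma has_dbar_cst (c : R[i]) p : has_dbar (fun=> c) p 0.
Proof.
exists 0, 0; split; first by split; exact: rdiff_cst.
by apply: complex_ext; rewrite !ReImE; ring.
Qed.

Lemma has_dbarZ (c : R[i]) F p d : has_dbar F p d -> has_dbar (fun q => c * F q) p (c * d).
Proof. by move=> Fd; have := has_dbarM (has_dbar_cst c p) Fd; rewrite mul0r add0r. Qed.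

Lemma has_dbar_conj p : has_dbar (fun q => (toC q)^*) p 1.
Proof.
exists 1, (0 +i* (- 1))%C; split; last by apply: complex_ext; rewrite !ReImE; field.
split; first by apply: eq_rdiff (rdiff_fst p).
by apply: eq_rdiff (rdiffN (rdiff_snd p)) => //=; rewrite oppr0.
Qed.

Lemma has_dbar_toC p : has_dbar (@toC R) p 0.
Proof.
exists 1, (0 +i* 1)%C; split; last by apply: complex_ext; rewrite !ReImE; field.
by split; [exact: rdiff_fst|exact: rdiff_snd].
Qed.

Lemma has_dbar_toCX n p : has_dbar (fun q => toC q ^+ n) p 0.
Proof.
elim: n => [|n IH]; first by under eq_fun do rewrite expr0; exact: has_dbar_cst.
under eq_fun do rewrite exprS.
by have := has_dbarM (has_dbar_toC p) IH; rewrite mul0r mulr0 addr0.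
Qed.

Lemma has_dbar_conjX n p :
  has_dbar (fun q => (toC q)^* ^+ n.+1) p (n.+1%:R * (toC p)^* ^+ n).
Proof.
elim: n => [|n IH].
  by under eq_fun do rewrite expr1; rewrite expr0 mulr1; exact: has_dbar_conj.
under eq_fun do rewrite exprS.
have := has_dbarM (has_dbar_conj p) IH; congr has_dbar.
by rewrite exprS -natr1; ring.
Qed.

(** The chain rule with dbar |z|^2 = z. *)
Lemma has_dbar_radial (k : R -> R) (c : R) p : is_derive (sqz p) 1 k c ->
  has_dbar (fun q => (k (sqz q))%:C) p (c%:C * toC p).
Proof.
move=> kd.
have sd : rdiff sqz p (2 * p.1) (2 * p.2).
  have := rdiffD (rdiffM (rdiff_fst p) (rdiff_fst p)) (rdiffM (rdiff_snd p) (rdiff_snd p)).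
  by apply: eq_rdiff => [q||]; rewrite ?sqzE ?expr2//; ring.
have := has_dbarC (rdiff_comp sd kd); congr has_dbar.
by apply: complex_ext; rewrite !ReImE; field.
Qed.

(** Re (dbar F) and Im (dbar F) are the divergences of (Re F, - Im F) / 2 and (Im F, Re F) / 2. *)
Lemma cint_dbar_compact F G (r : R) : (forall p, has_dbar F p (G p)) -> ccont G ->
  (forall p, r < sqz p -> F p = 0 /\ G p = 0) -> cint G = 0.
Proof.
(* [r] bounds |z|^2 whereas the divergence theorem bounds the coordinates; 1 <= s gives r <= s <=
   s^2. *)
move=> FG [cG1 cG2] supp; pose s := Num.max r 1.
have s1 : 1 <= s by rewrite le_max lexx orbT.
have far p : (s < `|p.1|) || (s < `|p.2|) -> r < sqz p.
  have sq (x : R) : s < `|x| -> r < x ^+ 2.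
    move=> sx; rewrite -[_ ^+ 2]real_normK ?num_real//.
    have rs : r <= s by rewrite le_max lexx.
    by apply: le_lt_trans rs _; nra.
  rewrite sqzE => /orP[/sq h|/sq h]; apply: (lt_le_trans h).
    by rewrite lerDl sqr_ge0.
  by rewrite lerDr sqr_ge0.
have half f p a b : rdiff f p a b -> rdiff (fun q => f q / 2) p (a / 2) (b / 2).
  move=> fd; have := rdiffM fd (rdiff_cst 2^-1 p).
  by apply: eq_rdiff => *; rewrite ?mulr0 ?addr0.
rewrite /cint; apply: complex_ext => /=.
- apply: (@compact_divergence R (fun p => Re (F p) / 2) (fun p => - (Im (F p) / 2)) _ _ cG1 s).
    move=> p; have [a [b [[F1 F2] ->]]] := FG p.
    exists (Re a / 2), (Re b / 2), (- (Im a / 2)), (- (Im b / 2)); split.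
    + exact: half.
    + by apply: rdiffN; exact: half.
    + by rewrite /= mulrBl.
  by move=> p /far/supp[-> ->]; rewrite /= mul0r oppr0.
- apply: (@compact_divergence R (fun p => Im (F p) / 2) (fun p => Re (F p) / 2) _ _ cG2 s).
    move=> p; have [a [b [[F1 F2] ->]]] := FG p.
    exists (Im a / 2), (Im b / 2), (Re a / 2), (Re b / 2); split; try exact: half.
    by rewrite /= mulrDl.
  by move=> p /far/supp[-> ->]; rewrite /= mul0r.
Qed.

(* Bounded with compact support. *)
Definition bcs F : Prop := cmeasurable F /\ exists C r : R,
  forall p, sqmod (F p) <= C /\ (r < sqz p -> F p = 0).

Lemma ccont_bcs F (r : R) : ccont F -> (forall p, r < sqz p -> F p = 0) -> bcs F.
Proof.
move=> cF F0; split; first exact: ccont_measurable.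
pose s := Num.max r 1.
have s1 : 1 <= s by rewrite le_max lexx orbT.
have K : compact (`[- s, s] `*` `[- s, s] : set (R * R)).
  by apply: compact_setX; exact: segment_compact.
have cS : continuous (fun p => sqmod (F p)).
  move=> p; rewrite /sqmod; under eq_fun do rewrite !expr2.
  by apply: contD2; apply: contM2; do ?[exact: cF.1|exact: cF.2].
have := compact_bounded (continuous_compact (continuous_subspaceT cS) K).
move=> [M [_ MP]]; exists (Num.max (M + 1) 0), r => p; split; last exact: F0.
have [rp|pr] := ltP r (sqz p).
  by rewrite F0// /sqmod /= expr0n/= addr0 le_max lexx orbT.
rewrite le_max; apply/orP; left; rewrite -[leLHS]ger0_norm ?sqmod_ge0//.
apply: MP; first by rewrite ltrDl.
have rs : r <= s by rewrite le_max lexx.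
exists p => //; split => /=; rewrite in_itv/= -ler_norml.
  rewrite leNgt; apply/negP => h; have := sqr_ge0 p.2; move: pr; rewrite sqzE.
  by rewrite -(@real_normK _ p.1) ?num_real//; nra.
rewrite leNgt; apply/negP => h; have := sqr_ge0 p.1; move: pr; rewrite sqzE.
by rewrite -(@real_normK _ p.2) ?num_real//; nra.
Qed.

Lemma rint_box f (C r : R) : measurable_fun setT f -> (forall p, `|f p| <= C) ->
  (forall p, r < sqz p -> f p = 0) -> rint f.
Proof.
move=> mf fC f0; pose s := Num.max r 1.
have s1 : 1 <= s by rewrite le_max lexx orbT.
pose A : set (R * R) := `](- s - 1), s] `*` `](- s - 1), s].
have mA : measurable A by apply: measurableX; exact: measurable_itv.
have iA : (@lam2 R).-integrable A (EFin \o f).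
  apply: measurable_bounded_integrable => //.
  - by rewrite [X in (X < _)%E]lam2_box ?ltry//; lra.
  - exact: measurable_funTS.
  - by exists C; split; [exact: num_real|move=> M CM x _ /=; exact: le_trans (ltW CM)].
have := (@integrable_mkcond _ _ R (@lam2 R) _ (EFin \o f) mA).1 iA.
rewrite restrict_EFin; apply: eq_integrable => // p _ /=; rewrite patchE.
case: ifPn => //; rewrite notin_setE => pA; rewrite f0// ltNge; apply/negP => pr.
apply: pA; have rs : r <= s by rewrite le_max lexx.
split => /=; rewrite in_itv/=.
  have : `|p.1| <= s; last by rewrite ler_norml; lra.
  rewrite leNgt; apply/negP => h; have := sqr_ge0 p.2; move: pr; rewrite sqzE.
  by rewrite -(@real_normK _ p.1) ?num_real//; nra.
have : `|p.2| <= s; last by rewrite ler_norml; lra.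
rewrite leNgt; apply/negP => h; have := sqr_ge0 p.1; move: pr; rewrite sqzE.
by rewrite -(@real_normK _ p.2) ?num_real//; nra.
Qed.

Lemma bcs_cintegrable F : bcs F -> cintegrable F.
Proof.
move=> [[m1 m2] [C [r FP]]].
have C0 : 0 <= C by have [h _] := FP (0, 0); exact: le_trans (sqmod_ge0 _) h.
have bd (x y : R) : x ^+ 2 + y ^+ 2 <= C -> `|x| <= C + 1.
  move=> h; have := sqr_ge0 y; have : `|x| ^+ 2 = x ^+ 2 by rewrite real_normK ?num_real.
  have := normr_ge0 x; nra.
split; apply: (@rint_box _ (C + 1) r) => // p.
- by apply: bd; exact: (FP p).1.
- by move=> /((FP p).2) ->.
- by apply: bd; rewrite addrC; exact: (FP p).1.
- by move=> /((FP p).2) ->.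
Qed.

Lemma test_support phi : test_fun phi -> exists r : R, forall p, r < sqz p ->
  [/\ phi p = 0, 'D_(ex R) phi p = 0 & 'D_(ey R) phi p = 0].
Proof.
move=> [_ [r rP]]; exists (r ^+ 2).
have P0 p : r ^+ 2 < sqz p -> phi p = 0.
  move=> h; apply: rP; rewrite /Defs.absz /cmod -/(sqz p).
  apply: (@le_lt_trans _ _ `|r|); first exact: ler_norm.
  by rewrite -sqrtr_sqr ltr_sqrt// (le_lt_trans _ h)// sqr_ge0.
move=> p h; have E : \near p, phi p = cst 0 p.
  have oA : open [set q | r ^+ 2 < sqz q].
    by have /continuousP/(_ _ (@open_gt R (r ^+ 2))) := cont_sqz.
  have := open_nbhs_nbhs (conj oA h : open_nbhs p _).
  by apply: filterS => q /P0.
by rewrite P0// !(near_eq_derive _ E) !derive_cst.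
Qed.

Lemma test_ccont_dbar phi : test_fun phi -> ccont (dbar phi).
Proof.
move=> [[sc _] _]; have cx := sc [:: true]; have cy := sc [:: false].
split => p.
  by apply: (@contM2 _ (fun p => 'D_(ex R) phi p) (fun=> 2^-1)); [exact: cx|exact: contC2].
by apply: (@contM2 _ (fun p => 'D_(ey R) phi p) (fun=> 2^-1)); [exact: cy|exact: contC2].
Qed.

Lemma test_bcs phi : test_fun phi -> bcs (dbar phi).
Proof.
move=> tp; have [r rP] := test_support tp.
apply: (ccont_bcs (r := r)); first exact: test_ccont_dbar.
by move=> p /rP[_ h1 h2]; rewrite /dbar h1 h2 !mul0r.
Qed.

Lemma test_bcs_real phi : test_fun phi -> bcs (fun p => (phi p)%:C).
Proof.
move=> tp; have [r rP] := test_support tp.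
apply: (ccont_bcs (r := r)); last by move=> p /rP[-> _ _].
by apply: ccontC; have [[sc _] _] := tp; exact: (sc [::]).
Qed.

(** The function dbar (u phi) = v phi + u dbar phi has integral 0. It is continuous because [u] and
    [v] are, although the partial derivatives of [u] may fail to be. *)
Lemma classical_weak_dbar u v : (forall p, has_dbar u p (v p)) -> ccont v -> weak_dbar u v.
Proof.
move=> uf cf phi tp; have [r rP] := test_support tp.
have cu := has_dbar_ccont uf.
have cd := test_ccont_dbar tp.
have cphi : continuous phi by have [[sc _] _] := tp; exact: (sc [::]).
have d0 p : r < sqz p -> dbar phi p = 0.
  by move=> /rP[_ h1 h2]; rewrite /dbar h1 h2 !mul0r.
have H : cint (fun p => v p * (phi p)%:C + u p * dbar phi p) = 0.
  apply: (@cint_dbar_compact (fun p => u p * (phi p)%:C) _ r).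
  - move=> p; apply: has_dbarM => //; apply: has_dbarC.
    by apply: smooth_rdiff; have [] := tp.
  - by apply: ccontD; apply: ccontM => //; exact: ccontC.
  - by move=> p rp; have [h0 _ _] := rP p rp; rewrite h0 d0// !mulr0 addr0.
have b1 : cintegrable (fun p => v p * (phi p)%:C).
  apply: bcs_cintegrable; apply: (ccont_bcs (r := r)).
    by apply: ccontM => //; exact: ccontC.
  by move=> p /rP[-> _ _]; rewrite mulr0.
have b2 : cintegrable (fun p => u p * dbar phi p).
  apply: bcs_cintegrable; apply: (ccont_bcs (r := r)); first exact: ccontM.
  by move=> p /d0 ->; rewrite mulr0.
by move: H; rewrite cintD// addrC => /eqP; rewrite addr_eq0 => /eqP.
Qed.

Lemma cmod_ge_Re (a : R[i]) : `|Re a| <= cmod a.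
Proof. by rewrite -sqrtr_sqr /cmod ler_wsqrtr// lerDl sqr_ge0. Qed.

Lemma cmod_ge_Im (a : R[i]) : `|Im a| <= cmod a.
Proof. by rewrite -sqrtr_sqr /cmod ler_wsqrtr// lerDr sqr_ge0. Qed.

Lemma cmod_le (a : R[i]) : cmod a <= `|Re a| + `|Im a|.
Proof.
rewrite /cmod -[leRHS]ger0_norm ?addr_ge0// -sqrtr_sqr ler_wsqrtr// /sqmod.
rewrite sqrrD !real_normK ?num_real// addrAC lerDl mulrn_wge0// mulr_ge0//.
Qed.

(** The difference quotient Phi, completed by [l] at p, already is a Carathéodory slope: its real
    and imaginary parts serve as slopes of Re h and Im h, with the Cauchy-Riemann equations built
    in. *)
Lemma entire_has_dbar h p : entire h -> has_dbar h p 0.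
Proof.
move=> /(_ p)[l lP].
pose Phi q : R[i] := if q == p then l else (h q - h p) / (toC q - toC p).
have c1 : {for p, continuous (fun q => Re (Phi q))} /\ {for p, continuous (fun q => Im (Phi q))}.
  split; apply/cont2P => e e0; have [d d0 dP] := lP e e0;
  exists (d / 2); rewrite ?divr_gt0// => q q1 q2; rewrite {2}/Phi eqxx /Phi;
  (case: eqVneq => [_|qp]; first by rewrite subrr normr0);
  have qd : cmod (toC q - toC p) < d.
  - by apply: le_lt_trans (cmod_le _) _; rewrite !ReImE /=; lra.
  - by apply: le_lt_trans _ (dP q qp qd); rewrite -ReN -ReD cmod_ge_Re.
  - by apply: le_lt_trans (cmod_le _) _; rewrite !ReImE /=; lra.
  - by apply: le_lt_trans _ (dP q qp qd); rewrite -ImN -ImD cmod_ge_Im.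
have hE q : h q = h p + Phi q * (toC q - toC p).
  rewrite /Phi; case: eqVneq => [->|qp]; first by rewrite subrr mulr0 addr0.
  rewrite mulfVK; first by rewrite addrC subrK.
  apply: contra qp; rewrite subr_eq0 => /eqP[e1 e2].
  by rewrite [q]surjective_pairing [p]surjective_pairing e1 e2.
have [cR cI] := c1; exists l, ((- Im l) +i* (Re l))%C; split; last first.
  by apply: complex_ext; rewrite !ReImE; ring.
split.
- exists (fun q => Re (Phi q)), (fun q => - Im (Phi q)); split => //.
  + exact: contN2.
  + by rewrite /Phi eqxx.
  + by rewrite /Phi eqxx.
  + by move=> q; rewrite hE !ReImE; ring.
- exists (fun q => Im (Phi q)), (fun q => Re (Phi q)); split => //.
  + by rewrite /Phi eqxx.
  + by rewrite /Phi eqxx.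
  + by move=> q; rewrite hE !ReImE; ring.
Qed.

Lemma entire_toCX n : entire (fun p => toC p ^+ n : R[i]).
Proof.
elim: n => [|n IH] p.
  exists 0 => e e0; exists 1 => // q _ _.
  by rewrite !expr0 subrr mul0r subrr /cmod /sqmod /= expr0n/= addr0 sqrtr0.
have [l lP] := IH p; exists (toC p * l + toC p ^+ n) => e e0.
(* With k = e / (M + M) the three error terms of the product rule are at most |p| k, k and k |l|, in
   total k M < e. *)
pose M := cmod (toC p) + cmod l + 1.
have cmod_ge0 (a : R[i]) : 0 <= cmod a by exact: sqrtr_ge0.
have M0 : 0 < M by rewrite ltr_wpDl// addr_ge0.
have [d d0 dP] := lP (Num.min 1 (e / (M + M))) ltac:(by rewrite lt_min ltr01 divr_gt0// addr_gt0).
exists (Num.min 1 (Num.min d (e / (M + M)))).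
  by rewrite !lt_min ltr01 d0 divr_gt0// addr_gt0.
move=> q qp; rewrite !lt_min => /and3P[q1 qd qe].
have := dP q qp qd; rewrite lt_min => /andP[Q1 Qe].
set Q := (_ / _) in Q1 Qe.
have qpn : toC q - toC p != 0.
  apply: contra qp; rewrite subr_eq0 => /eqP[e1 e2].
  by rewrite [q]surjective_pairing [p]surjective_pairing e1 e2.
rewrite (_ : _ - _ = toC p * (Q - l) + (toC q - toC p) * (Q - l) + (toC q - toC p) * l); last first.
  by rewrite /Q !exprS; field.
have cmodM (a b : R[i]) : cmod (a * b) = cmod a * cmod b.
  by rewrite /cmod sqmodM sqrtrM// sqmod_ge0.
have cmodD (a b : R[i]) : cmod (a + b) <= cmod a + cmod b.
  rewrite -(@ler_pXn2r _ 2) ?nnegrE ?addr_ge0// sqrrD /cmod !sqr_sqrtr ?sqmod_ge0//.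
  rewrite -sqrtrM ?sqmod_ge0//.
  have : Re a * Re b + Im a * Im b <= Num.sqrt (sqmod a * sqmod b).
    apply: le_trans (ler_norm _) _; rewrite -sqrtr_sqr ler_wsqrtr//.
    rewrite /sqmod -subr_ge0.
    rewrite (_ : _ - _ = (Re a * Im b - Im a * Re b) ^+ 2) ?sqr_ge0//; ring.
  rewrite /sqmod !ReImE; set S := Num.sqrt _ => h; rewrite mulr2n; nra.
apply: le_lt_trans (cmodD _ _) _.
apply: le_lt_trans (lerD (cmodD _ _) (lexx _)) _; rewrite !cmodM.
have MM : e = e / (M + M) * (M + M) by rewrite divfK// gt_eqF// addr_gt0.
rewrite [ltRHS]MM; set k := e / _ in qe Qe *.
have k0 : 0 < k by rewrite divr_gt0// addr_gt0.
apply: (@le_lt_trans _ _ (cmod (toC p) * k + 1 * k + k * cmod l)).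
  by rewrite !lerD// ler_pM// ltW.
rewrite (_ : _ + _ = k * M); last by rewrite /M; ring.
by rewrite ltr_pM2l// ltrDl.
Qed.

End DbarCalculus.

(** * Angular modes of weakly closed functions *)

Section Modes.
Variables (R : realType) (m : R).
Hypothesis m0 : 0 <= m.
Implicit Types (f g phi : R * R -> R) (p q : R * R) (F G u v w psi : R * R -> R[i]).

Local Notation Re := complex.Re.
Local Notation Im := complex.Im.
Local Notation W := (weight m).
Local Notation ip := (inner m).

Lemma realcD (x y : R) : (x + y)%:C = x%:C + y%:C.
Proof. by apply: complex_ext; rewrite !ReImE ?addr0. Qed.
Lemma realcN (x : R) : (- x)%:C = - x%:C.
Proof. by apply: complex_ext; rewrite !ReImE ?oppr0. Qed.
Lemma realcM (x y : R) : (x * y)%:C = x%:C * y%:C.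
Proof. by apply: complex_ext; rewrite !ReImE; ring. Qed.
Lemma realcV (x : R) : (x^-1)%:C = (x%:C)^-1.
Proof. exact: fmorphV (real_complex R) x. Qed.
Lemma realc_nat n : (n%:R : R)%:C = n%:R :> R[i].
Proof. exact: rmorph_nat (real_complex R) n. Qed.
Lemma realcX (x : R) n : (x ^+ n)%:C = x%:C ^+ n.
Proof. exact: rmorphXn (real_complex R) n x. Qed.

(** Conjugate and inverse weight undo those inside [inner], so the plain integral of u G becomes an
    inner product, to which Cauchy-Schwarz and L^2 limits apply. *)
Definition dual G p : R[i] := (G p)^* * ((W p)^-1)%:C.

Lemma dual_L2w G : bcs G -> L2w m (dual G).
Proof.
move=> [mG [C [r GP]]]; apply/L2wP.
have mW := @weight_measurable R m.
have md : cmeasurable (dual G).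
  apply: cmeasurableM; first exact: cmeasurableJ.
  apply: cmeasurableC; rewrite (_ : (fun _ => _) = fun p => expR (- (- (Defs.absz p `^ m)))).
    apply: measurableT_comp => //; apply: measurableT_comp => //; apply: measurableT_comp => //.
    by apply: (measurableT_comp (f := fun x : R => x `^ m)); [exact: measurable_powR|exact: absz_measurable].
  by apply/funext => p; rewrite /weight [in RHS]expRN.
split => //; apply: (@rint_box _ _ (C * expR (Num.sqrt r `^ m)) r).
- by apply: measurable_funM => //; exact: sqmod_measurable.
- move=> p; rewrite ger0_norm ?mulr_ge0 ?sqmod_ge0 ?(ltW (weight_gt0 _ _))//.
  have [C0 Gr] := GP p; rewrite /dual sqmodM sqmodJ sqmodC expr2.
  rewrite mulrA -mulrA mulVf ?gt_eqF ?weight_gt0// mulr1.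
  have [rp|pr] := ltP r (sqz p).
    rewrite Gr// /sqmod/= expr0n/= addr0 mul0r mulr_ge0 ?expR_ge0//.
    exact: le_trans (sqmod_ge0 _) C0.
  apply: ler_pM; rewrite ?sqmod_ge0 ?invr_ge0 ?(ltW (weight_gt0 _ _))//.
  rewrite /weight expRN invrK ler_expR; apply: ge0_ler_powR => //.
  + by rewrite nnegrE sqrtr_ge0.
  + by rewrite nnegrE sqrtr_ge0.
  + by rewrite /Defs.absz /cmod ler_wsqrtr.
- by move=> p /((GP p).2); rewrite /dual => ->; rewrite /sqmod !ReImE; ring.
Qed.

Lemma dualE u G p : u p * (dual G p)^* * (W p)%:C = u p * G p.
Proof.
rewrite /dual conjM conjK conjC -!mulrA; congr (_ * _).
rewrite [X in _ * X](_ : _ = 1) ?mulr1//.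
rewrite -[LHS]/((W p)^-1%:C * (W p)%:C) -(rmorphM (real_complex R)).
by rewrite mulVf ?rmorph1// gt_eqF ?weight_gt0.
Qed.

Lemma cint_dual u G : cint (fun p => u p * G p) = ip u (dual G).
Proof. by rewrite /inner; apply: eq_cint => p; rewrite dualE. Qed.

Lemma L2w_bcs_cintegrable u G : L2w m u -> bcs G -> cintegrable (fun p => u p * G p).
Proof.
move=> Lu bG; have := ip_cintegrable Lu (dual_L2w bG).
by under [X in cintegrable X]eq_fun do rewrite dualE.
Qed.

(* By Weyl's lemma these are the elements of A^2 up to null sets; the proof does
   not use this. *)
Definition wclosed w : Prop := L2w m w /\
  forall phi, test_fun phi -> cint (fun p => w p * dbar phi p) = 0.

Lemma A2w_wclosed h : A2w m h -> wclosed h.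
Proof.
move=> [eh Lh]; split => // phi tp.
rewrite (classical_weak_dbar (v := fun=> 0) _ _ tp).
- by under eq_fun do rewrite mul0r; rewrite cint0 oppr0.
- by move=> p; exact: entire_has_dbar.
- exact: ccont_cst.
Qed.

(** Test functions are real, so a complex one is split: dbar psi = dbar (Re psi) + i dbar (Im
    psi). *)
Lemma wclosed_dbar w psi (d : R * R -> R[i]) : wclosed w ->
  test_fun (fun p => Re (psi p)) -> test_fun (fun p => Im (psi p)) ->
  (forall p, has_dbar psi p (d p)) -> cint (fun p => w p * d p) = 0.
Proof.
move=> [Lw wc] t1 t2 pd.
have dE p : d p = dbar (fun p => Re (psi p)) p + (0 +i* 1)%C * dbar (fun p => Im (psi p)) p.
  have [a [b [[r1 r2] ->]]] := pd p; rewrite /dbar.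
  have [_ ->] := rdiff_derive_x r1; have [_ ->] := rdiff_derive_y r1.
  have [_ ->] := rdiff_derive_x r2; have [_ ->] := rdiff_derive_y r2.
  by apply: complex_ext; rewrite !ReImE; field.
have i1 := L2w_bcs_cintegrable Lw (test_bcs t1).
have i2 := L2w_bcs_cintegrable Lw (test_bcs t2).
rewrite (@eq_cint _ _ (fun p => w p * dbar (fun p => Re (psi p)) p +
   (0 +i* 1)%C * (w p * dbar (fun p => Im (psi p)) p))); last by move=> p; rewrite dE; ring.
by rewrite cintD ?cintZ ?wc ?mulr0 ?addr0//; exact: cintegrableZ.
Qed.

Lemma Ck_toCX k n : Ck k (fun p : R * R => Re (toC p ^+ n)) /\ Ck k (fun p : R * R => Im (toC p ^+ n)).
Proof.
elim: n => [|n [IH1 IH2]].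
  by split; under eq_fun do rewrite expr0 !ReImE; exact: Ck_cst.
have x := @Ck_fst R k; have y := @Ck_snd R k.
have neg f : Ck k f -> Ck k (fun p => - f p).
  by move=> Cf; under eq_fun do rewrite -mulN1r; apply: CkM => //; exact: Ck_cst.
split; under eq_fun do rewrite exprS !ReImE.
  by apply: CkD; [exact: CkM x IH1|apply: neg; exact: CkM y IH2].
by apply: CkD; [exact: CkM x IH2|exact: CkM y IH1].
Qed.

Lemma Ck_sqz k : Ck k (@sqz R).
Proof.
rewrite (_ : @sqz R = fun p => p.1 * p.1 + p.2 * p.2); last by apply/funext => p; rewrite sqzE !expr2.
by apply: CkD; apply: CkM; do ?[exact: Ck_fst|exact: Ck_snd].
Qed.

Lemma test_radial f (K : R -> R) (b : R) : (forall k, Ck k f) -> smooth1 K ->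
  (forall t, b <= t -> K t = 0) -> test_fun (fun p => f p * K (sqz p)).
Proof.
move=> Cf sK Kb; split.
  by apply: Ck_smooth => k; apply: CkM => //; apply: Ck_comp => //; exact: Ck_sqz.
exists (Num.max b 1) => p bp; rewrite Kb ?mulr0//.
have b1 : b <= Num.max b 1 by rewrite le_max lexx.
have b2 : 1 <= Num.max b 1 by rewrite le_max lexx orbT.
have h : Defs.absz p ^+ 2 = sqz p by rewrite sqr_sqrtr// sqmod_ge0.
rewrite -h (le_trans b1)// (le_trans (ltW bp))// expr2 ler_peMr//.
  by rewrite (le_trans _ (ltW bp))// (le_trans _ b2).
by rewrite (le_trans b2)// ltW.
Qed.

Lemma test_toCX n (K : R -> R) (b : R) : smooth1 K -> (forall t, b <= t -> K t = 0) ->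
  test_fun (fun p => Re (toC p ^+ n * (K (sqz p))%:C)) /\
  test_fun (fun p => Im (toC p ^+ n * (K (sqz p))%:C)).
Proof.
move=> sK Kb; split; under eq_fun do rewrite !ReImE mulr0 ?subr0 ?add0r;
  apply: (@test_radial _ K b) => // k; have [] := Ck_toCX k n; by [].
Qed.

Lemma test_conjX n (K : R -> R) (b : R) : smooth1 K -> (forall t, b <= t -> K t = 0) ->
  test_fun (fun p => Re ((toC p)^* ^+ n * (K (sqz p))%:C)) /\
  test_fun (fun p => Im ((toC p)^* ^+ n * (K (sqz p))%:C)).
Proof.
move=> sK Kb; split; under eq_fun do rewrite -conjX !ReImE mulr0 ?subr0 ?add0r.
  by apply: (@test_radial _ K b) => // k; have [] := Ck_toCX k n.
apply: (@test_radial _ K b) => // k; under eq_fun do rewrite -mulN1r.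
by apply: CkM; [exact: Ck_cst|have [] := Ck_toCX k n].
Qed.

(* If K' = H and K vanishes at infinity, then z^n K(|z|^2) is a test function and
   its dbar is z^n.+1 H(|z|^2). *)
Lemma mode_pos w n (H : R -> R) : wclosed w -> annular H ->
  cint (fun p => w p * (toC p ^+ n.+1 * (H (sqz p))%:C)) = 0.
Proof.
move=> wc aH; have [F [a [b [c [a0 FD sF F0 Fc]]]]] := annular_primitive aH.
pose K t := F t + (- c).
have sK : smooth1 K by apply: smooth1D => //; exact: smooth1_cst.
have Kb t : b <= t -> K t = 0 by move=> bt; rewrite /K Fc// subrr.
have KD (t : R) : is_derive t 1 K (H t).
  by apply: (is_derive_eq (is_deriveD (FD t) (is_derive_cst (- c) t 1))); rewrite addr0.
have [t1 t2] := test_toCX n sK Kb.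
apply: (wclosed_dbar wc t1 t2) => p.
have := has_dbarM (has_dbar_toCX n p) (has_dbar_radial (KD (sqz p))).
by congr has_dbar; rewrite exprSr; ring.
Qed.

Lemma Cn_invX k n : Cn (@pos R) n (fun t => t^-1 ^+ k).
Proof.
elim: k => [|k IH]; first by under eq_fun do rewrite expr0; apply: Cn_cst; exact: open_pos.
by under eq_fun do rewrite exprS; apply: CnM => //; exact: Cn_inv.
Qed.

Lemma toC_sqz p : toC p * (toC p)^* = (sqz p)%:C.
Proof. by rewrite sqmodE. Qed.

(* Here the test function is zbar^(j+1) N(|z|^2) with N(t) = M(t) / t^(j+1). *)
Lemma mode_neg_exact w j (M G : R -> R) : wclosed w -> annular M -> annular G ->
  (forall t : R, is_derive t 1 M (G t)) ->
  cint (fun p => w p * ((toC p)^* ^+ j * (G (sqz p) * (sqz p)^-1 ^+ j)%:C)) = 0.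
Proof.
move=> wc aM [_ [a [b [a0 ab Gab]]]] MD.
pose N t := M t * t^-1 ^+ j.+1.
have aN : annular N by apply: annularMl => // n; exact: Cn_invX.
have [sN [a' [b' [a'0 ab' Nab']]]] := aN.
have [t1 t2] := @test_conjX j.+1 N b' sN ltac:(by move=> t h; rewrite Nab'// h orbT).
(* The dbar derivative of zbar^(j+1) N(|z|^2) is zbar^j ((j+1) N + t N'), and the bracket equals
   t^-j (t^(j+1) N)' = t^-j M'. At t = 0 both sides vanish with the supports. *)
have NE t : 0 <= t -> j.+1%:R * N t + t * derive1 N t = G t * t^-1 ^+ j.
  rewrite le_eqVlt => /orP[/eqP <-|t0].
    by rewrite mul0r addr0 Gab ?(ltW a0)// Nab' ?(ltW a'0)// mulr0 mul0r.
  have t0' : t != 0 by rewrite gt_eqF.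
  have dI : is_derive t 1 (fun s : R => s^-1 ^+ j.+1) (- (j.+1%:R * t^-1 ^+ j.+2)).
    elim: (j) => [|i IH].
      rewrite (_ : (fun _ => _) = fun s : R => s^-1); last by apply/funext => s; rewrite expr1.
      by apply: (is_derive_eq (is_derive1_inv t0)); rewrite mul1r expr2.
    rewrite (_ : (fun _ => _) = fun s : R => s^-1 * s^-1 ^+ i.+1); last first.
      by apply/funext => s; rewrite exprS.
    apply: (is_derive_eq (is_deriveM (is_derive1_inv t0) IH)).
    by rewrite /GRing.scale/= -[i.+2%:R]natr1 !exprS; ring.
  have [_] := is_deriveM (MD t) dI; rewrite -derive1E => ->.
  rewrite /N /GRing.scale/= !exprS; set X := t^-1 ^+ j.
  by field.
apply: (wclosed_dbar wc t1 t2) => p.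
have := has_dbarM (has_dbar_conjX j p) (has_dbar_radial (smooth1_is_derive (sqz p) sN)).
congr has_dbar; rewrite -NE ?sqz_ge0//.
rewrite realcD !realcM -toC_sqz realc_nat [(toC p)^* ^+ j.+1]exprS; ring.
Qed.

Lemma bcs_radial F (H : R -> R) : ccont F -> annular H -> bcs (fun p => F p * (H (sqz p))%:C).
Proof.
move=> cF [sH [a [b [a0 ab Hab]]]]; apply: (@ccont_bcs _ _ b).
  apply: ccontM => //; apply: ccontC => p; apply: continuous_comp; first exact: cont_sqz.
  exact: smooth1_cont.
by move=> p bp; rewrite Hab ?(ltW bp) ?orbT// mulr0.
Qed.

(* Subtracting from G a multiple of a fixed bump makes its primitive compactly
   supported, so the pairing only depends on the total mass c of G. *)
Lemma mode_neg_const w j : wclosed w -> exists D : R[i], forall (G F : R -> R) (a b c : R),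
  annular G -> 0 < a -> (forall t : R, is_derive t 1 F (G t)) -> smooth1 F ->
  (forall t, t <= a -> F t = 0) -> (forall t, b <= t -> F t = c) ->
  cint (fun p => w p * ((toC p)^* ^+ j * (G (sqz p) * (sqz p)^-1 ^+ j)%:C)) = c%:C * D.
Proof.
move=> wc; have [B [a1 [b1 [c1 [[a10 c10 sB] BD B0 Bc]]]]] := @bump_primitive_gt0 R.
have ab : annular (bump 1 2 : R -> R) by apply: annular_bump => //; rewrite ltr1n.
pose L (G : R -> R) := cint (fun p => w p * ((toC p)^* ^+ j * (G (sqz p) * (sqz p)^-1 ^+ j)%:C)).
have cJ : ccont (fun p : R * R => (toC p)^* ^+ j) by apply: ccontX; apply: ccontJ; exact: ccont_toC.
have iL (G : R -> R) : annular G ->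
    cintegrable (fun p => w p * ((toC p)^* ^+ j * (G (sqz p) * (sqz p)^-1 ^+ j)%:C)).
  move=> aG; apply: L2w_bcs_cintegrable; first by have [] := wc.
  apply: (@bcs_radial _ (fun t => G t * t^-1 ^+ j)) => //.
  by apply: annularMl => // n; exact: Cn_invX.
(* [D] is the pairing per unit mass, read off on the reference bump. *)
exists (L (bump 1 2) / c1%:C) => G F a b c aG a0 FD sF F0 Fc.
pose k := - (c / c1).
have bk : annular (fun t : R => bump 1 2 t * k) by exact: annularZ.
have aG' : annular (fun t => G t + bump 1 2 t * k) by exact: annularD.
have MD (t : R) : is_derive t 1 (fun t => F t + B t * k) (G t + bump 1 2 t * k).
  have d2 := is_deriveM (BD t) (is_derive_cst k t 1).
  apply: (is_derive_eq (is_deriveD (FD t) d2)).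
  by rewrite /GRing.scale/= mulr0 add0r [k * _]mulrC.
have aM : annular (fun t => F t + B t * k).
  split; first by apply: smooth1D => //; apply: smooth1M => //; exact: smooth1_cst.
  (* The entry [a + 1] serves only to make the interval nondegenerate. *)
  exists (Num.min a a1), (Num.max (Num.max b b1) (a + 1)); split.
  - by rewrite lt_min a0.
  - by rewrite gt_min !lt_max ltrDl ltr01 orbT.
  move=> t /orP[|]; first by rewrite le_min => /andP[h1 h2]; rewrite F0// B0// mul0r addr0.
  rewrite !ge_max => /andP[/andP[h1 h2] _]; rewrite Fc// Bc// /k mulrN mulrC divfK ?subrr//.
  by rewrite gt_eqF.
have := mode_neg_exact j wc aM aG' MD.
rewrite (@eq_cint _ _ (fun p => w p * ((toC p)^* ^+ j * (G (sqz p) * (sqz p)^-1 ^+ j)%:C) +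
   k%:C * (w p * ((toC p)^* ^+ j * (bump 1 2 (sqz p) * (sqz p)^-1 ^+ j)%:C)))); last first.
  by move=> p; rewrite !(realcM, realcD); ring.
rewrite cintD; [|exact: iL|by apply: cintegrableZ; exact: iL].
rewrite cintZ; last exact: iL.
rewrite -/(L G) -/(L (bump 1 2)) /k realcN realcM realcV => /eqP.
rewrite mulNr subr_eq0 => /eqP ->.
by rewrite mulrAC mulrA.
Qed.

End Modes.

(** * Dominated convergence, positivity and an integrable majorant *)

Section PlaneIntegrals.
Variable R : realType.
Implicit Types (f g : R * R -> R) (p : R * R).

Lemma lam2_origin : (@lam2 R) [set 0] = 0%E.
Proof.
have -> : [set 0] = [set 0] `*` [set 0] :> set (R * R).
  by apply/seteqP; split => [_ ->|[x y] [/= -> ->]].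
rewrite /lam2 product_measure1E; last 2 first; [exact: measurable_set1|exact: measurable_set1|].
by rewrite /= lebesgue_measure_set1 mul0e.
Qed.

(** Convergence is asked off the origin only, because the cutoffs [chi] all vanish at 0; a single
    point is null. *)
Lemma Rint_dominated (f_ : nat -> R * R -> R) f g :
  (forall n, measurable_fun setT (f_ n)) -> measurable_fun setT f ->
  (forall p, p != 0 -> f_ n p @[n --> \oo] --> f p) -> rint g ->
  (forall n p, `|f_ n p| <= g p) ->
  \int[@lam2 R]_p f_ n p @[n --> \oo] --> \int[@lam2 R]_p f p.
Proof.
move=> mf_ mf cf ig fg.
have [fi _ cvg] := @dominated_convergence _ _ R (@lam2 R) setT measurableT
  (fun n p => (f_ n p)%:E) (fun p => (f p)%:E) (fun p => (g p)%:E)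
  (fun n => (measurable_EFinP _ _).2 (mf_ n)) ((measurable_EFinP _ _).2 mf)
  ltac:(exists [set 0]; split;
    [by rewrite (_ : [set 0] = [set 0] `*` [set 0] :> set (R * R));
       [apply: measurableX; exact: measurable_set1|
        apply/seteqP; split => [_ ->|[x y] [/= -> ->]]]
    |exact: lam2_origin
    |move=> p /=; apply: contra_notP => /eqP p0 _;
      by apply: cvg_EFin; [exact: nearW|exact: cf]])
  ig ltac:(by apply: aeW => p n _; rewrite /= lee_fin).
have fin := integrable_fin_num measurableT fi.
apply: fine_cvg; rewrite fineK//.
Qed.

Lemma Rint_gt0 f (a b c d : R) : rint f -> (forall p, 0 <= f p) -> a < b -> c < d ->
  (forall p, a < p.1 <= b -> c < p.2 <= d -> 0 < f p) -> 0 < \int[@lam2 R]_p f p.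
Proof.
move=> fi f0 ab cd fpos; rewrite lt_neqAle Rintegral_ge0 ?andbT// eq_sym; apply/eqP => I0.
have mf := rint_measurable fi.
have : (\int[@lam2 R]_p `|(f p)%:E| = 0)%E.
  under eq_integral => p _ do rewrite gee0_abs ?lee_fin//.
  by rewrite -[LHS]fineK ?(integrable_fin_num measurableT fi)// -/(Rintegral _ _ _) I0.
move/(ae_eq_integral_abs (@lam2 R) measurableT ((measurable_EFinP _ _).2 mf)).
move=> [A [mA A0 Asub]].
pose B : set (R * R) := `]a, b] `*` `]c, d].
have mB : measurable B by apply: measurableX; exact: measurable_itv.
have BA : B `<=` A.
  move=> p [p1 p2]; apply: Asub => /= h; have : (f p)%:E = 0%E := h Logic.I.
  move=> [fp].
  move: p1 p2; rewrite /= !in_itv/= => p1 p2; have := fpos p p1 p2.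
  by rewrite fp ltxx.
have := @le_measure _ _ _ (@lam2 R) B A; rewrite !inE => /(_ mB mA BA).
rewrite [X in (_ <= X)%E]A0 [X in (X <= _)%E](lam2_box (ltW ab) (ltW cd)) lee_fin leNgt.
by rewrite mulr_gt0 ?subr_gt0.
Qed.

(** A product of one-variable Cauchy kernels is an integrable majorant that Tonelli evaluates
    without polar coordinates. *)
Lemma rint_cauchy2 : rint (fun p : R * R => (oneDsqr p.1)^-1 * (oneDsqr p.2)^-1).
Proof.
have pos (x : R) : 0 <= (oneDsqr x)^-1 by rewrite invr_ge0 (le_trans _ (oneDsqr_ge1 x)).
have I : (\int[@lebesgue_measure R]_x ((oneDsqr x)^-1)%:E = pi%:E)%E.
  rewrite (ge0_symfun_integralT pos continuous_oneDsqrV); last first.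
    by move=> x; rewrite /= /oneDsqr sqrrN.
  rewrite (_ : [set x | 0 <= x] = `[0, +oo[%classic :> set R); last first.
    by apply/seteqP; split => x /=; rewrite in_itv/= andbT.
  by rewrite integral0y_oneDsqr -EFinM; congr EFin; field.
have mV : measurable_fun setT (fun x : R => (oneDsqr x)^-1).
  by apply: continuous_measurable_fun; exact: continuous_oneDsqrV.
have mF : measurable_fun setT (fun p : R * R => (oneDsqr p.1)^-1 * (oneDsqr p.2)^-1).
  by apply: measurable_funM; apply: (measurableT_comp mV); [exact: measurable_fst|exact: measurable_snd].
apply/(integrable12ltyP (@lebesgue_measure R) (@lebesgue_measure R) ((measurable_EFinP _ _).2 mF)).
under eq_integral => x _.
  under eq_integral => y _ do rewrite /= ger0_norm ?mulr_ge0// EFinM.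
  rewrite ge0_integralZl//; last exact/measurable_EFinP.
  rewrite I muleC; over.
rewrite ge0_integralZl ?lee_fin ?pi_ge0//; last exact/measurable_EFinP.
by rewrite I -EFinM ltry.
Qed.

End PlaneIntegrals.

(** * Moments of the weight and inner products of weakly closed functions *)

Section WeightMoments.
Variables (R : realType) (m : R).
Hypothesis hm : 2 <= m.
Implicit Types (p : R * R) (u w : R * R -> R[i]).

Local Notation Re := complex.Re.
Local Notation Im := complex.Im.
Local Notation W := (weight m).
Local Notation ip := (inner m).

Let m0 : 0 <= m. Proof. exact: le_trans hm. Qed.

Definition radw (t : R) : R := expR (- (t `^ (m / 2))).

Lemma radwE p : W p = radw (sqz p).
Proof.
rewrite /weight /radw; congr (expR (- _)).
rewrite /Defs.absz /cmod -/(sqz p) mulrC powRrM.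
by rewrite -powR12_sqrt ?sqz_ge0.
Qed.

Lemma Cn_radw n : Cn (@pos R) n radw.
Proof.
have op := @open_pos R.
apply: (@Cn_comp _ _ setT) => //; first exact: openT.
- by apply: Cn_expR; exact: openT.
- rewrite (_ : (fun _ => _) = fun t => (-1) * (t `^ (m / 2))); last first.
    by apply/funext => t; rewrite mulN1r.
  by apply: CnM => //; [exact: Cn_cst|exact: Cn_powR].
Qed.

(** For t >= 1 the hypothesis 2 <= m gives t <= t^(m/2); the constant 1 absorbs the range t <= 1. *)
Lemma radw_le t : 0 <= t -> radw t <= expR (1 - t).
Proof.
move=> t0; rewrite ler_expR lerNl opprB lerBlDr.
have [t1|t1] := leP t 1; first by rewrite (le_trans t1)// lerDr powR_ge0.
apply: (@le_trans _ _ (t `^ (m / 2))); last by rewrite lerDl.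
rewrite -[leLHS]powRr1//; apply: ler_powR; first exact: ltW.
by rewrite ler_pdivlMr// mul1r.
Qed.

Lemma sqz_measurable : measurable_fun setT (@sqz R).
Proof. by apply: cont2_measurable; exact: cont_sqz. Qed.

Lemma rint_moment k : rint (fun p => sqz p ^+ k * W p).
Proof.
(* With t = x^2 + y^2: (1 + x^2)(1 + y^2) <= (1 + t)^2, then (1 + t)^(k+2) <= (k+2)! exp(1 + t), and
   the weight is at most exp(1 - t). The exponentials multiply to exp 2. *)
pose C : R := (k.+2)`!%:R * expR 2.
apply: rint_dom (rintZ C (rint_cauchy2 R)).
  apply: measurable_funM; last exact: weight_measurable.
  by apply: measurable_funX; exact: sqz_measurable.
move=> p; have t0 := sqz_ge0 p; rewrite ger0_norm; last first.
  by rewrite mulr_ge0 ?exprn_ge0// ltW// weight_gt0.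
have x1 := oneDsqr_ge1 p.1; have y1 := oneDsqr_ge1 p.2.
have x0 : 0 < oneDsqr p.1 by exact: lt_le_trans x1.
have y0 : 0 < oneDsqr p.2 by exact: lt_le_trans y1.
rewrite -invfM ler_pdivlMr ?mulr_gt0//.
have h1 : oneDsqr p.1 * oneDsqr p.2 <= (1 + sqz p) ^+ 2.
  rewrite expr2 ler_pM ?(ltW x0) ?(ltW y0)// /oneDsqr sqzE lerD2l ?lerDl ?lerDr sqr_ge0//.
have h2 : sqz p ^+ k <= (1 + sqz p) ^+ k.
  have le1 : sqz p <= 1 + sqz p by rewrite lerDr.
  by apply: lerXn2r => //; rewrite nnegrE addr_ge0.
have h3 : (1 + sqz p) ^+ k.+2 <= (k.+2)`!%:R * expR (1 + sqz p).
  have f0 : 0 < (k.+2)`!%:R :> R by rewrite ltr0n fact_gt0.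
  rewrite mulrC -ler_pdivrMr//; apply: le_trans (expR_ge1Dxn k.+1 _); last by rewrite addr_ge0.
  by rewrite lerDr.
rewrite mulrAC; apply: (@le_trans _ _ ((1 + sqz p) ^+ k.+2 * W p)).
  rewrite ler_pM2r ?weight_gt0// -addn2 exprD ler_pM// ?exprn_ge0// ?mulr_ge0 ?(ltW x0) ?(ltW y0)//.
apply: (@le_trans _ _ ((k.+2)`!%:R * expR (1 + sqz p) * expR (1 - sqz p))).
  apply: ler_pM => //; first by rewrite exprn_ge0// addr_ge0.
    by rewrite ltW// weight_gt0.
  by rewrite radwE radw_le.
by rewrite -mulrA -expRD /C addrACA subrr addr0.
Qed.

Lemma ck2E k : ck2 m k = \int[@lam2 R]_p (sqz p ^+ k * W p).
Proof.
apply: eq_Rintegral => p _; congr (_ * _).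
by rewrite exprM /Defs.absz /cmod sqr_sqrtr ?sqmod_ge0.
Qed.

Lemma ck2_gt0 k : 0 < ck2 m k.
Proof.
rewrite ck2E; apply: (@Rint_gt0 _ _ 0 1 0 1) => //; first exact: rint_moment.
  by move=> p; rewrite mulr_ge0 ?exprn_ge0 ?sqz_ge0// ltW// weight_gt0.
move=> p /andP[x0 _] _; rewrite mulr_gt0 ?weight_gt0// exprn_gt0// sqzE.
by rewrite ltr_pwDl ?sqr_ge0// exprn_gt0.
Qed.

Definition mono (a b : nat) p : R[i] := toC p ^+ a * (toC p)^* ^+ b.

Lemma sqmodX (x : R[i]) n : sqmod (x ^+ n) = sqmod x ^+ n.
Proof.
elim: n => [|n IH]; last by rewrite !exprS sqmodM IH.
by rewrite !expr0 /sqmod /= expr1n expr0n/= addr0.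
Qed.

Lemma ccont_mono a b : ccont (mono a b).
Proof.
by apply: ccontM; apply: ccontX; [exact: ccont_toC|apply: ccontJ; exact: ccont_toC].
Qed.

Lemma L2w_mono a b : L2w m (mono a b).
Proof.
apply/L2wP; split; first by apply: ccont_measurable; exact: ccont_mono.
have := rint_moment (a + b); apply: eq_integrable => // p _ /=.
by rewrite sqmodM !sqmodX sqmodJ -exprD.
Qed.

Lemma A2w_toCX n : A2w m (fun p => toC p ^+ n).
Proof.
split; first exact: entire_toCX.
have := L2w_mono n 0; congr L2w; apply/funext => p.
by rewrite /mono expr0 mulr1.
Qed.

Lemma mono_sqz a b k p : mono (a + k) (b + k) p = mono a b p * (sqz p ^+ k)%:C.
Proof. by rewrite realcX -toC_sqz exprMn /mono !exprD; ring. Qed.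

(* As flat 0 tends to 1 at infinity, chi n tends to 1 pointwise on ]0, +oo[. *)
Definition chi (n : nat) (t : R) : R :=
  flat 0 (n.+2%:R * t - 1) * flat 0 (n.+2%:R * (n.+2%:R - t)).

Lemma chi_ge0 n t : 0 <= chi n t.
Proof. by rewrite mulr_ge0// flat0_ge0. Qed.

Lemma chi_le1 n t : chi n t <= 1.
Proof. by rewrite -[leRHS]mulr1 ler_pM ?flat0_ge0 ?flat0_le1. Qed.

Lemma annular_chi n : annular (chi n).
Proof.
have n0 : 0 < n.+2%:R :> R by rewrite ltr0n.
have c1 := @smooth1_cst R; have id1 := @smooth1_id R.
split.
  apply: smooth1M; apply: (@smooth1_comp _ (flat 0)) => //; try exact: smooth1_flat.
    by apply: smooth1D => //; exact: smooth1M.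
  apply: smooth1M => //; apply: smooth1D => //.
  rewrite (_ : -%R = fun t => (-1) * t); first exact: smooth1M.
  by apply/funext => t; rewrite mulN1r.
exists n.+2%:R^-1, n.+2%:R; split.
- by rewrite invr_gt0.
- by rewrite (@lt_trans _ _ 1) ?invf_lt1 ?ltr1n.
move=> t; rewrite /chi /flat !subr_gt0 pmulr_rgt0// subr_gt0 => /orP[h|h].
  rewrite ifF ?mul0r//; apply: le_gtF.
  by rewrite -ler_pdivlMl// mulr1.
by rewrite [X in _ * X]ifF ?mulr0//; exact: le_gtF.
Qed.

Lemma chi_cvg t : 0 < t -> chi n t @[n --> \oo] --> (1 : R).
Proof.
move=> t0.
(* This bound reduces the claim to both arguments of [flat 0] exceeding 2 / e, each factor then
   being within e / 2 of 1. *)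
have fl (s : R) : 0 < s -> 1 - s^-1 <= flat 0 s.
  by move=> s0; rewrite /flat s0 expr0 mul1r expR_ge1Dx.
apply/cvgrPdist_le => e e0.
near=> n.
pose r := 2 / e; have r0 : 0 < r by rewrite divr_gt0.
have large (s : R) : r <= s -> 0 < s /\ s^-1 <= e / 2.
  move=> rs; have s0 := lt_le_trans r0 rs; split => //.
  by rewrite -(invrK (e / 2)) lef_pV2 ?posrE ?invr_gt0 ?divr_gt0// invf_div.
have [s10 s1] : 0 < n.+2%:R * t - 1 /\ (n.+2%:R * t - 1)^-1 <= e / 2.
  apply: large; rewrite lerBrDr -ler_pdivrMr//.
  near: n; apply: filterS (nbhs_infty_ger ((r + 1) / t)) => n h.
  by rewrite (le_trans h)// ler_nat -addn2 leq_addr.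
have [s20 s2] : 0 < n.+2%:R * (n.+2%:R - t) /\ (n.+2%:R * (n.+2%:R - t))^-1 <= e / 2.
  apply: large; apply: (@le_trans _ _ (n.+2%:R - t)).
    rewrite lerBrDr; near: n; apply: filterS (nbhs_infty_ger (r + t)) => n h.
    by rewrite (le_trans h)// ler_nat -addn2 leq_addr.
  rewrite ler_peMl ?ler1n// subr_ge0.
  near: n; apply: filterS (nbhs_infty_ger t) => n h.
  by rewrite (le_trans h)// ler_nat -addn2 leq_addr.
have h1 := fl _ s10; have h2 := fl _ s20; have l1 := flat0_le1 (n.+2%:R * t - 1).
have g1 := flat0_ge0 (n.+2%:R * t - 1).
rewrite ger0_norm ?subr_ge0 ?chi_le1// /chi.
move: h1 h2 l1 g1 s1 s2; set x := flat _ _; set y := flat _ _; set i1 := _^-1; set i2 := _^-1.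
have : y <= 1 by exact: flat0_le1.
have : 0 <= y by exact: flat0_ge0.
clear; move=> *; nra.
Unshelve. all: by end_near. Qed.

(** Behind the cutoff the weight itself may enter the profile, so the mode identities become
    statements about [inner] once [chi] is removed. *)
Lemma annular_weight n i : annular (fun t => chi n t * (t ^+ i * radw t)).
Proof.
apply: annularMl; first exact: annular_chi.
move=> k; have op := @open_pos R; apply: CnM => //; last exact: Cn_radw.
elim: i => [|i IH]; first by under eq_fun do rewrite expr0; exact: Cn_cst.
by under eq_fun do rewrite exprS; apply: CnM => //; exact: Cn_id.
Qed.

(** Dominated convergence with majorants |Re F| and |Im F|; this is the passage from annular
    profiles to inner products. *)
Lemma cint_chi_eq0 (F : R * R -> R[i]) : cintegrable F ->
  (forall n, cint (fun p => F p * (chi n (sqz p))%:C) = 0) -> cint F = 0.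
Proof.
move=> [F1 F2] Fn.
have L (f : R * R -> R) : rint f ->
    (forall n, \int[@lam2 R]_p (f p * chi n (sqz p)) = 0) -> \int[@lam2 R]_p f p = 0.
  move=> rf fn; have mf := rint_measurable rf.
  have : \int[@lam2 R]_p (f p * chi n (sqz p)) @[n --> \oo] --> \int[@lam2 R]_p f p.
    apply: (@Rint_dominated _ _ _ (fun p => `|f p|)) => //.
    - move=> n; apply: measurable_funM => //; apply: cont2_measurable => p.
      apply: continuous_comp; first exact: cont_sqz.
      by apply: smooth1_cont; have [] := annular_chi n.
    - move=> p p0; rewrite -[X in _ --> X]mulr1; apply: cvgM; first exact: cvg_cst.
      apply: chi_cvg; rewrite lt_neqAle sqz_ge0 andbT eq_sym; apply: contra p0.
      by move=> /eqP /sqmod_eq0 [e1 e2]; rewrite [p]surjective_pairing e1 e2.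
    - by have := integrable_norm rf; apply: eq_integrable.
    - by move=> n p; rewrite normrM ler_piMr// ger0_norm ?chi_ge0 ?chi_le1.
  by under eq_fun do rewrite fn; move=> /(cvg_lim (@norm_hausdorff _ _)) <-; rewrite lim_cst.
have E n : (\int[@lam2 R]_p (Re (F p) * chi n (sqz p)) = 0) /\
           (\int[@lam2 R]_p (Im (F p) * chi n (sqz p)) = 0).
  have /= := Fn n; rewrite /cint => -[h1 h2]; split; [rewrite -[RHS]h1|rewrite -[RHS]h2];
  by apply: eq_Rintegral => p _; rewrite !ReImE mulr0 ?subr0 ?add0r.
by rewrite /cint; apply: complex_ext => /=; apply: L => // n; have [] := E n.
Qed.

(** The conjugation in [inner] turns zbar^(n+1) into z^(n+1): weak closedness alone excludes
    antiholomorphic modes, before any orthogonality is assumed. *)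
Lemma ip_mode_pos w n i : wclosed m w ->
  ip w (fun p => (toC p)^* ^+ n.+1 * (sqz p ^+ i)%:C) = 0.
Proof.
move=> wc; have Lw := wc.1.
have Lg : L2w m (fun p => (toC p)^* ^+ n.+1 * (sqz p ^+ i)%:C).
  have := L2w_mono i (n.+1 + i); congr L2w; apply/funext => p.
  by rewrite -[i in LHS]add0n mono_sqz /mono expr0 mul1r.
apply: cint_chi_eq0; first exact: ip_cintegrable.
move=> k; have := mode_pos m0 n wc (annular_weight k i).
rewrite /= => h; rewrite -[RHS]h; apply: eq_cint => p.
by rewrite conjM conjX conjK conjC radwE !realcM; ring.
Qed.

Lemma wclosed1 : wclosed m (fun=> 1).
Proof.
have := A2w_toCX 0; under eq_fun do rewrite expr0.
exact: A2w_wclosed.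
Qed.

Lemma ck2C k : cint (fun p => (sqz p ^+ k * W p)%:C) = (ck2 m k)%:C.
Proof. by rewrite cintC ck2E. Qed.

(** Heuristically [C] is the j-th Taylor coefficient of w. Dividing the identity of [mode_neg_const]
    for w by the one for the constant function 1 trades the one-dimensional mass for a plane
    integral. In polar coordinates the constant E would be pi; all that matters is that it is
    nonzero. *)
Lemma mode_neg w j : wclosed m w -> exists C : R[i], forall H : R -> R, annular H ->
  cint (fun p => w p * ((toC p)^* ^+ j * (H (sqz p))%:C)) =
  C * cint (fun p => (sqz p ^+ j * H (sqz p))%:C).
Proof.
move=> wc; have [D DP] := mode_neg_const m0 j wc.
have [E EP] := mode_neg_const m0 0 wclosed1.
have EP' (G F : R -> R) (a b c : R) :
  annular G -> 0 < a -> (forall t : R, is_derive t 1 F (G t)) -> smooth1 F ->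
  (forall t, t <= a -> F t = 0) -> (forall t, b <= t -> F t = c) ->
  cint (fun p => (G (sqz p))%:C) = c%:C * E.
  move=> aG a0 FD sF F0 Fc; rewrite -(EP G F a b c) //; apply: eq_cint => p.
  by rewrite !expr0 mulr1 !mul1r.
have En0 : E != 0.
  apply/eqP => E0.
  have ab : annular (bump 1 2 : R -> R) by apply: annular_bump => //; rewrite ltr1n.
  have [B [a1 [b1 [c1 [[a10 c10 sB] BD B0 Bc]]]]] := @bump_primitive_gt0 R.
  have := EP' _ _ _ _ _ ab a10 BD sB B0 Bc; rewrite E0 mulr0 cintC => -[I0].
  have : 0 < \int[@lam2 R]_p bump 1 2 (sqz p); last by rewrite I0 ltxx.
  have c2 : continuous (fun p : R * R => bump 1 2 (sqz p)).
    move=> p; apply: continuous_comp; first exact: cont_sqz.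
    by apply: smooth1_cont; exact: smooth1_bump.
  (* On this box 1 < x^2 + y^2 < 2, where the bump is positive. *)
  apply: (@Rint_gt0 _ _ 1 (11 / 10) 0 (1 / 2)).
  - apply: (@rint_box _ _ 1 2); first exact: cont2_measurable.
    + by move=> p; rewrite ger0_norm ?bump_ge0 ?bump_le1.
    + by move=> p h; rewrite bump_eq0// (ltW h) orbT.
  - by move=> p; exact: bump_ge0.
  - by lra.
  - by lra.
  - move=> p /andP[? ?] /andP[? ?]; apply: bump_gt0; rewrite sqzE.
    by apply/andP; split; nra.
exists (D / E) => H aH.
pose G (t : R) := H t * t ^+ j.
have aG : annular G.
  apply: annularMl => // n; have op := @open_pos R.
  elim: (j) => [|i IH]; first by under eq_fun do rewrite expr0; exact: Cn_cst.
  by under eq_fun do rewrite exprS; apply: CnM => //; exact: Cn_id.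
have [F [a [b [c [a0 FD sF F0 Fc]]]]] := annular_primitive aG.
have h1 := DP G F a b c aG a0 FD sF F0 Fc.
have h2 := EP' G F a b c aG a0 FD sF F0 Fc.
have -> : cint (fun p => w p * ((toC p)^* ^+ j * (H (sqz p))%:C)) = c%:C * D.
  rewrite -h1; apply: eq_cint => p; congr (_ * (_ * _%:C)); rewrite /G.
  have [t0|t0] := eqVneq (sqz p) 0.
    have [_ [a' [b' [a'0 _ Hab]]]] := aH.
    by rewrite t0 Hab ?(ltW a'0)// !mul0r.
  by rewrite -mulrA -exprMn mulfV// expr1n mulr1.
have -> : cint (fun p => (sqz p ^+ j * H (sqz p))%:C) = c%:C * E.
  by rewrite -h2; apply: eq_cint => p; rewrite /G mulrC.
by field.
Qed.

(** Both clauses share [C]: orthogonality to z^j makes it 0 through the first one, and the second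
    then annihilates every annular profile in that mode. *)
Lemma ip_mode_neg w j : wclosed m w -> exists C : R[i],
  (forall i, ip w (fun p => toC p ^+ j * (sqz p ^+ i)%:C) = C * (ck2 m (i + j))%:C) /\
  (forall H : R -> R, annular H ->
    cint (fun p => w p * ((toC p)^* ^+ j * (H (sqz p))%:C)) =
    C * cint (fun p => (sqz p ^+ j * H (sqz p))%:C)).
Proof.
move=> wc; have [C CP] := mode_neg j wc; exists C; split => // i.
have Lw := wc.1.
have Lg : L2w m (fun p => toC p ^+ j * (sqz p ^+ i)%:C).
  have := L2w_mono (j + i) i; congr L2w; apply/funext => p.
  by rewrite -[i in X in mono _ X]add0n mono_sqz /mono expr0 mulr1.
have i1 := ip_cintegrable Lw Lg.
have i2 : cintegrable (fun p => (sqz p ^+ (i + j) * W p)%:C).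
  by split; [exact: rint_moment|exact: rint0].
apply/eqP; rewrite -subr_eq0 -ck2C /inner -mulNr -cintZ// -cintD//; last exact: cintegrableZ.
apply/eqP; apply: cint_chi_eq0; first by apply: cintegrableD => //; exact: cintegrableZ.
move=> n; have := CP _ (annular_weight n i) => h.
have aw := annular_weight n i.
have k1 : cintegrable (fun p => w p * ((toC p)^* ^+ j * (chi n (sqz p) * (sqz p ^+ i * radw (sqz p)))%:C)).
  apply: (L2w_bcs_cintegrable m0) => //.
  apply: (@bcs_radial _ _ (fun t => chi n t * (t ^+ i * radw t))) => //.
  by apply: ccontX; apply: ccontJ; exact: ccont_toC.
have k2 : cintegrable (fun p => (sqz p ^+ j * (chi n (sqz p) * (sqz p ^+ i * radw (sqz p))))%:C).
  have := bcs_cintegrable (@bcs_radial _ (fun p => (sqz p ^+ j)%:C) _ _ aw).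
  under [X in _ -> cintegrable X]eq_fun do rewrite realcM.
  apply; apply: ccontC => p; have := ccontX j (ccontC (@cont_sqz R)) => -[c1 _].
  by have := c1 p; under eq_fun do rewrite -realcX.
rewrite (@eq_cint _ _ (fun p => w p * ((toC p)^* ^+ j * (chi n (sqz p) * (sqz p ^+ i * radw (sqz p)))%:C)
  + (- C) * (sqz p ^+ j * (chi n (sqz p) * (sqz p ^+ i * radw (sqz p))))%:C)); last first.
  by move=> p; rewrite conjM conjX conjC radwE exprD !realcM; ring.
by rewrite cintD ?cintZ ?h ?mulNr ?subrr//; exact: cintegrableZ.
Qed.

End WeightMoments.

(** * Uniqueness *)

Section NullIntegrals.
Variable R : realType.
Implicit Types (f g : R * R -> R) (p : R * R).

(** The pi-lambda theorem pulled back along [phi]. With [phi] a projection and [B] a condition on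
    the other coordinate it passes from rays to measurable sets; with [phi] the identity it passes
    from rectangles to all measurable sets. *)
Lemma null_dynkin d (T : measurableType d) (G : set (set T)) (phi : R * R -> T) f
    (B : set (R * R)) : d.-measurable = <<s G >> -> setI_closed G -> measurable_fun setT phi ->
  measurable B -> rint f -> (\int[@lam2 R]_(p in B) (f p)%:E = 0)%E ->
  (forall A, G A -> (\int[@lam2 R]_(p in B `&` phi @^-1` A) (f p)%:E = 0)%E) ->
  forall A, d.-measurable A -> (\int[@lam2 R]_(p in B `&` phi @^-1` A) (f p)%:E = 0)%E.
Proof.
move=> GE GI mphi mB fi B0 G0 A mA.
have mpre S : d.-measurable S -> measurable (B `&` phi @^-1` S).
  by move=> mS; apply: measurableI => //; rewrite -[X in measurable X]setTI; exact: mphi.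
have iB S : measurable S -> (@lam2 R).-integrable S (fun p => (f p)%:E).
  by move=> mS; apply: integrableS fi.
apply: (dynkin_induction (G := G)
  (P := fun A => (\int[@lam2 R]_(p in B `&` phi @^-1` A) (f p)%:E = 0)%E) GE GI).
- by rewrite preimage_setT setIT.
- by [].
- move=> S mS S0.
  have e : B = (B `&` phi @^-1` S) `|` (B `&` phi @^-1` (~` S)).
    by rewrite -setIUr -preimage_setU setUv preimage_setT setIT.
  have := B0; rewrite {1}e integral_setU_EFin//=.
  + by rewrite S0 add0e.
  + exact: mpre.
  + by apply: mpre; exact: measurableC.
  + by apply: measurable_funTS; exact: rint_measurable.
  + by apply/disj_setPLR => x [_ /= xS] [_]; exact.
- move=> F mF tF F0; rewrite preimage_bigcup setI_bigcupr integral_bigcup//.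
  + by apply: eseries0 => i _ _; exact: F0.
  + move=> i j _ _ [x [[_ xi] [_ xj]]]; apply: (tF i j Logic.I Logic.I).
    by exists (phi x); split.
  + by move=> k; exact: mpre.
  + by apply: iB; apply: bigcupT_measurable => k; exact: mpre.
- by rewrite -GE.
Qed.

Lemma rays_setI_closed : setI_closed (@RGenInftyO.G R).
Proof.
move=> _ _ [x ->] [y ->]; exists (Num.min x y).
apply/seteqP; split => z; rewrite /= !in_itv/= lt_min; first by move=> [-> ->].
by move=> /andP[].
Qed.

(** The generating rays do not include the whole line, so half-planes and the plane are listed
    separately; for compactly supported functions they amount to quadrants with a remote corner
    coordinate. *)
Lemma null_quadrants f : rint f -> \int[@lam2 R]_p f p = 0 ->
  (forall a b : R, (\int[@lam2 R]_(p in [set p : R * R | (p.1 < a)%R /\ (p.2 < b)%R]) (f p)%:E = 0)%E) ->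
  (forall a : R, (\int[@lam2 R]_(p in [set p : R * R | (p.1 < a)%R]) (f p)%:E = 0)%E) ->
  (forall b : R, (\int[@lam2 R]_(p in [set p : R * R | (p.2 < b)%R]) (f p)%:E = 0)%E) ->
  ae_eq (@lam2 R) setT (EFin \o f) (cst 0%E).
Proof.
move=> fi I0 Q Q1 Q2.
have RE : @measurable _ (measurableTypeR R) = <<s @RGenInftyO.G R >> by exact: RGenInftyO.measurableE.
have T0 : (\int[@lam2 R]_p (f p)%:E = 0)%E.
  by rewrite -[LHS]fineK ?(integrable_fin_num measurableT fi)// -/(Rintegral _ _ _) I0.
have m1 : measurable_fun setT (fst : R * R -> R) by exact: measurable_fst.
have m2 : measurable_fun setT (snd : R * R -> R) by exact: measurable_snd.
have h1 (A : set R) : measurable A -> forall b : R,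
    (\int[@lam2 R]_(p in [set p : R * R | (p.2 < b)%R] `&` fst @^-1` A) (f p)%:E = 0)%E.
  move=> mA b.
  have mB : measurable [set p : R * R | (p.2 < b)%R].
    have := m2 measurableT `]-oo, b[%classic (measurable_itv _).
    by congr measurable; apply/seteqP; split => x; rewrite /= in_itv/=; [case|split].
  apply: (null_dynkin RE rays_setI_closed m1 mB fi (Q2 b)) => // _ [a ->].
  rewrite -[RHS](Q a b); congr (integral _ _ _).
  by apply/seteqP; split => x /=; rewrite in_itv/= => -[].
have h1' (A : set R) : measurable A -> (\int[@lam2 R]_(p in fst @^-1` A) (f p)%:E = 0)%E.
  move=> mA; rewrite -[_ @^-1` _]setTI.
  apply: (null_dynkin RE rays_setI_closed m1 measurableT fi T0) => // _ [a ->].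
  rewrite -[RHS](Q1 a); congr (integral _ _ _).
  by apply/seteqP; split => x /=; rewrite in_itv/=; [case|split].
have h2 (A B : set R) : measurable A -> measurable B ->
    (\int[@lam2 R]_(p in A `*` B) (f p)%:E = 0)%E.
  move=> mA mB; rewrite (_ : A `*` B = fst @^-1` A `&` snd @^-1` B)//.
  apply: (null_dynkin RE rays_setI_closed m2 _ fi (h1' _ mA)) => //.
    by rewrite -[X in measurable X]setTI; exact: m1.
  move=> _ [b ->]; rewrite -[RHS](h1 _ mA b) setIC; congr (integral _ _ _);
    by apply/seteqP; split => x /=; rewrite in_itv/=.
apply: (integral_ae_eq measurableT fi) => // E _ mE.
rewrite [RHS]integral0 -[E]setTI.
have mI : measurable_fun setT (id : R * R -> R * R) by exact: measurable_id.
apply: (null_dynkin (measurable_prod_measurableType _ _) _ mI measurableT fi T0) => //.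
- move=> _ _ [A mA [B mB <-]] [C mC [D mD <-]].
  exists (A `&` C); first exact: measurableI.
  by exists (B `&` D); [exact: measurableI|rewrite setXI].
- by move=> _ [A mA [B mB <-]]; rewrite setTI preimage_id; exact: h2.
Qed.

End NullIntegrals.

(** * Polynomials approximating a step on the unit interval *)

Section HalfLine.
Variable R : realType.

Lemma bernoulli_le (a : R) k : -1 <= a -> 1 + k%:R * a <= (1 + a) ^+ k.
Proof.
move=> a1; have a0 : 0 <= 1 + a by lra.
elim: k => [|k IH]; first by rewrite mul0r addr0 expr0.
rewrite exprS; apply: le_trans (ler_wpM2l a0 IH).
rewrite -subr_ge0 -natr1 (_ : _ - _ = k%:R * a ^+ 2); last by ring.
by rewrite mulr_ge0 ?sqr_ge0.
Qed.

(** It yields N q^N <= 1 / (1 - q) for q < 1, hence a geometric rate for N q^(2N). *)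
Lemma natX_le (q : R) N : 0 <= q <= 1 -> N%:R * q ^+ N * (1 - q) + q ^+ N <= 1.
Proof.
move=> /andP[q0 q1]; elim: N => [|N IH]; first by rewrite !mul0r expr0 add0r.
have qN : q ^+ N.+1 <= 1 by rewrite exprn_ile1.
have qN0 : 0 <= q ^+ N.+1 by rewrite exprn_ge0.
rewrite -natr1; apply: (@le_trans _ _ (q * 1 + 1 * (1 - q))); last by rewrite mulr1 mul1r addrC subrK.
apply: (@le_trans _ _ (q * (N%:R * q ^+ N * (1 - q) + q ^+ N) + q ^+ N.+1 * (1 - q))).
  by rewrite exprS le_eqVlt; apply/orP; left; apply/eqP; ring.
by apply: lerD; [exact: ler_wpM2l|apply: ler_wpM2r => //; rewrite subr_ge0].
Qed.

(* By Bernoulli's inequality these polynomials tend to the indicator of s < 1/2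
   on [0, 1]. *)
Definition step (N : nat) (s : R) : R := (1 - s ^+ N) ^+ (N * 2 ^ N).

Lemma step_itv N s : 0 <= s <= 1 -> 0 <= step N s <= 1.
Proof.
move=> /andP[s0 s1]; have h0 : 0 <= s ^+ N by exact: exprn_ge0.
have h1 : s ^+ N <= 1 by exact: exprn_ile1.
by rewrite exprn_ge0 ?exprn_ile1//= ?subr_ge0// gerBl.
Qed.

Lemma step_cvg s : 0 <= s <= 1 -> step N s @[N --> \oo] --> ((s < 2^-1)%R%:R : R).
Proof.
move=> /andP[s0 s1].
have kE N : (N * 2 ^ N)%:R * s ^+ N = N%:R * (2 * s) ^+ N :> R.
  by rewrite natrM natrX exprMn mulrA.
have h0 N : 0 <= s ^+ N by exact: exprn_ge0.
have h1 N : s ^+ N <= 1 by exact: exprn_ile1.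
have [s2|s2] := ltP s 2^-1; rewrite /=.
  (* Bernoulli leaves the error N (2 s)^N = (N q^N) q^N: one factor q^N absorbs N, the other tends
     to 0. *)
  pose q := Num.sqrt (2 * s).
  have q0 : 0 <= q by exact: sqrtr_ge0.
  have qq : q ^+ 2 = 2 * s by rewrite sqr_sqrtr ?mulr_ge0.
  have q1 : q < 1 by rewrite -sqrtr1 ltr_sqrt//; lra.
  have lb N : 1 - (1 - q)^-1 * q ^+ N <= step N s.
    apply: (@le_trans _ _ (1 + (N * 2 ^ N)%:R * - s ^+ N)); last first.
      by apply: bernoulli_le; rewrite lerN2.
    rewrite mulrN lerD2l lerN2 kE -qq -exprM mulnC exprM expr2 mulrA.
    apply: ler_wpM2r; first exact: exprn_ge0.
    rewrite -[leRHS]mul1r ler_pdivlMr ?subr_gt0//.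
    apply: le_trans (@natX_le q N _); last by rewrite q0 ltW.
    by rewrite lerDl exprn_ge0.
  apply: (@squeeze_cvgr _ _ _ _ (fun N => 1 - (1 - q)^-1 * q ^+ N) (fun=> 1)).
  - by near=> N; rewrite lb /=; have /andP[] := @step_itv N s ltac:(by rewrite s0 s1).
  - rewrite -[X in _ --> X]subr0 -(mulr0 (1 - q)^-1); apply: cvgB; first exact: cvg_cst.
    by apply: cvgM; [exact: cvg_cst|apply: cvg_expr; rewrite ger0_norm].
  - exact: cvg_cst.
(* With x = s^N one has (1 - x)^k (1 + x)^k <= 1, while Bernoulli bounds the second factor below by
   1 + N (2 s)^N >= N + 1. *)
have ub N : step N s <= N.+1%:R^-1.
  set k := (N * 2 ^ N)%N.
  have hk : N.+1%:R <= (1 + s ^+ N) ^+ k :> R.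
    apply: le_trans (@bernoulli_le (s ^+ N) k _); last by rewrite (le_trans _ (h0 N)).
    rewrite kE -natr1 addrC lerD2l -[leLHS]mulr1; apply: ler_wpM2l => //.
    by rewrite exprn_ege1//; lra.
  rewrite -[leRHS]mul1r ler_pdivlMr ?ltr0n//.
  apply: (@le_trans _ _ (step N s * (1 + s ^+ N) ^+ k)).
    by apply: ler_wpM2l => //; have /andP[] := @step_itv N s ltac:(by rewrite s0 s1).
  rewrite /step -exprMn (_ : _ * _ = 1 - (s ^+ N) ^+ 2); last by ring.
  by apply: exprn_ile1; rewrite ?gerBl ?sqr_ge0// subr_ge0 exprn_ile1.
apply: (@squeeze_cvgr _ _ _ _ (fun=> 0) (fun N => N.+1%:R^-1)).
- by near=> N; rewrite ub andbT; have /andP[] := @step_itv N s ltac:(by rewrite s0 s1).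
- exact: cvg_cst.
- exact: cvg_harmonic.
Unshelve. all: by end_near. Qed.

End HalfLine.

Section Uniqueness.
Variables (R : realType) (m : R).
Hypothesis hm : 2 <= m.
Implicit Types (f g : R * R -> R) (p : R * R) (q u w : R * R -> R[i]).

Local Notation Re := complex.Re.
Local Notation Im := complex.Im.
Local Notation W := (weight m).
Local Notation ip := (inner m).

Let m0 : 0 <= m. Proof. exact: le_trans hm. Qed.

Section Localized.
Variable w : R * R -> R[i].
Hypothesis wc : wclosed m w.
Hypothesis w_ortho : forall j, ip w (fun p => toC p ^+ j) = 0.
Variable H : R -> R.
Hypothesis aH : annular H.

(** Quantifying over all exponents makes this condition stable under multiplication of [q] by z and
    zbar, hence by the real coordinates. *)
Let annih q := forall a b,
  cint (fun p => w p * (mono a b p * q p * (H (sqz p))%:C)) = 0.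

Let annih_cintegrable a b q : ccont q ->
  cintegrable (fun p => w p * (mono a b p * q p * (H (sqz p))%:C)).
Proof.
move=> cq; apply: (L2w_bcs_cintegrable m0); first exact: wc.1.
by apply: bcs_radial => //; apply: ccontM => //; exact: ccont_mono.
Qed.

(** Extracting the common power of |z|^2 leaves a pure power: one of zbar is killed by orthogonality
    to the corresponding power of z, one of z by weak closedness. *)
Let annih1 : annih (fun=> 1).
Proof.
have aHX i : annular (fun t => H t * t ^+ i).
  apply: annularMl => // n; have op := @open_pos R.
  elim: i => [|i IH]; first by under eq_fun do rewrite expr0; exact: Cn_cst.
  by under eq_fun do rewrite exprS; apply: CnM => //; exact: Cn_id.
move=> a b; have [ab|ba] := leqP a b.
  have [C [C1 C2]] := ip_mode_neg hm (b - a) wc.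
  have C0 : C = 0.
    have := C1 0%N; under [X in ip w X]eq_fun do rewrite expr0 mulr1.
    rewrite w_ortho => /esym/eqP; rewrite mulf_eq0 => /orP[/eqP//|/eqP[h]].
    by have := ck2_gt0 hm (0 + (b - a)); rewrite h ltxx.
  have := C2 _ (aHX a); rewrite C0 mul0r => h; rewrite -[RHS]h; apply: eq_cint => p.
  have := mono_sqz 0 (b - a) a p; rewrite add0n subnK// => ->.
  by rewrite /mono expr0 realcM; ring.
have := mode_pos m0 (a - b).-1 wc (aHX b); rewrite prednK ?subn_gt0// => h.
rewrite -[RHS]h; apply: eq_cint => p.
have := mono_sqz (a - b) 0 b p; rewrite add0n subnK ?(ltnW ba)// => ->.
by rewrite /mono expr0 realcM; ring.
Qed.

(** These multipliers form an algebra containing the coordinates and the constants, so the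
    polynomials in x and y are covered with no syntax for them. *)
Let mult f := continuous f /\
  forall q, ccont q -> annih q -> annih (fun p => (f p)%:C * q p).

Let mult_fst : mult fst.
Proof.
split=> [p|q cq aq a b]; first exact: cont_fst.
have e p : (p.1)%:C = 2^-1 * (toC p + (toC p)^*) :> R[i].
  apply: (mulfI (_ : 2 != 0 :> R[i])); first by rewrite pnatr_eq0.
  rewrite mulrA mulfV ?mul1r ?pnatr_eq0//.
  by apply: complex_ext; rewrite -[2]/(1 + 1) !ReImE /=; ring.
rewrite (@eq_cint _ _ (fun p => 2^-1 * (w p * (mono a.+1 b p * q p * (H (sqz p))%:C) +
   w p * (mono a b.+1 p * q p * (H (sqz p))%:C)))); last first.
  by move=> p; rewrite e /mono !exprS; ring.
rewrite cintZ; last by apply: cintegrableD; exact: annih_cintegrable.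
by rewrite cintD ?aq ?addr0 ?mulr0//; exact: annih_cintegrable.
Qed.

Let mult_snd : mult snd.
Proof.
split=> [p|q cq aq a b]; first exact: cont_snd.
pose c : R[i] := (0 +i* (- 2^-1))%C.
have e p : (p.2)%:C = c * (toC p - (toC p)^*) :> R[i].
  by rewrite /c; apply: complex_ext; rewrite !ReImE /toC /=; field.
rewrite (@eq_cint _ _ (fun p => c * (w p * (mono a.+1 b p * q p * (H (sqz p))%:C) +
   (-1) * (w p * (mono a b.+1 p * q p * (H (sqz p))%:C))))); last first.
  by move=> p; rewrite e /mono !exprS; ring.
have i1 := @annih_cintegrable a.+1 b q cq; have i2 := @annih_cintegrable a b.+1 q cq.
rewrite cintZ; last by apply: cintegrableD => //; exact: cintegrableZ.
by rewrite cintD ?cintZ ?aq ?mulr0 ?addr0 ?mulr0//; exact: cintegrableZ.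
Qed.

Let mult_cst (c : R) : mult (fun=> c).
Proof.
split=> [p|q cq aq a b]; first exact: contC2.
rewrite (@eq_cint _ _ (fun p => c%:C * (w p * (mono a b p * q p * (H (sqz p))%:C)))); last first.
  by move=> p; ring.
by rewrite cintZ ?aq ?mulr0//; exact: annih_cintegrable.
Qed.

Let multD f g : mult f -> mult g -> mult (fun p => f p + g p).
Proof.
move=> [cf mf] [cg mg]; split=> [p|q cq aq a b]; first by apply: contD2; [exact: cf|exact: cg].
have cfq : ccont (fun p => (f p)%:C * q p) by apply: ccontM => //; exact: ccontC.
have cgq : ccont (fun p => (g p)%:C * q p) by apply: ccontM => //; exact: ccontC.
have i1 := @annih_cintegrable a b _ cfq; have i2 := @annih_cintegrable a b _ cgq.
rewrite (@eq_cint _ _ (fun p => w p * (mono a b p * ((f p)%:C * q p) * (H (sqz p))%:C) +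
   w p * (mono a b p * ((g p)%:C * q p) * (H (sqz p))%:C))); last first.
  by move=> p; rewrite realcD; ring.
by rewrite cintD// mf// mg// addr0.
Qed.

Let multM f g : mult f -> mult g -> mult (fun p => f p * g p).
Proof.
move=> [cf mf] [cg mg]; split=> [p|q cq aq a b]; first by apply: contM2; [exact: cf|exact: cg].
have cgq : ccont (fun p => (g p)%:C * q p) by apply: ccontM => //; exact: ccontC.
rewrite -[RHS](mf _ cgq (mg _ cq aq) a b); apply: eq_cint => p.
by rewrite realcM; ring.
Qed.

Let multX f n : mult f -> mult (fun p => f p ^+ n).
Proof.
move=> mf; elim: n => [|n IH]; first by under eq_fun do rewrite expr0; exact: mult_cst.
by under eq_fun do rewrite exprS; exact: multM.
Qed.

Let mult_eq0 f : mult f -> cint (fun p => w p * (H (sqz p))%:C * (f p)%:C) = 0.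
Proof.
move=> [cf mf]; have := mf _ (ccont_cst 1) annih1 0%N 0%N => h; rewrite -[RHS]h.
by apply: eq_cint => p; rewrite /mono !expr0; ring.
Qed.

Let mult_step (L : R) N f : mult f -> mult (fun p => step N (2^-1 + f p / L)).
Proof.
move=> mf; rewrite /step; apply: multX; apply: multD; first exact: mult_cst.
under eq_fun do rewrite -mulN1r; apply: multM; first exact: mult_cst.
apply: multX; apply: multD; first exact: mult_cst.
by apply: multM => //; exact: mult_cst.
Qed.

Let quadrant (g : R * R -> R) (r : R) : rint g -> (forall p, r < sqz p -> g p = 0) ->
  (forall f, mult f -> \int[@lam2 R]_p (g p * f p) = 0) ->
  forall a b : R, \int[@lam2 R]_p (g p * ((p.1 < a)%R%:R * (p.2 < b)%R%:R)) = 0.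
Proof.
move=> ig g0 gm a b.
(* [L] is four times a bound for |x - a| and |y - b| on the support, so 1/2 + (x - a) / L stays in
   [1/4, 3/4] there, and it is below 1/2 exactly when x < a. *)
pose s := Num.max r 1; pose L := 4 * (s + `|a| + `|b|).
have s1 : 1 <= s by rewrite le_max lexx orbT.
have rs : r <= s by rewrite le_max lexx.
have L0 : 0 < L by rewrite /L; have := normr_ge0 a; have := normr_ge0 b; lra.
have sq (x : R) : x ^+ 2 <= r -> `|x| <= s.
  move=> h; rewrite leNgt; apply/negP => sx.
  have : `|x| ^+ 2 = x ^+ 2 by rewrite real_normK ?num_real.
  nra.
have small p : sqz p <= r -> `|p.1| <= s /\ `|p.2| <= s.
  rewrite sqzE => h; split; apply: sq; apply: le_trans h; first by rewrite lerDl sqr_ge0.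
  by rewrite lerDr sqr_ge0.
have arg (x c : R) : `|x| <= s -> `|c| <= `|a| + `|b| -> 0 <= 2^-1 + (x - c) / L <= 1.
  move=> xs cc; have : `|x - c| <= L / 4.
    apply: le_trans (ler_normB _ _) _; rewrite /L; lra.
  rewrite ler_norml => /andP[h1 h2].
  have e1 : - (4^-1) <= (x - c) / L by rewrite ler_pdivlMr//; lra.
  have e2 : (x - c) / L <= 4^-1 by rewrite ler_pdivrMr//; lra.
  by apply/andP; split; lra.
have ca : `|a| <= `|a| + `|b| by rewrite lerDl.
have cb : `|b| <= `|a| + `|b| by rewrite lerDr.
have ltE (x c : R) : (2^-1 + (x - c) / L < 2^-1) = (x < c).
  by rewrite gtrDl pmulr_llt0 ?invr_gt0// subr_lt0.
pose f N p := step N (2^-1 + (p.1 - a) / L) * step N (2^-1 + (p.2 - b) / L).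
have fm N : mult (f N).
  apply: multM; apply: (@mult_step L N (fun p => _ - _)).
    by apply: multD; [exact: mult_fst|exact: mult_cst].
  by apply: multD; [exact: mult_snd|exact: mult_cst].
have mg := rint_measurable ig.
have mlt : measurable_fun setT (fun p : R * R => g p * ((p.1 < a)%R%:R * (p.2 < b)%R%:R)).
  have m1 (c : R) : measurable_fun setT (fun x : R => (x < c)%R%:R : R).
    rewrite (_ : (fun _ => _) = \1_(`]-oo, c[%classic : set R)); first exact: measurable_indic.
    by apply/funext => x; rewrite indicE; congr (nat_of_bool _)%:R; apply/idP/idP; rewrite inE /= in_itv.
  apply: measurable_funM => //; apply: measurable_funM; apply: (measurableT_comp (m1 _)).
    exact: measurable_fst.
  exact: measurable_snd.
have : \int[@lam2 R]_p (g p * f N p) @[N --> \oo] -->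
    \int[@lam2 R]_p (g p * ((p.1 < a)%R%:R * (p.2 < b)%R%:R)).
  apply: (@Rint_dominated _ _ _ (fun p => `|g p|)) => //.
  - by move=> N; apply: measurable_funM => //; apply: cont2_measurable; exact: (fm N).1.
  - move=> p _; have [rp|pr] := ltP r (sqz p).
      by rewrite g0// mul0r; under eq_fun do rewrite mul0r; exact: cvg_cst.
    have [p1 p2] := small p pr.
    apply: cvgM; first exact: cvg_cst.
    by rewrite -(ltE p.1 a) -(ltE p.2 b); apply: cvgM; apply: step_cvg; exact: arg.
  - by have := integrable_norm ig; apply: eq_integrable.
  - move=> N p; have [rp|pr] := ltP r (sqz p); first by rewrite g0// mul0r normr0.
    have [p1 p2] := small p pr; rewrite normrM ler_piMr//.
    have /andP[x0 x1] := @step_itv _ N _ (arg _ _ p1 ca).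
    have /andP[y0 y1] := @step_itv _ N _ (arg _ _ p2 cb).
    by rewrite /f ger0_norm ?mulr_ge0// -[leRHS]mulr1 ler_pM.
by under eq_fun do rewrite gm//; move=> /(cvg_lim (@norm_hausdorff _ _)) <-; rewrite lim_cst.
Qed.

Let null_real (g : R * R -> R) (r : R) : rint g -> (forall p, r < sqz p -> g p = 0) ->
  (forall f, mult f -> \int[@lam2 R]_p (g p * f p) = 0) ->
  ae_eq (@lam2 R) setT (EFin \o g) (cst 0%E).
Proof.
move=> ig g0 gm; have Q := quadrant ig g0 gm.
(* [g] vanishes wherever a coordinate reaches [s], so half-planes and the plane are handled as
   quadrants with [s] as a corner coordinate. *)
pose s := Num.max r 1 + 1.
have far (x y : R) : s <= x -> r < x ^+ 2 + y ^+ 2.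
  move=> sx; have s1 : 1 <= Num.max r 1 by rewrite le_max lexx orbT.
  have s2 : 2 <= s by rewrite /s; lra.
  have rs : r + 1 <= s by rewrite lerD2r le_max lexx.
  have := sqr_ge0 y; nra.
have setint (A : set (R * R)) (h : R * R -> R) : measurable A ->
    (forall p, (g \_ A) p = h p) -> \int[@lam2 R]_p h p = 0 ->
    (\int[@lam2 R]_(p in A) (g p)%:E = 0)%E.
  move=> mA hE h0; have iA : (@lam2 R).-integrable A (EFin \o g) by apply: integrableS ig.
  have R0 : \int[@lam2 R]_(p in A) g p = 0.
    by rewrite Rintegral_mkcond -[RHS]h0; apply: eq_Rintegral => p _; rewrite hE.
  have := fineK (@integrable_fin_num _ _ R (@lam2 R) A mA _ iA).
  by rewrite (_ : fine _ = 0)// => <-.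
have f1 : measurable_fun setT (fst : R * R -> R) by exact: measurable_fst.
have f2 : measurable_fun setT (snd : R * R -> R) by exact: measurable_snd.
have m1 (a : R) : measurable [set p : R * R | p.1 < a].
  have := f1 measurableT `]-oo, a[%classic (measurable_itv _).
  by congr measurable; apply/seteqP; split => x; rewrite /= in_itv/=; [case|split].
have m2 (a : R) : measurable [set p : R * R | p.2 < a].
  have := f2 measurableT `]-oo, a[%classic (measurable_itv _).
  by congr measurable; apply/seteqP; split => x; rewrite /= in_itv/=; [case|split].
have memE (A : set (R * R)) p : (g \_ A) p = g p * (p \in A)%:R.
  by rewrite patchE; case: ifP; rewrite ?mulr1 ?mulr0.
have inb (A : set (R * R)) p (c : bool) : (A p <-> c) -> (p \in A) = c.
  by move=> h; apply/idP/idP => [/set_mem/h|/h/mem_set].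
have big1 p : s <= p.1 -> g p = 0 by move=> h; rewrite g0// sqzE far.
have big2 p : s <= p.2 -> g p = 0 by move=> h; rewrite g0// sqzE addrC far.
apply: null_quadrants => //.
- rewrite -[RHS](Q s s); apply: eq_Rintegral => p _.
  have [h1|h1] := ltP p.1 s; last by rewrite big1// mul0r.
  by have [h2|h2] := ltP p.2 s; rewrite ?mulr1// big2// mul0r.
- move=> a b; apply: setint (Q a b); first exact: (measurableI _ _ (m1 a) (m2 b)).
  move=> p; rewrite memE -natrM mulnb; congr (_ * (nat_of_bool _)%:R).
  by apply: inb; split => /andP.
- move=> a; apply: setint (Q a s) => // p; rewrite memE.
  have [h2|h2] := ltP p.2 s; last by rewrite big2// !mul0r.
  by rewrite mulr1; congr (_ * (nat_of_bool _)%:R); exact: inb.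
- move=> b; apply: setint (Q s b) => // p; rewrite memE.
  have [h1|h1] := ltP p.1 s; last by rewrite big1// !mul0r.
  by rewrite mul1r; congr (_ * (nat_of_bool _)%:R); exact: inb.
Qed.

Lemma localized_null : (forall t, 0 <= H t) ->
  \int[@lam2 R]_p (sqmod (w p) * W p * H (sqz p)) = 0.
Proof.
move=> H0.
have [sH [a [b [a0 ab Hab]]]] := aH.
have iw : cintegrable (fun p => w p * (H (sqz p))%:C).
  have := annih_cintegrable 0 0 (ccont_cst 1).
  by under [X in cintegrable X -> _]eq_fun do rewrite /mono !expr0 !mul1r.
have supp p : b < sqz p -> H (sqz p) = 0 by move=> h; rewrite Hab// (ltW h) orbT.
have mE f : mult f -> (\int[@lam2 R]_p (Re (w p) * H (sqz p) * f p) = 0) /\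
                      (\int[@lam2 R]_p (Im (w p) * H (sqz p) * f p) = 0).
  move=> /mult_eq0; rewrite /cint => -[h1 h2]; split; [rewrite -[RHS]h1|rewrite -[RHS]h2];
  by apply: eq_Rintegral => p _; rewrite !ReImE; ring.
have i1 : rint (fun p => Re (w p) * H (sqz p)).
  by have := iw.1; apply: eq_integrable => // p _ /=; rewrite !ReImE mulr0 subr0.
have i2 : rint (fun p => Im (w p) * H (sqz p)).
  by have := iw.2; apply: eq_integrable => // p _ /=; rewrite !ReImE mulr0 add0r.
have z1 := @null_real _ b i1 ltac:(by move=> p /supp ->; rewrite mulr0) (fun f mf => (mE f mf).1).
have z2 := @null_real _ b i2 ltac:(by move=> p /supp ->; rewrite mulr0) (fun f mf => (mE f mf).2).
rewrite /Rintegral (ae_eq_integral (cst 0%E)) ?integral0//.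
- apply/measurable_EFinP; apply: measurable_funM; last first.
    apply: cont2_measurable => p; apply: continuous_comp; first exact: cont_sqz.
    exact: smooth1_cont.
  apply: measurable_funM; last exact: weight_measurable.
  by apply: sqmod_measurable; have [[]] := wc.
- apply: filterS2 z1 z2 => p h1 h2 _; have [e1] := h1 Logic.I; have [e2] := h2 Logic.I.
  congr EFin; rewrite /sqmod.
  rewrite (_ : _ * _ = (Re (w p) * H (sqz p)) * Re (w p) * W p +
    (Im (w p) * H (sqz p)) * Im (w p) * W p); last by ring.
  by rewrite e1 e2 !mul0r addr0.
Qed.

End Localized.

Theorem wclosed_unique w : wclosed m w -> (forall j, ip w (fun p => toC p ^+ j) = 0) ->
  L2norm2 m w = 0.
Proof.
move=> wc wo; have Lw := wc.1; have /L2wP[mw iw] := Lw.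
have : cint (fun p => (sqmod (w p) * W p)%:C) = 0.
  apply: cint_chi_eq0; first by split => //; exact: rint0.
  move=> n; have := localized_null wc wo (@annular_chi R n) (@chi_ge0 R n) => h.
  under eq_fun do rewrite -realcM.
  by rewrite cintC h.
by rewrite cintC => -[].
Qed.

End Uniqueness.

(** * Completeness *)

Section RieszFischer.
Context d (T : measurableType d) (R : realType) (mu : {measure set T -> \bar R}).

(** By |b| <= a b^2 + 1/a with a = 2^k the increments are absolutely summable. The weights make it
    possible to work with squares only, without Minkowski's inequality. *)
Lemma weighted_square_cvg (h : nat -> R) :
  (\sum_(0 <= k <oo) (2 ^+ k * (h k.+1 - h k) ^+ 2)%:E < +oo)%E -> cvgn h.
Proof.
move=> Sfin; set S := (\sum_(0 <= k <oo) _)%E in Sfin.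
have t0 k : (0 <= (2 ^+ k * (h k.+1 - h k) ^+ 2)%:E)%E.
  by rewrite lee_fin mulr_ge0 ?sqr_ge0 ?exprn_ge0.
have S0 : (0 <= S)%E by apply: nneseries_ge0 => k _ _; exact: t0.
have part n : \sum_(0 <= k < n) (2 ^+ k * (h k.+1 - h k) ^+ 2) <= fine S.
  have := @nneseries_lim_ge R _ xpredT 0 n (fun k _ _ => t0 k).
  by rewrite -lee_fin fineK ?ge0_fin_numE// -sumEFin.
have geo n : \sum_(0 <= k < n) (2 ^+ k)^-1 <= 2 :> R.
  suff -> : \sum_(0 <= k < n) (2 ^+ k)^-1 = 2 - 2 * (2 ^+ n)^-1 :> R.
    by rewrite gerBl mulr_ge0// invr_ge0 exprn_ge0.
  elim: n => [|n IH]; first by rewrite big_geq// expr0 invr1 mulr1 subrr.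
  rewrite big_nat_recr//= IH exprS; field.
  by rewrite expf_neq0.
have am (a b : R) : 0 < a -> `|b| <= a * b ^+ 2 + a^-1.
  move=> a0; rewrite -(ler_pM2l a0) mulrDr mulfV ?gt_eqF// mulrA -expr2 -exprMn.
  have : (a * `|b|) ^+ 2 = (a * b) ^+ 2 by rewrite !exprMn real_normK ?num_real.
  by move=> <-; set c := a * `|b|; nra.
have nc : cvgn [normed series (telescope h)].
  apply: nondecreasing_is_cvgn; first by apply: nondecreasing_series => *; exact: normr_ge0.
  exists (fine S + 2) => _ [n _ <-] /=.
  apply: le_trans (lerD (part n) (geo n)); rewrite -big_split/=.
  by apply: ler_sum => k _; apply: am; exact: exprn_gt0.
have /cvg_ex[l lP] := normed_cvg nc.
apply/cvg_ex; exists (h 0%N + l).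
have c : (fun n => h 0%N + series (telescope h) n) @ \oo --> h 0%N + l.
  by apply: cvgD => //; exact: cvg_cst.
by rewrite -(funext (eq_sum_telescope h)) in c.
Qed.

Lemma nneseries_half_lty (u : nat -> \bar R) : (forall k, (0 <= u k)%E) ->
  (forall k, (u k <= ((2 ^+ k.+1)^-1)%:E)%E) -> (\sum_(0 <= k <oo) u k < +oo)%E.
Proof.
move=> u0 uh; have c := @cvg_geometric_eseries_half R 1 0.
apply: (@le_lt_trans _ _ (limn (eseries (fun k : nat => (1 / (2 ^ (k + 1))%:R)%:E)))).
  apply: lee_nneseries => k _ //.
  by rewrite addn1 div1r natrX.
by rewrite (cvg_lim _ c)// ltry.
Qed.

Lemma riesz_fischer (f : nat -> T -> R) :
  (forall n, measurable_fun setT (f n)) ->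
  (forall e : R, 0 < e -> exists N, forall i j, (N <= i)%N -> (N <= j)%N ->
    (\int[mu]_x ((f i x - f j x) ^+ 2)%:E <= e%:E)%E) ->
  exists2 g : T -> R, measurable_fun setT g &
    forall e : R, 0 < e -> exists N, forall i, (N <= i)%N ->
      (\int[mu]_x ((f i x - g x) ^+ 2)%:E <= e%:E)%E.
Proof.
move=> mf cf.
(* The factor 2^k pays for the weight in [weighted_square_cvg], the factor 2^(k+1) makes the
   weighted integrals summable. *)
have dk0 k : 0 < (2 ^+ k * 2 ^+ k.+1)^-1 :> R by rewrite invr_gt0 mulr_gt0 ?exprn_gt0.
have [N NP] := choice (fun k => cf _ (dk0 k)).
(* Summing the thresholds makes [nk] nondecreasing and at least [N k]; the added [k] makes it
   unbounded. *)
pose nk k := (\sum_(i < k.+1) N i + k)%N.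
have nkN k : (N k <= nk k)%N by rewrite /nk big_ord_recr/= -addnA addnCA leq_addr.
have nkS k : (nk k <= nk k.+1)%N by rewrite /nk [X in (_ <= X + _)%N]big_ord_recr/= leq_add// leq_addr.
pose h k x := f (nk k) x.
pose S x := (\sum_(0 <= k <oo) (2 ^+ k * (h k.+1 x - h k x) ^+ 2)%:E)%E.
have mt k : measurable_fun setT (fun x => (2 ^+ k * (h k.+1 x - h k x) ^+ 2)%:E).
  apply/measurable_EFinP; apply: measurable_funM; first exact: measurable_cst.
  by apply: measurable_funX; apply: measurable_funB; exact: mf.
have t0 k x : (0 <= (2 ^+ k * (h k.+1 x - h k x) ^+ 2)%:E)%E.
  by rewrite lee_fin mulr_ge0 ?sqr_ge0 ?exprn_ge0.
have mS : measurable_fun setT S by exact: ge0_emeasurable_sum.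
have S0 x : (0 <= S x)%E by apply: nneseries_ge0 => k _ _; exact: t0.
have Slt : (\int[mu]_x S x < +oo)%E.
  rewrite integral_nneseries//; apply: nneseries_half_lty => k; first exact: integral_ge0.
  under eq_integral do rewrite EFinM.
  rewrite ge0_integralZl_EFin ?exprn_ge0//; last 2 first.
  - by move=> x _; rewrite lee_fin sqr_ge0.
  - apply/measurable_EFinP; apply: measurable_funX; apply: measurable_funB; exact: mf.
  have hk := NP k (nk k.+1) (nk k) (leq_trans (nkN k) (nkS k)) (nkN k).
  have p0 : 0 <= 2 ^+ k :> R by exact: exprn_ge0.
  apply: le_trans (lee_wpmul2l _ hk) _; first by rewrite lee_fin.
  by rewrite -EFinM lee_fin invfM mulrA mulfV ?mul1r ?expf_neq0.
pose E := [set x | (S x < +oo)%E].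
have mE : measurable E.
  by rewrite -[E]setTI; exact: emeasurable_fun_infty_o.
have aeE : \forall x \ae mu, E x.
  have iS : mu.-integrable setT S.
    by apply/integrableP; split => //; under eq_integral do rewrite gee0_abs//.
  have := integrable_ae measurableT iS; apply: filterS => x /(_ Logic.I).
  by rewrite /E /= ge0_fin_numE.
(* Cutting down to [E] makes the subsequence converge everywhere, so its limit is measurable; as [E]
   has full measure, no integral changes. *)
pose hE k x := h k x * \1_E x.
have mhE k : measurable_fun setT (hE k).
  by apply: measurable_funM; [exact: mf|exact: measurable_indic].
have cE x : cvgn (fun k => hE k x).
  rewrite /hE indicE; case: (boolP (x \in E)) => xE.
    under eq_fun do rewrite mulr1; apply: weighted_square_cvg; exact: (set_mem xE).
  by under eq_fun do rewrite mulr0; exact: is_cvg_cst.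
pose g x := limn (fun k => hE k x).
have mg : measurable_fun setT g by apply: (measurable_fun_cvg mhE) => x _; exact: cE.
exists g => // e e0; have [N0 N0P] := cf e e0; exists N0 => i iN.
have F0 k x : (0 <= ((f i x - hE k x) ^+ 2)%:E)%E by rewrite lee_fin sqr_ge0.
have mF k : measurable_fun setT (fun x => ((f i x - hE k x) ^+ 2)%:E).
  by apply/measurable_EFinP; apply: measurable_funX; apply: measurable_funB.
have cF x : ((f i x - hE k x) ^+ 2)%:E @[k --> \oo] --> ((f i x - g x) ^+ 2)%:E.
  apply: cvg_EFin; first exact: nearW.
  by rewrite expr2; under eq_fun do rewrite expr2; apply: cvgM; apply: cvgB;
    do ?[exact: cvg_cst|exact: cE].
have := fatou mu measurableT mF (fun k x _ => F0 k x).
under eq_integral do rewrite (cvg_limn_einf_sup (cF _)).1.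
move=> /le_trans; apply.
have IE k : (\int[mu]_x ((f i x - hE k x) ^+ 2)%:E =
    \int[mu]_x ((f i x - h k x) ^+ 2)%:E)%E.
  apply: ae_eq_integral => //.
    by apply/measurable_EFinP; apply: measurable_funX; apply: measurable_funB; exact: mf.
  by apply: filterS aeE => x xE _; rewrite /hE indicE mem_set// mulr1.
have nkk k : (k <= nk k)%N by rewrite leq_addl.
rewrite limn_einf_lim; apply: lime_le; first exact: is_cvg_einfs.
exists N0 => // k /= Nk; apply: (@le_trans _ _ (\int[mu]_x ((f i x - hE k x) ^+ 2)%:E)%E).
  by apply: ereal_inf_lbound; exists k => //=.
by rewrite IE; apply: N0P => //; exact: leq_trans Nk (nkk k).
Qed.

End RieszFischer.

Section Completeness.
Variables (R : realType) (m : R).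
Implicit Types (p : R * R) (u v w g : R * R -> R[i]).

Local Notation Re := complex.Re.
Local Notation Im := complex.Im.
Local Notation W := (weight m).
Local Notation ip := (inner m).
Local Notation nrm := (L2norm2 m).

Lemma nrmE u : L2w m u -> (\int[@lam2 R]_p (sqmod (u p) * W p)%:E = (nrm u)%:E)%E.
Proof.
by move=> /L2wP[_ iu]; rewrite /L2norm2 /Rintegral fineK//; exact: (integrable_fin_num measurableT iu).
Qed.

Lemma L2w_complete (u : nat -> R * R -> R[i]) : (forall n, L2w m (u n)) ->
  (forall e : R, 0 < e -> exists N, forall i j, (N <= i)%N -> (N <= j)%N ->
     nrm (fun p => u i p - u j p) <= e) ->
  exists v, L2w m v /\ nrm (fun p => u n p - v p) @[n --> \oo] --> (0 : R).
Proof.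
(* Multiplication by the square root of the weight reduces the claim to unweighted real L^2, once
   for the real and once for the imaginary part. *)
move=> Lu cu; pose rt p := Num.sqrt (W p).
have rt0 p : 0 < rt p by rewrite sqrtr_gt0 weight_gt0.
have rt2 p : rt p ^+ 2 = W p by rewrite sqr_sqrtr// ltW// weight_gt0.
have mrt : measurable_fun setT rt.
  apply: (measurableT_comp (f := @Num.sqrt R)); last exact: weight_measurable.
  by apply: continuous_measurable_fun => x; exact: sqrt_continuous.
have part (F : R[i] -> R) : (forall a b, F (a - b) = F a - F b) ->
    (forall a, F a ^+ 2 <= sqmod a) -> (forall n, measurable_fun setT (fun p => F (u n p))) ->
    exists2 h : R * R -> R, measurable_fun setT h &
    forall e : R, 0 < e -> exists N, forall i, (N <= i)%N ->
      (\int[@lam2 R]_p ((F (u i p) * rt p - h p) ^+ 2)%:E <= e%:E)%E.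
  move=> FB Fle mF; apply: (@riesz_fischer _ _ R (@lam2 R) (fun n p => F (u n p) * rt p)); first by move=> n; apply: measurable_funM; [exact: mF|exact: mrt].
  move=> e e0; have [N NP] := cu e e0; exists N => i j iN jN.
  apply: (@le_trans _ _ (nrm (fun p => u i p - u j p))%:E); last by rewrite lee_fin NP.
  have LB := L2wB (Lu i) (Lu j); rewrite -nrmE//.
  have mD : measurable_fun setT (fun p => F (u i p) * rt p - F (u j p) * rt p).
    by apply: measurable_funB; apply: measurable_funM => //; exact: mF.
  apply: ge0_le_integral => //.
  - by move=> p _; rewrite lee_fin sqr_ge0.
  - by apply/measurable_EFinP; exact: measurable_funX.
  - apply/measurable_EFinP; apply: measurable_funM; last exact: weight_measurable.
    exact: sqmod_measurable LB.1.
  - move=> p _; rewrite lee_fin -mulrBl -FB exprMn rt2 ler_pM2r ?weight_gt0//.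
have [h1 mh1 h1P] := @part (@complex.Re R) ltac:(by move=> a b; rewrite !ReImE)
  ltac:(by move=> a; rewrite lerDl sqr_ge0) (fun n => (Lu n).1.1).
have [h2 mh2 h2P] := @part (@complex.Im R) ltac:(by move=> a b; rewrite !ReImE)
  ltac:(by move=> a; rewrite lerDr sqr_ge0) (fun n => (Lu n).1.2).
pose v p : R[i] := ((h1 p / rt p) +i* (h2 p / rt p))%C.
have mV : measurable_fun setT (fun p => (rt p)^-1).
  rewrite (_ : (fun _ => _) = fun p => expR (- ln (rt p))).
    by apply: measurableT_comp => //; apply: measurableT_comp => //; exact: measurableT_comp.
  by apply/funext => p; rewrite expRN lnK// posrE.
have mv : cmeasurable v by split; apply: measurable_funM.
have E i p : sqmod (u i p - v p) * W p =
    (Re (u i p) * rt p - h1 p) ^+ 2 + (Im (u i p) * rt p - h2 p) ^+ 2.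
  rewrite /sqmod /v !ReImE -rt2; field; exact: lt0r_neq0.
have small (e : R) : 0 < e -> exists N, forall i, (N <= i)%N ->
    (\int[@lam2 R]_p (sqmod (u i p - v p) * W p)%R%:E <= e%:E)%E.
  move=> e0; have e2 : 0 < e / 2 by rewrite divr_gt0.
  have [N1 N1P] := h1P _ e2; have [N2 N2P] := h2P _ e2.
  exists (maxn N1 N2) => i; rewrite geq_max => /andP[i1 i2].
  under eq_integral do rewrite E EFinD.
  have mF (F : R[i] -> R) (h : R * R -> R) : measurable_fun setT (fun p => F (u i p)) -> measurable_fun setT h ->
      measurable_fun setT (fun p => ((F (u i p) * rt p - h p) ^+ 2)%:E).
    move=> mF mh; apply/measurable_EFinP; apply: measurable_funX.
    by apply: measurable_funB => //; exact: measurable_funM.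
  rewrite ge0_integralD//.
  - by rewrite [e in e%:E]splitr EFinD leeD ?N1P ?N2P.
  - by move=> p _; rewrite lee_fin sqr_ge0.
  - by apply: mF => //; exact: (Lu i).1.1.
  - by move=> p _; rewrite lee_fin sqr_ge0.
  - by apply: mF => //; exact: (Lu i).1.2.
have Lsub i : (\int[@lam2 R]_p (sqmod (u i p - v p) * W p)%:E < +oo)%E ->
    L2w m (fun p => u i p - v p).
  move=> h; split => //; apply: cmeasurableD; first exact: (Lu i).1.
  have := cmeasurableM (cmeasurable_cst (-1)) mv.
  by under eq_fun do rewrite mulN1r.
have Lv : L2w m v.
  have [N NP] := small 1 ltr01.
  have := L2wB (Lu N) (Lsub N (le_lt_trans (NP N (leqnn _)) (ltry _))).
  by under eq_fun do rewrite opprB addrC subrK.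
exists v; split => //; apply/cvgrPdist_le => e e0; have [N NP] := small e e0.
exists N => // i /= iN; rewrite sub0r normrN ger0_norm ?nrm_ge0//.
by rewrite -lee_fin -nrmE ?NP//; exact: L2wB.
Qed.

Lemma nrm_sum_ortho (E : nat -> R * R -> R[i]) (c : nat -> R[i]) N M :
  (forall k, L2w m (E k)) -> (forall j k, j != k -> ip (E j) (E k) = 0) -> (N <= M)%N ->
  nrm (fun p => \sum_(N <= k < M) c k * E k p) = \sum_(N <= k < M) sqmod (c k) * nrm (E k).
Proof.
move=> LE oE; elim: M => [|M IH].
  rewrite leqn0 => /eqP ->; rewrite big_geq//.
  under eq_fun do rewrite big_geq//.
  have := nrmZ 0 (L2w0 m); rewrite (_ : (fun _ => 0 * 0) = fun=> 0); last by rewrite mulr0.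
  by move=> ->; rewrite /sqmod/= expr0n/= addr0 mul0r.
rewrite leq_eqVlt => /orP[/eqP <-|NM].
  rewrite big_geq//; under eq_fun do rewrite big_geq//.
  have := nrmZ 0 (L2w0 m); rewrite (_ : (fun _ => 0 * 0) = fun=> 0); last by rewrite mulr0.
  by move=> ->; rewrite /sqmod/= expr0n/= addr0 mul0r.
have LcE k : L2w m (fun p => c k * E k p) by exact: L2wZ.
rewrite big_nat_recr//=; under eq_fun do rewrite big_nat_recr//=.
rewrite nrmD//; last exact: L2w_sum.
rewrite nrmZ// IH// ip_suml// [X in Re X](_ : _ = 0) ?mulr0 ?addr0//.
rewrite big_nat big1// => k /andP[_ kM].
by rewrite ipZl// ipZr// oE ?mulr0// ltn_eqF.
Qed.

End Completeness.

(** * Canonical solutions *)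

Section Eigenfunctions.
Variables (R : realType) (m : R).
Hypothesis hm : 2 <= m.
Implicit Types (p : R * R) (u v w g h : R * R -> R[i]).

Local Notation Re := complex.Re.
Local Notation Im := complex.Im.
Local Notation W := (weight m).
Local Notation ip := (inner m).
Local Notation nrm := (L2norm2 m).
Local Notation c2 := (ck2 m).

(** Vanishing off the diagonal comes from [ip_mode_pos] for the constant function 1, instead of an
    integration over the angle. *)
Lemma ip_mono a b c d : ip (mono a b) (mono c d) =
  if (a + d == b + c)%N then (c2 (a + d))%:C else 0 :> R[i].
Proof.
have E (a' b' c' d' : nat) p : mono a' b' p * (mono c' d' p)^* * (W p)%:C =
    mono (a' + d') (b' + c') p * (W p)%:C :> R[i].
  by rewrite /mono conjM !conjX conjK !exprD; ring.
have lt (a' b' c' d' : nat) : (b' + c' < a' + d')%N -> ip (mono a' b') (mono c' d') = 0 :> R[i].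
  move=> h; have := ip_mode_pos hm (a' + d' - (b' + c')).-1 (b' + c') (wclosed1 hm).
  rewrite prednK ?subn_gt0// => h0; rewrite -[RHS]h0; apply: eq_cint => p.
  rewrite E conjM !conjX conjK conjC mul1r.
  have := mono_sqz (a' + d' - (b' + c')) 0 (b' + c') p.
  by rewrite add0n subnK ?(ltnW h)// => ->; rewrite /mono expr0 mulr1.
case: ltngtP => h.
- rewrite [LHS](ipJ (L2w_mono hm _ _) (L2w_mono hm _ _)) lt; last by rewrite (addnC d) (addnC c).
  by apply: complex_ext; rewrite !ReImE ?oppr0.
- exact: lt.
rewrite -ck2C; apply: eq_cint => p; rewrite E -h.
have := mono_sqz 0 0 (a + d) p; rewrite !add0n => ->.
by rewrite /mono !expr0 !mul1r realcM.
Qed.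

Definition kap (k : nat) : R := if k is k'.+1 then c2 k / c2 k' else 0.

(* sol k is the canonical solution with datum z^k, and gap k is the ratio of their
   squared norms; at k = 0 the coefficient kap 0 = 0 makes k.-1 irrelevant. *)
Definition sol (k : nat) p : R[i] := mono k 1 p - (kap k)%:C * mono k.-1 0 p.

Definition gap (k : nat) : R := c2 k.+1 / c2 k - kap k.

Lemma L2w_sol k : L2w m (sol k).
Proof. by apply: L2wB; [exact: L2w_mono|apply: L2wZ; exact: L2w_mono]. Qed.

(** Both terms of [sol k] have angular mode k - 1 (for k = 0 the second one is absent), whence the
    orthogonality. *)
Lemma ip_sol j k : ip (sol j) (sol k) = if j == k then (c2 k * gap k)%:C else 0.
Proof.
have L a b := @L2w_mono R m hm a b.
have LZ (c : R[i]) a b : L2w m (fun p => c * mono a b p) by exact: L2wZ.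
have LL : L2w m (fun p => mono k 1 p - (kap k)%:C * mono k.-1 0 p) by exact: L2w_sol.
rewrite /sol ipBl// ipZl// !ipBr// !ipZr// !ip_mono !addn1 !add1n !addn0 !conjC.
have cn0 i : c2 i != 0 by rewrite gt_eqF// ck2_gt0.
have C0 : (0 : R)%:C = 0 :> R[i] by [].
rewrite !add0n; have [{j}->|jk] := eqVneq j k.
  rewrite eqxx; case: k LL => [|k] _.
    by rewrite /gap /kap C0 !mul0r !subr0 mulrC divfK.
  rewrite /= !eqxx.
  rewrite -!(realcM, realcN, realcD); congr (_%:C).
  by rewrite /gap /kap; field; rewrite !cn0.
rewrite eqSS (negbTE jk).
case: j k LL jk => [|j] [|k] _ //= jk; rewrite ?eqSS ?C0 /= ?mulr0 ?mul0r ?subr0 ?mulr0 ?oppr0//.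
  by rewrite addr0.
have jk' : (j == k) = false by exact: negbTE jk.
by rewrite jk' !mulr0 !subr0 !mulr0 ?subr0 ?oppr0 ?mulr0 ?subrr ?addr0.
Qed.

Lemma nrm_sol k : nrm (sol k) = c2 k * gap k.
Proof. by have := ip_sol k k; rewrite eqxx ip_nrm => -[]. Qed.

(** For k >= 1 this is the log-convexity of the moments, read off here from the norm of [sol k]. *)
Lemma gap_ge0 k : 0 <= gap k.
Proof.
have := nrm_ge0 m (sol k); rewrite nrm_sol pmulr_rge0//; exact: ck2_gt0.
Qed.

Lemma sol_weak_dbar k : weak_dbar (sol k) (fun p => toC p ^+ k).
Proof.
apply: classical_weak_dbar; last by apply: ccontX; exact: ccont_toC.
move=> p.
have h1 : has_dbar (mono k 1) p (toC p ^+ k).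
  have := has_dbarM (has_dbar_toCX k p) (has_dbar_conjX 0 p).
  by congr has_dbar; rewrite expr0; ring.
have h2 : has_dbar (fun p => (- (kap k)%:C) * mono k.-1 0 p) p 0.
  rewrite -[0](mulr0 (- (kap k)%:C)); apply: has_dbarZ.
  have := has_dbar_toCX k.-1 p; congr has_dbar.
  by apply/funext => q; rewrite /mono expr0 mulr1.
have := has_dbarD h1 h2; rewrite addr0; congr has_dbar.
by apply/funext => q; rewrite /sol mulNr.
Qed.

(** For any h in A^2, [ip_mode_neg] gives the inner products C c_(k+1)^2 and C c_k^2 with z^(k+1)
    zbar and z^k, and [kap k.+1] is exactly the ratio that cancels them. No expansion of h is
    involved. *)
Lemma sol_ortho k h : A2w m h -> ip (sol k) h = 0.
Proof.
move=> Ah; have wh := A2w_wclosed Ah; have Lh := wh.1.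
rewrite ipJ//; last exact: L2w_sol.
suff -> : ip h (sol k) = 0 by apply: complex_ext; rewrite !ReImE ?oppr0.
have L a b := @L2w_mono R m hm a b.
rewrite /sol ipBr//; last exact: L2wZ.
rewrite ipZr// conjC; case: k => [|k].
  rewrite /kap mul0r subr0.
  have h0 := ip_mode_pos hm 0 0 wh; rewrite -[RHS]h0; congr inner.
  by apply/funext => p; rewrite /mono !expr0 mul1r mulr1.
have [C [CP _]] := ip_mode_neg hm k wh.
have e1 : ip h (mono k.+1 1) = C * (c2 k.+1)%:C.
  rewrite -(CP 1%N); congr inner; apply/funext => p.
  by rewrite /mono exprS !expr1 -toC_sqz; ring.
have e2 : ip h (mono k 0) = C * (c2 k)%:C.
  rewrite -(CP 0%N); congr inner.
rewrite e1 /= e2 realcM realcV; have : (c2 k)%:C != 0 :> R[i].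
  by apply/eqP => -[]; apply/eqP; rewrite gt_eqF// ck2_gt0.
by move=> ?; field.
Qed.

End Eigenfunctions.

(** * Convergence of orthogonal series *)

Section CanonicalSeries.
Variables (R : realType) (m : R).
Implicit Types (p : R * R) (u v w g : R * R -> R[i]).

Local Notation Re := complex.Re.
Local Notation Im := complex.Im.
Local Notation ip := (inner m).
Local Notation nrm := (L2norm2 m).
Local Notation c2 := (ck2 m).

Lemma nrm_sym u v : nrm (fun p => u p - v p) = nrm (fun p => v p - u p).
Proof. by rewrite -nrmN; under eq_fun do rewrite opprB. Qed.

Definition L2cvg (S : nat -> R * R -> R[i]) v :=
  [/\ forall n, L2w m (S n), L2w m v & nrm (fun p => S n p - v p) @[n --> \oo] --> (0 : R)].

Lemma le0_cvg (a : R) (x : nat -> R) (K : R) : 0 <= a -> (forall n, a <= K * x n) ->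
  x @ \oo --> (0 : R) -> a = 0.
Proof.
move=> a0 ax xc; apply: le_anti; rewrite a0 andbT.
have h : (fun n => K * x n) @ \oo --> (0 : R).
  by rewrite -[X in _ --> X](mulr0 K); apply: cvgM => //; exact: cvg_cst.
rewrite -(cvg_lim _ h)//; apply: limr_ge; first by apply/cvg_ex; exists 0.
by apply: nearW.
Qed.

Lemma L2cvg_ip S v w : L2cvg S v -> L2w m w ->
  sqmod (ip (S n) w - ip v w) @[n --> \oo] --> (0 : R).
Proof.
move=> [LS Lv c] Lw; apply: (@squeeze_cvgr _ _ _ _ (fun=> 0) (fun n => nrm (fun p => S n p - v p) * nrm w)).
- apply: nearW => n; rewrite sqmod_ge0 -ipBl//= cauchy_schwarz//.
  exact: L2wB.
- exact: cvg_cst.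
- by rewrite -[X in _ --> X](mul0r (nrm w)); apply: cvgM => //; exact: cvg_cst.
Qed.

(** This is how the weak equation passes to the limit: S and T will be partial sums of the solution
    and of its datum, w and w' the [dual] functions of dbar phi and phi. *)
Lemma L2cvg_ip_opp S v w T v' w' : L2cvg S v -> L2cvg T v' -> L2w m w -> L2w m w' ->
  (forall n, ip (S n) w = - ip (T n) w') -> ip v w = - ip v' w'.
Proof.
move=> cS cT Lw Lw' E.
have h1 := L2cvg_ip cS Lw; have h2 := L2cvg_ip cT Lw'.
have H : (fun n => sqmod (ip (S n) w - ip v w) + sqmod (ip (T n) w' - ip v' w')) @ \oo --> (0 : R).
  by rewrite -[X in _ --> X](addr0 0); exact: cvgD.
apply/eqP; rewrite -addr_eq0; apply/eqP; apply: sqmod_eq0.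
apply: (le0_cvg (K := 2) (sqmod_ge0 _) _ H) => n /=.
rewrite -sqmodN (_ : - _ = (ip (S n) w - ip v w) + (ip (T n) w' - ip v' w')); last first.
  by rewrite E; ring.
by rewrite mulrDr; exact: sqmodD_le.
Qed.

Lemma L2cvg_ip_const S v w (c : R[i]) N : L2cvg S v -> L2w m w ->
  (forall n, (N <= n)%N -> ip (S n) w = c) -> ip v w = c.
Proof.
move=> cS Lw E; apply/eqP; rewrite -subr_eq0; apply/eqP; apply: sqmod_eq0.
have h := L2cvg_ip cS Lw; apply: (cvg_unique _ _ h) => //.
apply: cvg_near_cst; exists N => // n /= Nn.
by rewrite E// -opprB sqmodN.
Qed.

(** Functions are not identified modulo null sets, so a limit has to be exchanged explicitly for
    another function at distance 0. *)
Lemma L2cvg_null S v w : L2cvg S v -> L2w m w -> nrm (fun p => w p - v p) = 0 -> L2cvg S w.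
Proof.
move=> [LS Lv vc] Lw o0; split => //; apply/cvgrPdist_le => e e0.
have e2 : 0 < e / 2 by rewrite divr_gt0.
move/cvgrPdist_le: vc => /(_ _ e2)[N _ NP]; exists N => // n /= Nn.
have := NP n Nn; rewrite /= !sub0r !normrN !ger0_norm ?nrm_ge0// => h.
have := nrmB_le (L2wB (LS n) Lv) (L2wB Lw Lv); rewrite o0.
rewrite (_ : (fun p => S n p - v p - (w p - v p)) = fun p => S n p - w p); first by lra.
by apply/funext => p; ring.
Qed.

Section OrthogonalSeries.
Variables (E : nat -> R * R -> R[i]) (c : nat -> R[i]) (K : R).
Hypothesis LE : forall k, L2w m (E k).
Hypothesis oE : forall j k, j != k -> ip (E j) (E k) = 0.
Hypothesis cK : forall N, \sum_(0 <= k < N) sqmod (c k) * nrm (E k) <= K.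

Lemma orthogonal_series_cvg :
  exists v, L2cvg (fun n p => \sum_(0 <= k < n) c k * E k p) v.
Proof.
pose S n p := \sum_(0 <= k < n) c k * E k p.
have LS n : L2w m (S n) by apply: L2w_sum => k; exact: L2wZ.
suff [v [Lv vc]] : exists v, L2w m v /\ nrm (fun p => S n p - v p) @[n --> \oo] --> (0 : R).
  by exists v; split.
apply: L2w_complete => // e e0.
pose T n := \sum_(0 <= k < n) sqmod (c k) * nrm (E k).
have Tcat i j : (i <= j)%N -> T j = T i + \sum_(i <= k < j) sqmod (c k) * nrm (E k).
  by move=> ij; rewrite /T (big_cat_nat (n := i)).
have ndT : nondecreasing_seq T.
  move=> i j ij; rewrite (Tcat i j)// lerDl sumr_ge0// => k _.
  by rewrite mulr_ge0 ?sqmod_ge0 ?nrm_ge0.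
have cT : cvgn T.
  by apply: nondecreasing_is_cvgn => //; exists K => _ [n _ <-]; exact: cK.
have e2 : 0 < e / 2 by rewrite divr_gt0.
have /cvgrPdist_le/(_ _ e2)[N _ NP] : T @ \oo --> limn T by exact: cT.
have le i j : (N <= i)%N -> (i <= j)%N -> nrm (fun p => S j p - S i p) <= e.
  move=> Ni ij; rewrite (_ : (fun _ => _) = fun p => \sum_(i <= k < j) c k * E k p); last first.
    by apply/funext => p; rewrite /S (big_cat_nat (n := i))//=; ring.
  rewrite nrm_sum_ortho//; have -> : \sum_(i <= k < j) sqmod (c k) * nrm (E k) = T j - T i.
    by rewrite (Tcat i j)// addrC addKr.
  have := NP i Ni; have := NP j (leq_trans Ni ij); rewrite /= !ler_norml; lra.
exists N => i j Ni Nj; have [ij|/ltnW ji] := leqP i j; last exact: le.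
by rewrite nrm_sym; exact: le.
Qed.

(** The factor 2 comes from [nrmD_le]; it is harmless for compactness and spares an exact Parseval
    identity. *)
Lemma orthogonal_series_tail v N (D : R) : L2cvg (fun n p => \sum_(0 <= k < n) c k * E k p) v ->
  (forall M, (N <= M)%N -> \sum_(N <= k < M) sqmod (c k) * nrm (E k) <= D) ->
  nrm (fun p => v p - \sum_(0 <= k < N) c k * E k p) <= 2 * D.
Proof.
move=> [LS Lv vc] DP; apply/ler_addgt0Pr => e e0.
have e2 : 0 < e / 2 by rewrite divr_gt0.
have /cvgrPdist_le/(_ _ e2)[M _ MP] := vc.
pose n := maxn N M.
pose S n p := \sum_(0 <= k < n) c k * E k p.
have Ln : L2w m (fun p => S n p - v p) by exact: L2wB (LS n) Lv.
have LN : L2w m (fun p => S N p - S n p) by exact: L2wB (LS N) (LS n).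
have := MP n (leq_maxr _ _); rewrite /= sub0r normrN ger0_norm ?nrm_ge0// => h1.
have := DP n (leq_maxl _ _); rewrite -nrm_sum_ortho ?leq_maxl// => h2.
rewrite nrm_sym (_ : (fun _ => _) = fun p => (S N p - S n p) + (S n p - v p)); last first.
  by apply/funext => p; rewrite addrA subrK.
apply: (le_trans (nrmD_le LN Ln)); rewrite nrm_sym.
rewrite (_ : (fun p => S n p - S N p) = fun p => \sum_(N <= k < n) c k * E k p); last first.
  by apply/funext => p; rewrite /S (big_cat_nat (n := N)) ?leq_maxl//=; ring.
apply: lerD; first by rewrite ler_pM2l.
by move: h1; rewrite -/(S n _); lra.
Qed.
End OrthogonalSeries.
End CanonicalSeries.

(** * Expansion of a datum and of its canonical solution *)

Section CanonicalSolution.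
Variables (R : realType) (m : R).
Hypothesis hm : 2 <= m.
Implicit Types (p : R * R) (u v w g : R * R -> R[i]).

Local Notation Re := complex.Re.
Local Notation Im := complex.Im.
Local Notation ip := (inner m).
Local Notation nrm := (L2norm2 m).
Local Notation c2 := (ck2 m).
Local Notation Z := (fun k p => toC p ^+ k).

Lemma realc_sum (I : Type) (s : seq I) (x : I -> R) :
  (\sum_(i <- s) x i)%:C = \sum_(i <- s) (x i)%:C :> R[i].
Proof. by rewrite (big_morph _ (realcD (R := R)) (erefl _)). Qed.

Lemma L2w_toCX k : L2w m (Z k). Proof. exact: (A2w_toCX hm k).2. Qed.

Lemma ip_toCX j k : ip (Z j) (Z k) = if j == k then (c2 k)%:C else 0.
Proof.
have E i : Z i = @mono R i 0 by apply/funext => p; rewrite /mono expr0 mulr1.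
by rewrite !E ip_mono// addn0 add0n; case: eqP => // ->.
Qed.

Lemma nrm_toCX k : nrm (Z k) = c2 k.
Proof. by have := ip_toCX k k; rewrite eqxx ip_nrm => -[]. Qed.

Definition coef f (k : nat) : R[i] := ip f (Z k) * ((c2 k)^-1)%:C.

Section Solution.
Variables f u : R * R -> R[i].
Hypothesis Af : A2w m f.
Hypothesis fu : canonical_solution m f u.

Let Lf : L2w m f. Proof. exact: Af.2. Qed.
Let Lu : L2w m u. Proof. exact: fu.1. Qed.

Lemma coefE k : ip f (Z k) = coef f k * (c2 k)%:C.
Proof.
rewrite /coef -mulrA -realcM mulVf ?mulr1//; exact/lt0r_neq0/ck2_gt0.
Qed.

Lemma coef_bessel N : \sum_(0 <= k < N) sqmod (coef f k) * c2 k <= nrm f.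
Proof.
pose P p := \sum_(0 <= k < N) coef f k * Z k p.
have LcZ k : L2w m (fun p => coef f k * Z k p) by apply: L2wZ; exact: L2w_toCX.
have LP : L2w m P by exact: L2w_sum.
have := nrm_ge0 m (fun p => P p - f p); rewrite nrmB//.
have -> : nrm P = \sum_(0 <= k < N) sqmod (coef f k) * c2 k.
  rewrite nrm_sum_ortho//.
  - by apply: eq_bigr => k _; rewrite nrm_toCX.
  - by move=> k; exact: L2w_toCX.
  - by move=> j k jk; rewrite ip_toCX (negbTE jk).
have -> : ip P f = (\sum_(0 <= k < N) sqmod (coef f k) * c2 k)%:C.
  rewrite realc_sum ip_suml//; apply: eq_bigr => k _.
  rewrite ipZl//; last exact: L2w_toCX.
  rewrite (ipJ Lf (L2w_toCX k)) coefE conjM conjC mulrA sqmodE -realcM //.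
by rewrite ReC; lra.
Qed.

Lemma partial_cvg : L2cvg m (fun n p => \sum_(0 <= k < n) coef f k * Z k p) f.
Proof.
have LcZ k : L2w m (fun p => coef f k * Z k p) by apply: L2wZ; exact: L2w_toCX.
have [v cv] := @orthogonal_series_cvg R m Z (coef f) (nrm f) L2w_toCX
  ltac:(by move=> j k jk; rewrite ip_toCX (negbTE jk))
  ltac:(by move=> N; under eq_bigr do rewrite nrm_toCX; exact: coef_bessel).
have [LS Lv vc] := cv.
have LB : L2w m (fun p => f p - v p) by exact: L2wB.
have wcl : wclosed m (fun p => f p - v p).
  split => // phi tp.
  have m0 : 0 <= m by rewrite (le_trans _ hm).
  have Lg : L2w m (dual m (dbar phi)) by apply: dual_L2w => //; exact: test_bcs.
  rewrite (cint_dual m) ipBl// -cint_dual (A2w_wclosed Af).2// sub0r.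
  rewrite (@L2cvg_ip_const _ _ _ _ _ 0 0%N cv Lg) ?oppr0// => n _.
  rewrite ip_suml// big1// => k _.
  rewrite ipZl// ?[X in _ * X](_ : _ = 0) ?mulr0//; last exact: L2w_toCX.
  by rewrite -cint_dual (A2w_wclosed (A2w_toCX hm k)).2.
have o0 : nrm (fun p => f p - v p) = 0.
  apply: wclosed_unique => // j.
  rewrite ipBl//; last exact: L2w_toCX.
  rewrite (@L2cvg_ip_const _ _ _ _ _ (ip f (Z j)) j.+1 cv (L2w_toCX j)) ?subrr// => n jn.
  rewrite ip_suml//; last exact: L2w_toCX.
  rewrite (bigD1_seq j) ?mem_index_iota ?iota_uniq//= big1 ?addr0.
    by rewrite ipZl ?ip_toCX ?eqxx ?coefE//; exact: L2w_toCX.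
  move=> k kj; rewrite ipZl ?ip_toCX ?(negbTE kj) ?mulr0//; exact: L2w_toCX.
exact: L2cvg_null cv Lf o0.
Qed.

Lemma weak_dbar_partial n phi : test_fun phi ->
  ip (fun p => \sum_(0 <= k < n) coef f k * sol m k p) (dual m (dbar phi)) =
  - ip (fun p => \sum_(0 <= k < n) coef f k * Z k p) (dual m (fun p => (phi p)%:C)).
Proof.
move=> tp; have m0 : 0 <= m by rewrite (le_trans _ hm).
have Lg : L2w m (dual m (dbar phi)) by apply: dual_L2w => //; exact: test_bcs.
have Lg' : L2w m (dual m (fun p => (phi p)%:C)) by apply: dual_L2w => //; exact: test_bcs_real.
rewrite !ip_suml//; try by move=> k; apply: L2wZ; (exact: L2w_toCX || exact: L2w_sol).
rewrite -sumrN; apply: eq_bigr => k _.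
rewrite !ipZl//; [|exact: L2w_toCX|exact: L2w_sol].
by rewrite -!cint_dual sol_weak_dbar// mulrN.
Qed.

(** Since [nrm (sol m k)] is c_k^2 times the gap, a bound on the gaps from N on converts Bessel's
    inequality for f into one for its image. *)
Lemma sol_partial_bound (D : R) N M : (N <= M)%N ->
  (forall k, (N <= k)%N -> gap m k <= D) ->
  \sum_(N <= k < M) sqmod (coef f k) * nrm (sol m k) <= D * nrm f.
Proof.
move=> NM DP; have D0 : 0 <= D by rewrite (le_trans (gap_ge0 hm N)) ?DP.
have D0' : 0 <= D * nrm f - D * \sum_(0 <= k < M) sqmod (coef f k) * c2 k.
  by rewrite -mulrBr mulr_ge0// subr_ge0 coef_bessel.
rewrite subr_ge0 in D0'; apply: le_trans D0'.
rewrite (big_cat_nat (m := 0) (n := N))//= mulrDr; apply: ler_wpDl.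
  rewrite mulr_ge0// sumr_ge0// => k _.
  by rewrite mulr_ge0 ?sqmod_ge0// ltW// ck2_gt0.
rewrite mulr_sumr !big_nat ler_sum// => k /andP[Nk _].
rewrite nrm_sol// mulrA [leRHS]mulrC ler_wpM2l ?DP//.
by rewrite mulr_ge0 ?sqmod_ge0// ltW// ck2_gt0.
Qed.

Lemma sol_partial_cvg (B : R) : (forall k, gap m k <= B) ->
  L2cvg m (fun n p => \sum_(0 <= k < n) coef f k * sol m k p) u.
Proof.
move=> gB.
have Lsol k : L2w m (sol m k) by exact: L2w_sol.
have Lc k : L2w m (fun p => coef f k * sol m k p) by exact: L2wZ.
have [v cv] := @orthogonal_series_cvg R m (sol m) (coef f) (B * nrm f) Lsol
  ltac:(by move=> j k jk; rewrite ip_sol// (negbTE jk))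
  ltac:(by move=> N; apply: sol_partial_bound).
have [LS Lv vc] := cv.
have LB : L2w m (fun p => u p - v p) by exact: L2wB.
apply: (L2cvg_null cv Lu); apply: wclosed_unique => //.
  split => // phi tp.
  have m0 : 0 <= m by rewrite (le_trans _ hm).
  have Lg : L2w m (dual m (dbar phi)) by apply: dual_L2w => //; exact: test_bcs.
  have Lg' : L2w m (dual m (fun p => (phi p)%:C)) by apply: dual_L2w => //; exact: test_bcs_real.
  rewrite (cint_dual m) ipBl// -cint_dual fu.2.1// (cint_dual m).
  rewrite (L2cvg_ip_opp cv partial_cvg Lg Lg') ?subrr// => n.
  exact: weak_dbar_partial.
move=> j; have Az := A2w_toCX hm j.
rewrite ipBl//; last exact: L2w_toCX.
rewrite fu.2.2// (@L2cvg_ip_const _ _ _ _ _ 0 0%N cv (L2w_toCX j)) ?subrr// => n _.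
rewrite ip_suml//; last exact: L2w_toCX.
rewrite big1// => k _; rewrite ipZl//; last exact: L2w_toCX.
by rewrite sol_ortho// mulr0.
Qed.

(** Truncation at N is a finite-rank approximation of the solution operator, uniform on bounded sets
    with an error governed by the later gaps. *)
Lemma canonical_tail (B D : R) N : (forall k, gap m k <= B) ->
  (forall k, (N <= k)%N -> gap m k <= D) ->
  nrm (fun p => u p - \sum_(0 <= k < N) coef f k * sol m k p) <= 2 * (D * nrm f).
Proof.
move=> gB gD; apply: orthogonal_series_tail (sol_partial_cvg gB) _.
- by move=> k; exact: L2w_sol.
- by move=> j k jk; rewrite ip_sol// (negbTE jk).
- by move=> M NM; exact: sol_partial_bound.
Qed.

End Solution.
End CanonicalSolution.

(** * Compactness *)

Section Compactness.
Variable R : realType.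
Implicit Types (p : R * R).

(** A cluster point exists by compactness, and along an ultrafilter it is a limit: otherwise the
    indices with x far from [a] would form a large set. *)
Lemma ultra_bounded_cvg (U : set_system nat) (x : nat -> R) (B : R) : UltraFilter U ->
  (forall n, `|x n| <= B) -> exists a, forall e, 0 < e -> U [set n | `|x n - a| < e].
Proof.
move=> uU xB; have pU := @ultra_proper _ _ uU.
have [a [_ ca]] : exists a, (`[- B, B]%classic `&` cluster (x @ U)) a.
  apply: segment_compact; suff : U (x @^-1` `[- B, B]%classic) by [].
  rewrite (_ : _ @^-1` _ = setT); first exact: filterT.
  by apply/seteqP; split => // n _ /=; rewrite in_itv/= -ler_norml.
exists a => e e0; have [//|UC] := in_ultra_setVsetC [set n | `|x n - a| < e] uU.
have [z [/= zb]] := ca _ _ (UC : (x @ U) [set z | ~ `|z - a| < e]) (nbhsx_ballx a e e0).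
by rewrite /ball/= distrC.
Qed.

Lemma ultra_coef_cvg (U : set_system nat) (x : nat -> R[i]) (B : R) : UltraFilter U ->
  (forall n, sqmod (x n) <= B) ->
  exists a, forall e, 0 < e -> U [set n | sqmod (x n - a) < e].
Proof.
move=> uU xB; have pU := @ultra_proper _ _ uU.
have bnd (t : R) : `|t| <= 1 + t ^+ 2 by rewrite ler_norml; apply/andP; split; nra.
have bR n : `|complex.Re (x n)| <= 1 + B.
  by rewrite (le_trans (bnd _))// lerD2l (le_trans _ (xB n))// lerDl sqr_ge0.
have bI n : `|complex.Im (x n)| <= 1 + B.
  by rewrite (le_trans (bnd _))// lerD2l (le_trans _ (xB n))// lerDr sqr_ge0.
have [a aP] := ultra_bounded_cvg uU bR; have [b bP] := ultra_bounded_cvg uU bI.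
exists (a +i* b)%C => e e0; pose d := Num.min 1 (e / 2).
have d0 : 0 < d by rewrite lt_min ltr01 divr_gt0.
apply: filterS (filterI (aP d d0) (bP d d0)) => n [/= h1 h2].
have sq (t : R) : `|t| < d -> t ^+ 2 < e / 2.
  rewrite lt_min => /andP[t1 te]; rewrite -real_normK ?num_real// expr2.
  by rewrite (le_lt_trans _ te)// ler_piMr// ltW.
rewrite /sqmod !ReImE [e]splitr ltrD//; exact: sq.
Qed.

(** The tails belong to [U], so each [A n] contains indices beyond any bound; the requirement may
    become stricter with n. *)
Lemma ultra_subsequence (U : set_system nat) (A : nat -> set nat) : UltraFilter U ->
  \oo `<=` U -> (forall n, U (A n)) ->
  exists s : nat -> nat, (forall n, (s n < s n.+1)%N) /\ forall n, A n (s n).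
Proof.
move=> uU ooU UA; have pU := @ultra_proper _ _ uU.
have ex n N : exists j, (N < j)%N /\ A n j.
  have UN : U [set j | (N < j)%N] by apply: ooU; exists N.+1.
  by have [j [jN jA]] := filter_ex (filterI UN (UA n)); exists j.
have [g gP] := choice (fun nN : nat * nat => ex nN.1 nN.2).
pose fix s n := if n is n'.+1 then g (n, s n') else g (0, 0)%N.
exists s; split => n; first exact: (gP (n.+1, s n)).1.
by case: n => [|n]; [exact: (gP (0, 0)%N).2|exact: (gP (n.+1, s n)).2].
Qed.

Lemma strictly_increasing_ge (s : nat -> nat) : (forall n, (s n < s n.+1)%N) ->
  forall n, (n <= s n)%N.
Proof. by move=> h; elim=> // n IH; exact: leq_ltn_trans IH (h n). Qed.

Lemma half_bound (q t e : R) : 16 * q < t * e -> 8 * q <= e / 2 * t.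
Proof. by lra. Qed.

(** Epsilon bookkeeping for [compact_of_gap]: [a] and [b] are two truncation tails, [x] their
    difference, [y] the difference of the heads. *)
Lemma three_part_bound (x y a b t h e : R) : x <= 2 * a + 2 * b -> a <= 2 * t ->
  b <= 2 * t -> 16 * t <= e / 2 -> y <= 4 * h -> 8 * h <= e / 2 ->
  2 * x + 2 * y <= e.
Proof. by lra. Qed.

Lemma separated_contra (x y a b e : R) : 0 < e -> x + y <= 2 * a + 2 * b ->
  e < x -> e < y -> a <= e / 4 -> b <= e / 4 -> False.
Proof. by lra. Qed.

Variable m : R.
Hypothesis hm : 2 <= m.
Local Notation ip := (inner m).
Local Notation nrm := (L2norm2 m).
Local Notation c2 := (ck2 m).

Lemma coef_bound f k : A2w m f -> sqmod (coef m f k) <= nrm f / c2 k.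
Proof.
move=> Af; rewrite ler_pdivlMr; last exact: ck2_gt0.
apply: le_trans (coef_bessel hm Af k.+1); rewrite big_nat_recr//= lerDr sumr_ge0// => j _.
by rewrite mulr_ge0 ?sqmod_ge0// ltW// ck2_gt0.
Qed.

(** The limit concerns [gap] from index 1 on; index 0 is caught by the finite sum, which runs up to
    N. *)
Lemma gap_bounded : (fun k => gap m k.+1) @ \oo --> (0 : R) -> exists B, forall k, gap m k <= B.
Proof.
move=> h; move/cvgrPdist_le: h => /(_ _ ltr01)[N _ NP].
exists (1 + \sum_(k < N.+1) gap m k) => k.
have S0 : 0 <= \sum_(k < N.+1) gap m k by rewrite sumr_ge0// => i _; exact: gap_ge0.
have [kN|Nk] := ltnP k N.+1.
  rewrite (bigD1 (Ordinal kN))//= addrCA lerDl addr_ge0// sumr_ge0// => i _; exact: gap_ge0.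
case: k Nk => // k Nk; have := NP k Nk.
by rewrite /= sub0r normrN ger0_norm ?gap_ge0// => h1; rewrite (le_trans h1)// lerDl.
Qed.

Lemma compact_of_gap : (fun k => gap m k.+1) @ \oo --> (0 : R) -> Sm_compact m.
Proof.
move=> g0 f u Af [M fM] cu; have [B gB] := gap_bounded g0.
have Lu n : L2w m (u n) := (cu n).1.
have M0 : 0 <= M by rewrite (le_trans (nrm_ge0 m (f 0%N))).
(* An ultrafilter replaces the diagonal extraction over the coefficients. *)
have [U [uU ooU]] := @ultraFilterLemma _ \oo _.
have pU := @ultra_proper _ _ uU.
have cb k n : sqmod (coef m (f n) k) <= M / c2 k.
  rewrite (le_trans (coef_bound k (Af n)))// ler_wpM2r// invr_ge0 ltW//; exact: ck2_gt0.
have [al alP] := choice (fun k => ultra_coef_cvg uU (cb k)).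
(* Tying the number of controlled coefficients and the accuracy to the same N lets one subsequence
   settle all coefficients. *)
have UA N : U [set n | forall k, (k < N)%N -> sqmod (coef m (f n) k - al k) < N.+1%:R^-1].
  have Np : 0 < N.+1%:R^-1 :> R by rewrite invr_gt0.
  move: (N.+1%:R^-1) Np => d d0; elim: N => [|K IH]; first by apply: filterS filterT => n.
  apply: filterS (filterI IH (alP K _ d0)) => n [/= h1 h2] k.
  by rewrite ltnS leq_eqVlt => /orP[/eqP ->|]; [exact: h2|exact: h1].
have [s [s_lt sP]] := ultra_subsequence uU ooU UA.
suff : exists v, L2w m v /\ nrm (fun p => u (s n) p - v p) @[n --> \oo] --> (0 : R).
  by move=> [v [Lv vc]]; exists s, v.
apply: (L2w_complete (u := fun n => u (s n))) => // e e0.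
(* The two tails will contribute 16 D M <= e / 2; [M + 1] avoids dividing by 0. *)
pose D := e / (32 * (M + 1)).
have D0 : 0 < D by rewrite divr_gt0// mulr_gt0// ltr_wpDl.
move/cvgrPdist_le: g0 => /(_ _ D0)[N0 _ N0P].
have gD k : (N0.+1 <= k)%N -> gap m k <= D.
  case: k => // k /N0P/=; rewrite sub0r normrN ger0_norm//; exact: gap_ge0.
have Lsol k : L2w m (sol m k) by exact: L2w_sol.
pose S n p := \sum_(0 <= k < N0.+1) coef m (f (s n)) k * sol m k p.
have LS n : L2w m (S n) by apply: L2w_sum => k; exact: L2wZ.
have LuS n : L2w m (fun p => u (s n) p - S n p) by exact: L2wB.
have tail n : nrm (fun p => u (s n) p - S n p) <= 2 * (D * M).
  apply: (le_trans (canonical_tail hm (Af (s n)) (cu (s n)) gB gD)).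
  by rewrite !ler_pM2l.
pose Q := \sum_(0 <= k < N0.+1) nrm (sol m k).
have Q0 : 0 <= Q by rewrite sumr_ge0// => k _; exact: nrm_ge0.
(* From [N] on the first N0 + 1 coefficients are all controlled, and the heads contribute 8 Q / (N +
   1) <= e / 2. *)
pose N := maxn N0.+1 (Num.truncn (16 * Q / e)).
have NQ : 8 * Q * N.+1%:R^-1 <= e / 2.
  rewrite ler_pdivrMr ?ltr0n//.
  have h : 16 * Q / e < N.+1%:R.
    by rewrite (lt_le_trans (truncnS_gt _))// ler_nat ltnS leq_maxr.
  move: h; rewrite ltr_pdivrMr//; exact: half_bound.
exists N => i j Ni Nj.
have coefN n k : (N <= n)%N -> (k < N0.+1)%N ->
    sqmod (coef m (f (s n)) k - al k) <= N.+1%:R^-1.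
  move=> Nn kN; apply: le_trans (ltW (sP n k _)) _.
    by rewrite (leq_trans kN)// (leq_trans (leq_maxl _ _) Nn).
  by rewrite lef_pV2 ?posrE ?ltr0n// ler_nat.
have head : nrm (fun p => S i p - S j p) <= 4 * (N.+1%:R^-1 * Q).
  rewrite (_ : (fun _ => _) =
      fun p => \sum_(0 <= k < N0.+1) (coef m (f (s i)) k - coef m (f (s j)) k) * sol m k p); last first.
    by apply/funext => p; rewrite /S -sumrB; apply: eq_bigr => k _; rewrite mulrBl.
  rewrite nrm_sum_ortho//; last by move=> a b ab; rewrite ip_sol// (negbTE ab).
  rewrite mulrA /Q mulr_sumr !big_nat ler_sum// => k /andP[_ kN].
  rewrite ler_wpM2r ?nrm_ge0//.
  rewrite (_ : _ - _ = (coef m (f (s i)) k - al k) + - (coef m (f (s j)) k - al k)); last by ring.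
  apply: (le_trans (sqmodD_le _ _)); rewrite sqmodN.
  rewrite (_ : 4 * _ = 2 * N.+1%:R^-1 + 2 * N.+1%:R^-1); last by rewrite -mulrDl -natrD.
  by apply: lerD; rewrite ler_pM2l//; exact: coefN.
rewrite (_ : (fun _ => _) = fun p => ((u (s i) p - S i p) - (u (s j) p - S j p)) + (S i p - S j p)); last first.
  by apply/funext => p; ring.
apply: (le_trans (nrmD_le (L2wB (LuS i) (LuS j)) (L2wB (LS i) (LS j)))).
have DM : 16 * (D * M) <= e / 2.
  have M1 : 0 < M + 1 by rewrite ltr_wpDl.
  have M1' : M / (M + 1) <= 1 by rewrite ler_pdivrMr// mul1r lerDl.
  have -> : 16 * (D * M) = e / 2 * (M / (M + 1)) by rewrite /D; field; rewrite gt_eqF.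
  by rewrite ler_piMr// ltW// divr_gt0.
apply: (three_part_bound (nrmB_le (LuS i) (LuS j)) (tail i) (tail j) DM head).
by rewrite [_ * Q]mulrC mulrA.
Qed.

Lemma cmodM (a b : R[i]) : cmod (a * b) = cmod a * cmod b.
Proof. by rewrite /cmod sqmodM sqrtrM// sqmod_ge0. Qed.

Lemma entireZ (c : R[i]) h : entire h -> entire (fun p => c * h p).
Proof.
move=> eh p; have [l lP] := eh p; exists (c * l) => e e0.
have c0 : 0 < cmod c + 1 by rewrite ltr_wpDl// sqrtr_ge0.
have [d d0 dP] := lP _ (divr_gt0 e0 c0); exists d => // q qp qd.
have := dP q qp qd; set x := _ / _ - l => xe.
rewrite (_ : _ - _ = c * x); last by rewrite /x; ring.
rewrite cmodM; apply: (@le_lt_trans _ _ ((cmod c + 1) * cmod x)).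
  by rewrite ler_wpM2r ?sqrtr_ge0// lerDl.
by rewrite mulrC -ltr_pdivlMr.
Qed.

Lemma A2wZ (c : R[i]) h : A2w m h -> A2w m (fun p => c * h p).
Proof. by move=> [eh Lh]; split; [exact: entireZ|exact: L2wZ]. Qed.

Lemma canonical_solutionZ (c : R[i]) f u : A2w m f -> canonical_solution m f u ->
  canonical_solution m (fun p => c * f p) (fun p => c * u p).
Proof.
move=> [_ Lf] [Lu [uf ou]]; have m0 : 0 <= m by rewrite (le_trans _ hm).
split; first exact: L2wZ.
split => [phi tp|h Ah]; last by rewrite ipZl ?ou ?mulr0//; exact: Ah.2.
have Lg : L2w m (dual m (dbar phi)) by apply: dual_L2w => //; exact: test_bcs.
have Lg' : L2w m (dual m (fun p => (phi p)%:C)) by apply: dual_L2w => //; exact: test_bcs_real.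
by rewrite !(cint_dual m) !ipZl// -!cint_dual uf// mulrN.
Qed.

Lemma canonical_sol k : canonical_solution m (fun p => toC p ^+ k) (sol m k).
Proof.
split; first exact: L2w_sol.
by split => [|h]; [exact: sol_weak_dbar|exact: sol_ortho].
Qed.

(** If gaps above e occurred at arbitrarily large indices, the normalised monomials there would form
    a bounded sequence whose distinct images are orthogonal with squared norm above e, hence at
    squared distance above 2 e: no subsequence could converge. *)
Lemma gap_of_compact : Sm_compact m -> (fun k => gap m k.+1) @ \oo --> (0 : R).
Proof.
move=> Sc; apply/cvgrPdist_le => e e0; apply: contrapT => nf.
have ex N : exists k, (N <= k)%N /\ e < gap m k.+1.
  apply: contrapT => nk; apply: nf; exists N => // k /= Nk.
  rewrite sub0r normrN ger0_norm ?gap_ge0// leNgt; apply/negP => ke.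
  by apply: nk; exists k.
have [phi phiP] := choice ex.
pose c n : R[i] := ((Num.sqrt (c2 (phi n).+1))^-1)%:C.
have cE n : sqmod (c n) = (c2 (phi n).+1)^-1.
  by rewrite sqmodC exprVn sqr_sqrtr// ltW// ck2_gt0.
have cn0 n : c2 (phi n).+1 != 0 by rewrite gt_eqF// ck2_gt0.
pose u n p := c n * sol m (phi n).+1 p.
have Lu n : L2w m (u n) by apply: L2wZ; exact: L2w_sol.
have nu n : nrm (u n) = gap m (phi n).+1.
  by rewrite /u nrmZ ?cE ?nrm_sol ?mulKf//; exact: L2w_sol.
have [s [v [s_lt [Lv vc]]]] := Sc (fun n p => c n * toC p ^+ (phi n).+1) u
  (fun n => A2wZ (c n) (A2w_toCX hm (phi n).+1))
  ltac:(by exists 1 => n; rewrite nrmZ ?cE ?nrm_toCX ?mulVf//; exact: L2w_toCX)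
  (fun n => canonical_solutionZ (c n) (A2w_toCX hm _) (canonical_sol _)).
have e4 : 0 < e / 4 by rewrite divr_gt0.
move/cvgrPdist_le: vc => /(_ _ e4)[N _ NP].
have NP' n : (N <= n)%N -> nrm (fun p => u (s n) p - v p) <= e / 4.
  by move=> /NP /=; rewrite sub0r normrN ger0_norm ?nrm_ge0.
(* [phi] need not be injective, so [j] is chosen far out: phi (s j) >= s j >= j > phi (s N). *)
pose j := maxn N (phi (s N)).+1.
have jN : phi (s N) != phi (s j).
  rewrite ltn_eqF// (@leq_trans j) ?leq_maxr//.
  by rewrite (leq_trans (strictly_increasing_ge s_lt j))// (phiP (s j)).1.
have Lb n : L2w m (fun p => u (s n) p - v p) by exact: L2wB.
have := nrmB_le (Lb N) (Lb j).
rewrite (_ : (fun p => u (s N) p - v p - (u (s j) p - v p)) = fun p => u (s N) p - u (s j) p); last first.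
  by apply/funext => p; ring.
have o0 : ip (u (s N)) (u (s j)) = 0.
  have Lsol k : L2w m (sol m k) by exact: L2w_sol.
  by rewrite /u ipZl ?ipZr ?ip_sol ?eqSS ?(negbTE jN) ?mulr0//; exact: L2wZ.
rewrite nrmB// o0 Re0 mulr0 subr0 !nu.
move=> le; exact: (separated_contra e0 le (phiP _).2 (phiP _).2 (NP' _ (leqnn _)) (NP' _ (leq_maxl _ _))).
Qed.
End Compactness.

(** The sequence is [gap m k.+1] by conversion; the shift of the index by one is what makes c_(k-1)
    meaningful from the first term on. *)
Theorem theorem3p1 (R : realType) (m : R) (hm : 2 <= m) :
  Sm_compact m <->
  (fun k : nat => ck2 m k.+2 / ck2 m k.+1 - ck2 m k.+1 / ck2 m k) @ \oo --> (0 : R).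
Proof. by split; [exact: gap_of_compact|exact: compact_of_gap]. Qed.
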